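(* There is a one-to-one correspondence between Lie bialgebroids and degree $1$ $PQ$-manifolds $(E[1],Q,\{\cdot,\cdot\})$.
   Context: For a vector bundle $E\to M$, $E[1]$ is the $1$-manifold with body $M$ and functions $C_\bullet(E[1])=\Gamma(\wedge^\bullet E^* )$. A vector field of degree $k$ is a degree $k$ derivation of $C_\bullet(E[1])$. A degree $1$ $PQ$-manifold is a triple $(E[1],Q,\{\cdot,\cdot\})$ where: (i) $\{\cdot,\cdot\}:C_i\times C_j\to C_{i+j-1}$ is a Poisson bracket of degree $-1$, i.e. with $k=-1$ it is bilinear and satisfies $\{s_1,s_2\}=-(-1)^{(|s_1|+k)(|s_2|+k)}\{s_2,s_1\}$, $\{s_1,s_2\wedge s_3\}=\{s_1,s_2\}\wedge s_3+(-1)^{(|s_1|+k)|s_2|}s_2\wedge\{s_1,s_3\}$, $\{s_1,\{s_2,s_3\}\}=\{\{s_1,s_2\},s_3\}+(-1)^{(|s_1|+k)(|s_2|+k)}\{s_2,\{s_1,s_3\}\}$; (ii) $Q$ is a degree $1$ vector field with $Q^2=0$; (iii) $Q$ is Poisson: $Q(\{s_1,s_2\})=\{Q(s_1),s_2\}+(-1)^{|s_1|-1}\{s_1,Q(s_2)\}$. A Lie algebroid $(E\to M,\rho,[\cdot,\cdot]_E)$ is a vector bundle with a bundle map $\rho:E\to TM$ over the identity and a Lie bracket on $\Gamma(E)$ with $[e,fe']_E=f[e,e']_E+\rho(e)(f)e'$. Its differential is the degree $1$ derivation $Q$ of $\Gamma(\wedge^\bullet E^* )$ given by $(Qs)(e_0,\dots,e_k)=\sum_i(-1)^i\rho(e_i)\big(s(e_0,\dots,\hat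 e_i,\dots,e_k)\big)+\sum_{i<j}(-1)^{i+j}s([e_i,e_j]_E,e_0,\dots,\hat e_i,\dots,\hat e_j,\dots,e_k)$; Lie algebroid structures on $E$ correspond bijectively to degree $1$ vector fields $Q$ on $E[1]$ with $Q^2=0$. A Lie algebroid structure on $E^*$ induces a degree $-1$ (Gerstenhaber) bracket on $\Gamma(\wedge^\bullet E^* )$ extending $\{\xi,f\}=\rho_{E^*}(\xi)(f)$, $\{\xi,\xi'\}=[\xi,\xi']_{E^*}$. A Lie bialgebroid is a Lie algebroid $(E\to M,\rho_E,[\cdot,\cdot]_E)$ whose dual $E^*\to M$ is also equipped with a Lie algebroid structure $(\rho_{E^*},[\cdot,\cdot]_{E^*})$ such that the differential $Q$ of $E$ is a derivation of the Gerstenhaber bracket on $\Gamma(\wedge^\bullet E^* )$: $Q\{s,s'\}=\{Q(s),s'\}+(-1)^{|s|-1}\{s,Q(s')\}$. The correspondence is the one induced by these identifications. *)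

(* Defs.v *)
From HB Require Import structures.
From mathcomp Require Import all_boot all_order all_algebra.
From mathcomp Require Import all_classical all_reals all_analysis.

Set Implicit Arguments.
Unset Strict Implicit.
Unset Printing Implicit Defensive.

Import Order.TTheory GRing.Theory Num.Theory.
Import numFieldNormedType.Exports.

Local Open Scope classical_set_scope.
Local Open Scope ring_scope.

(* [Ck k V f] and [Cinf V f] are meant for an open set V: the derivatives at
   points of V then depend only on the restriction of f to V. *)
Section Ck.
Variables (R : realType) (n : nat).
Implicit Types (V W : set 'rV[R]_n) (f g : 'rV[R]_n -> R).

Fixpoint Ck (k : nat) V f : Prop :=
  match k with
  | 0 => forall x, V x -> {for x, continuous f}
  | k'.+1 => (forall x, V x -> differentiable f x) /\
             (forall v, Ck k' V ('D_v f))
  end.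

Definition Cinf V f := forall k, Ck k V f.

Lemma Ck_sub k V W f : W `<=` V -> Ck k V f -> Ck k W f.
Proof.
move=> WV; elim: k f => [|k IH] f /=; first by move=> h x /WV/h.
by case=> h1 h2; split=> [x /WV/h1|v] //; exact: IH.
Qed.

Lemma Ck_local k V f :
  (forall x, V x -> exists2 W, W x & Ck k W f) -> Ck k V f.
Proof.
elim: k f => [|k IH] f /= h; first by move=> x /h[W Wx /(_ x Wx)].
split=> [x /h[W Wx [/(_ x Wx)]]|v] //.
by apply: IH => x /h[W Wx [_ hD]]; exists W.
Qed.

Lemma open_near_eq V f g : open V -> {in V, f =1 g} ->
  forall x, V x -> \near x, f x = g x.
Proof.
move=> oV fg x Vx; have := open_nbhs_nbhs (conj oV Vx).
by apply: filterS => y Vy; apply: fg; rewrite inE.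
Qed.

Lemma near_eq_differentiable f g x : (\near x, f x = g x) ->
  differentiable f x -> differentiable g x.
Proof.
move=> fg df; have fgx : f x = g x := nbhs_singleton fg.
have [dfc dfx] := (diff_locallyP _ _).1 df.
have dgx : g \o shift x = cst (g x) + 'd f x +o_ 0 id.
  apply/eqaddoP => e e0.
  have fg0 : \forall h \near 0, f (h + x) = g (h + x).
    by move/nbhs0P: fg; apply: filterS => h; rewrite addrC.
  have := (eqaddoP _ _ _ _).1 dfx e e0.
  by apply: filterS2 fg0 => h /= fgh; rewrite !fctE /= -fgh -fgx.
apply: (diff_locallyP x g).2; split; last by rewrite (diff_unique dfc dgx).
by rewrite (diff_unique dfc dgx).
Qed.

Lemma Ck_ext k V f g : open V -> {in V, f =1 g} -> Ck k V f -> Ck k V g.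
Proof.
move=> oV; elim: k f g => [|k IH] f g fg /=.
  move=> h x Vx; have fgx := open_near_eq oV fg Vx.
  have := h x Vx; rewrite /prop_for /continuous_at -(fg x (mem_set Vx)).
  exact: cvg_trans (near_eq_cvg fgx).
case=> h1 h2; split=> [x Vx|v].
  exact: near_eq_differentiable (open_near_eq oV fg Vx) (h1 _ Vx).
apply: IH (h2 v) => x; rewrite inE => Vx; apply: near_eq_derive.
exact: open_near_eq Vx.
Qed.

Lemma CkS k V f : Ck k.+1 V f -> Ck k V f.
Proof.
elim: k f => [|k IH] f /=.
  by case=> h _ x /h; exact: differentiable_continuous.
by case=> h1 h2; split=> // v; apply: IH; exact: h2.
Qed.

Lemma Ck_cst k V a : Ck k V (fun=> a).
Proof.
elim: k a => [|k IH] a /=; first by move=> x _; exact: cst_continuous.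
split=> [x _|v]; first exact: differentiable_cst.
by rewrite (_ : 'D_v _ = fun=> 0) //; apply/funext => x; exact: derive_cst.
Qed.

Lemma Ck_add k V f g : open V -> Ck k V f -> Ck k V g ->
  Ck k V (fun x => f x + g x).
Proof.
move=> oV; elim: k f g => [|k IH] f g /=.
  by move=> hf hg x Vx; apply: continuousD; [exact: hf|exact: hg].
case=> f1 f2 [g1 g2]; split=> [x Vx|v].
  by apply: differentiableD; [exact: f1|exact: g1].
apply: Ck_ext (IH _ _ (f2 v) (g2 v)) => // x; rewrite inE => Vx.
by rewrite -deriveD //; apply: diff_derivable; [exact: f1|exact: g1].
Qed.

Lemma Ck_mul k V f g : open V -> Ck k V f -> Ck k V g ->
  Ck k V (fun x => f x * g x).
Proof.
move=> oV; elim: k f g => [|k IH] f g hf hg.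
  by move=> x Vx; apply: continuousM; [exact: hf|exact: hg].
have [hf' hg'] := (CkS hf, CkS hg).
case: hf hg => f1 f2 [g1 g2]; split=> [x Vx|v].
  by apply: differentiableM; [exact: f1|exact: g1].
apply: Ck_ext (Ck_add oV (IH _ _ hf' (g2 v)) (IH _ _ hg' (f2 v))) => // x.
rewrite inE => Vx.
by rewrite -deriveM //; apply: diff_derivable; [exact: f1|exact: g1].
Qed.

End Ck.


Record chart (R : realType) (n : nat) (T : topologicalType) := Chart {
  c_dom : set T;
  c_cod : set 'rV[R]_n;
  c_map : T -> 'rV[R]_n;
  c_inv : 'rV[R]_n -> T;
  c_dom_open : open c_dom;
  c_cod_open : open c_cod;
  c_map_cod : forall x, c_dom x -> c_cod (c_map x);
  c_inv_dom : forall y, c_cod y -> c_dom (c_inv y);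
  c_mapK : forall x, c_dom x -> c_inv (c_map x) = x;
  c_invK : forall y, c_cod y -> c_map (c_inv y) = y;
  c_map_cont : {in c_dom, continuous c_map};
  c_inv_cont : {in c_cod, continuous c_inv} }.

(* the part of [U] seen in the chart [c], as a subset of R^n *)
Definition c_img R n T (c : chart R n T) (U : set T) : set 'rV[R]_n :=
  [set y | c_cod c y /\ U (c_inv c y)].

Record manifold (R : realType) (n : nat) := Manifold {
  m_space :> topologicalType;
  m_hausdorff : hausdorff_space m_space;
  m_second_countable : @second_countable m_space;
  m_atlas : set (chart R n m_space);
  m_cover : forall x, exists2 c, m_atlas c & c_dom c x;
  m_compat : forall c c', m_atlas c -> m_atlas c' ->
    forall i, Cinf (c_img c (c_dom c')) (fun y => c_map c' (c_inv c y) 0 i) }.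

Arguments m_atlas {R n} m _.

Definition smooth_on R n (M : manifold R n) (U : set M) (f : M -> R) :=
  forall c, m_atlas M c -> Cinf (c_img c U) (f \o c_inv c).

Section SmoothOn.
Variables (R : realType) (n : nat) (M : manifold R n).
Implicit Types (U : set M) (f g : M -> R).

Lemma open_c_img (c : chart R n M) U : open U -> open (c_img c U).
Proof.
move=> oU; rewrite openE => y [cy Uy].
have h1 := open_nbhs_nbhs (conj (@c_cod_open _ _ _ c) cy).
have h2 := c_inv_cont (mem_set cy) (open_nbhs_nbhs (conj oU Uy)).
by apply: filterS2 h1 h2 => z.
Qed.

Lemma smooth_ext U f g : open U -> (forall x, U x -> f x = g x) ->
  smooth_on U f -> smooth_on U g.
Proof.
move=> oU fg sf c ac k; apply: Ck_ext (sf c ac k); first exact: open_c_img.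
by move=> y; rewrite inE => -[_ /fg].
Qed.

Lemma smooth_sub U U' f : U' `<=` U -> smooth_on U f -> smooth_on U' f.
Proof.
by move=> UU' sf c ac k; apply: Ck_sub (sf c ac k) => y [? /UU'].
Qed.

Lemma smooth_local U f :
  (forall x, U x -> exists2 U', U' x & smooth_on U' f) -> smooth_on U f.
Proof.
move=> h c ac k; apply: Ck_local => y [cy /h[U' U'y sf]].
by exists (c_img c U') => //; exact: sf.
Qed.

Lemma smooth_cst U a : smooth_on U (fun=> a).
Proof. by move=> c ac k; exact: Ck_cst. Qed.

Lemma smooth_add U f g : open U -> smooth_on U f -> smooth_on U g ->
  smooth_on U (fun x => f x + g x).
Proof.
by move=> oU sf sg c ac k; apply: Ck_add;
  [exact: open_c_img|exact: sf|exact: sg].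
Qed.

Lemma smooth_mul U f g : open U -> smooth_on U f -> smooth_on U g ->
  smooth_on U (fun x => f x * g x).
Proof.
by move=> oU sf sg c ac k; apply: Ck_mul;
  [exact: open_c_img|exact: sf|exact: sg].
Qed.

Lemma smooth_sum U (I : Type) (s : seq I) (P : pred I) (F : I -> M -> R) :
  open U -> (forall i, smooth_on U (F i)) ->
  smooth_on U (fun x => \sum_(i <- s | P i) F i x).
Proof.
move=> oU sF; rewrite (_ : (fun x => _) = \sum_(i <- s | P i) F i); last first.
  by apply/funext => x; rewrite fct_sumE.
elim/big_rec: _ => [|i f _ sf]; first exact: smooth_cst.
exact: smooth_add.
Qed.

End SmoothOn.

Section Functions.
Variables (R : realType) (n : nat) (M : manifold R n).

Record cinf := CInf { cinf_fun :> M -> R; cinfP : smooth_on setT cinf_fun }.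

Lemma cinf_ext (f g : cinf) : (forall x, f x = g x) -> f = g.
Proof.
case: f g => [f pf] [g pg] /= /funext fg.
by rewrite fg in pf *; congr CInf; exact: Prop_irrelevance.
Qed.

HB.instance Definition _ := gen_eqMixin cinf.
HB.instance Definition _ := gen_choiceMixin cinf.

Let oT : open [set: M] := openT.
Definition cinf_cst a := CInf (smooth_cst setT a).
Definition cinf_add (f g : cinf) := CInf (smooth_add oT (cinfP f) (cinfP g)).
Definition cinf_mul (f g : cinf) := CInf (smooth_mul oT (cinfP f) (cinfP g)).
Definition cinf_scale a (f : cinf) := cinf_mul (cinf_cst a) f.
Definition cinf_opp f := cinf_scale (-1) f.

Fact cinf_addA : associative cinf_add.
Proof. by move=> f g h; apply: cinf_ext => x; exact: addrA. Qed.
Fact cinf_addC : commutative cinf_add.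
Proof. by move=> f g; apply: cinf_ext => x; exact: addrC. Qed.
Fact cinf_add0 : left_id (cinf_cst 0) cinf_add.
Proof. by move=> f; apply: cinf_ext => x; exact: add0r. Qed.
Fact cinf_addN : left_inverse (cinf_cst 0) cinf_opp cinf_add.
Proof. by move=> f; apply: cinf_ext => x; rewrite /= mulN1r addNr. Qed.
HB.instance Definition _ :=
  GRing.isZmodule.Build cinf cinf_addA cinf_addC cinf_add0 cinf_addN.

Fact cinf_mulA : associative cinf_mul.
Proof. by move=> f g h; apply: cinf_ext => x; exact: mulrA. Qed.
Fact cinf_mulC : commutative cinf_mul.
Proof. by move=> f g; apply: cinf_ext => x; exact: mulrC. Qed.
Fact cinf_mul1 : left_id (cinf_cst 1) cinf_mul.
Proof. by move=> f; apply: cinf_ext => x; exact: mul1r. Qed.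
Fact cinf_mulD : left_distributive cinf_mul cinf_add.
Proof. by move=> f g h; apply: cinf_ext => x; exact: mulrDl. Qed.
HB.instance Definition _ := GRing.Zmodule_isComPzRing.Build cinf
  cinf_mulA cinf_mulC cinf_mul1 cinf_mulD.

Fact cinf_scaleA a b f : cinf_scale a (cinf_scale b f) = cinf_scale (a * b) f.
Proof. by apply: cinf_ext => x; exact: mulrA. Qed.
Fact cinf_scale1 : left_id 1 cinf_scale.
Proof. by move=> f; apply: cinf_ext => x; exact: mul1r. Qed.
Fact cinf_scaleDr : right_distributive cinf_scale +%R.
Proof. by move=> a f g; apply: cinf_ext => x; exact: mulrDr. Qed.
Fact cinf_scaleDl f : {morph cinf_scale^~ f : a b / a + b}.
Proof. by move=> a b; apply: cinf_ext => x; exact: mulrDl. Qed.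
HB.instance Definition _ := GRing.Zmodule_isLmodule.Build R cinf
  cinf_scaleA cinf_scale1 cinf_scaleDr cinf_scaleDl.

End Functions.

Section Tangent.
Variables (R : realType) (n : nat) (M : manifold R n) (x : M).

Record tangent := Tangent {
  tan_fun :> cinf M -> R;
  tan_linear : forall a f g, tan_fun (a *: f + g) = a * tan_fun f + tan_fun g;
  tan_leibniz : forall f g, tan_fun (f * g) = f x * tan_fun g + tan_fun f * g x
}.

Lemma tan_ext (v w : tangent) : (forall f, v f = w f) -> v = w.
Proof.
case: v w => [v p q] [w p' q'] /= /funext vw.
by rewrite vw in p q *; congr Tangent; exact: Prop_irrelevance.
Qed.

HB.instance Definition _ := gen_eqMixin tangent.
HB.instance Definition _ := gen_choiceMixin tangent.

Fact tan0_linear a (f g : cinf M) : 0 = a * 0 + 0 :> R.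
Proof. by rewrite mulr0 addr0. Qed.
Fact tan0_leibniz (f g : cinf M) : 0 = f x * 0 + 0 * g x.
Proof. by rewrite mulr0 mul0r addr0. Qed.
Definition tan0 := Tangent tan0_linear tan0_leibniz.

Fact tan_add_linear (v w : tangent) a f g :
  v (a *: f + g) + w (a *: f + g) = a * (v f + w f) + (v g + w g).
Proof. by rewrite !tan_linear mulrDr addrACA. Qed.
Fact tan_add_leibniz (v w : tangent) f g :
  v (f * g) + w (f * g) = f x * (v g + w g) + (v f + w f) * g x.
Proof. by rewrite !tan_leibniz mulrDr mulrDl addrACA. Qed.
Definition tan_add v w := Tangent (tan_add_linear v w) (tan_add_leibniz v w).

Fact tan_scale_linear (b : R) (v : tangent) a f g :
  b * v (a *: f + g) = a * (b * v f) + b * v g.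
Proof. by rewrite tan_linear mulrDr mulrCA. Qed.
Fact tan_scale_leibniz (b : R) (v : tangent) f g :
  b * v (f * g) = f x * (b * v g) + b * v f * g x.
Proof. by rewrite tan_leibniz mulrDr mulrCA [b * (v f * _)]mulrA. Qed.
Definition tan_scale b v :=
  Tangent (tan_scale_linear b v) (tan_scale_leibniz b v).

Fact tan_addA : associative tan_add.
Proof. by move=> u v w; apply: tan_ext => f; exact: addrA. Qed.
Fact tan_addC : commutative tan_add.
Proof. by move=> u v; apply: tan_ext => f; exact: addrC. Qed.
Fact tan_add0 : left_id tan0 tan_add.
Proof. by move=> u; apply: tan_ext => f; exact: add0r. Qed.
Fact tan_addN : left_inverse tan0 (tan_scale (-1)) tan_add.
Proof. by move=> u; apply: tan_ext => f; rewrite /= mulN1r addNr. Qed.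
HB.instance Definition _ :=
  GRing.isZmodule.Build tangent tan_addA tan_addC tan_add0 tan_addN.

Fact tan_scaleA a b v : tan_scale a (tan_scale b v) = tan_scale (a * b) v.
Proof. by apply: tan_ext => f; exact: mulrA. Qed.
Fact tan_scale1 : left_id 1 tan_scale.
Proof. by move=> v; apply: tan_ext => f; exact: mul1r. Qed.
Fact tan_scaleDr : right_distributive tan_scale +%R.
Proof. by move=> a v w; apply: tan_ext => f; exact: mulrDr. Qed.
Fact tan_scaleDl v : {morph tan_scale^~ v : a b / a + b}.
Proof. by move=> a b; apply: tan_ext => f; exact: mulrDl. Qed.
HB.instance Definition _ := GRing.Zmodule_isLmodule.Build R tangent
  tan_scaleA tan_scale1 tan_scaleDr tan_scaleDl.

End Tangent.

(* A vector bundle of rank [r] is presented by its fibres together with local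
   trivialisations.  A trivialisation over [lf_dom] is given by the frame
   [lf_vec] of the fibres that it maps to the standard basis of R^r. *)
Record local_frame (R : realType) (T : topologicalType) (V : T -> vectType R)
    (r : nat) := LocalFrame {
  lf_dom : set T;
  lf_vec : forall x, r.-tuple (V x);
  lf_open : open lf_dom;
  lf_basis : forall x, lf_dom x -> basis_of fullv (lf_vec x) }.

Record vbundle (R : realType) (n : nat) (M : manifold R n) (r : nat) :=
  VBundle {
  vb_fib :> M -> vectType R;
  vb_frame : set (local_frame vb_fib r);
  vb_cover : forall x, exists2 F, vb_frame F & lf_dom F x;
  vb_compat : forall F G, vb_frame F -> vb_frame G -> forall i j,
    smooth_on (lf_dom F `&` lf_dom G)
      (fun x => coord (lf_vec G x) j (tnth (lf_vec F x) i)) }.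

Arguments vb_frame {R n M r} v _.

Section Dual.
Variables (R : realType) (n : nat) (M : manifold R n) (r : nat).
Variable E : vbundle M r.

Definition dual_fib (x : M) : vectType R := 'Hom(E x, R^o).

Definition dual_tuple (V : vectType R) (X : r.-tuple V) :
    r.-tuple 'Hom(V, R^o) :=
  [tuple linfun (coord X i : V -> R^o) | i < r].

Lemma dual_tupleE (V : vectType R) (X : r.-tuple V) i (v : V) :
  tnth (dual_tuple X) i v = coord X i v.
Proof. by rewrite tnth_mktuple lfunE. Qed.

Lemma basis_tnth (V : vectType R) (X : r.-tuple V) i j :
  basis_of fullv X -> coord X i (tnth X j) = (i == j)%:R.
Proof.
by move=> bX; rewrite (tnth_nth 0) coord_free ?(basis_free bX) // eq_sym.
Qed.

Lemma dual_sumE (V : vectType R) (X : r.-tuple V) (k : 'I_r -> R) i :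
  basis_of fullv X -> (\sum_j k j *: tnth (dual_tuple X) j) (tnth X i) = k i.
Proof.
move=> bX; rewrite sum_lfunE (bigD1 i) // big1 => [|j ji].
  rewrite scale_lfunE dual_tupleE basis_tnth // eqxx /= addr0.
  exact: mulr1.
by rewrite scale_lfunE dual_tupleE basis_tnth // (negPf ji) scaler0.
Qed.

Lemma dual_basis (V : vectType R) (X : r.-tuple V) :
  basis_of fullv X -> basis_of fullv (dual_tuple X).
Proof.
move=> bX; apply/andP; split.
  rewrite eqEsubv subvf /=; apply/subvP => p _.
  suff -> : p = \sum_i p (tnth X i) *: tnth (dual_tuple X) i.
    by apply: memv_suml => i _; apply/memvZ/memv_span/mem_tnth.
  apply/lfunP => v; rewrite sum_lfunE [in LHS](coord_basis bX (memvf v)).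
  rewrite linear_sum; apply: eq_bigr => i _.
  rewrite linearZ scale_lfunE dual_tupleE -tnth_nth.
  exact: mulrC.
apply/freeP => k hk i.
have {}hk : \sum_j k j *: tnth (dual_tuple X) j = 0.
  by rewrite -[RHS]hk; apply: eq_bigr => j _; rewrite -tnth_nth.
have /lfunP/(_ (tnth X i)) := hk.
by rewrite zero_lfunE dual_sumE.
Qed.

Lemma coord_dual (V : vectType R) (X : r.-tuple V) (p : 'Hom(V, R^o)) i :
  basis_of fullv X -> coord (dual_tuple X) i p = p (tnth X i).
Proof.
move=> bX; rewrite [in RHS](coord_basis (dual_basis bX) (memvf p)).
rewrite -[LHS](dual_sumE (fun j => coord (dual_tuple X) j p) i bX).
congr (fun_of_lfun _ _).
by apply: eq_bigr => j _; rewrite -tnth_nth.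
Qed.

Definition dual_frame (F : local_frame E r) : local_frame dual_fib r :=
  @LocalFrame R M dual_fib r (lf_dom F) (fun x => dual_tuple (lf_vec F x))
    (lf_open F) (fun x Fx => dual_basis (lf_basis Fx)).

Lemma dual_cover x :
  exists2 F, (dual_frame @` vb_frame E) F & lf_dom F x.
Proof.
by have [F EF Fx] := vb_cover E x; exists (dual_frame F) => //; exists F.
Qed.

Lemma dual_compat F G :
  (dual_frame @` vb_frame E) F -> (dual_frame @` vb_frame E) G -> forall i j,
  smooth_on (lf_dom F `&` lf_dom G)
    (fun x => coord (lf_vec G x) j (tnth (lf_vec F x) i)).
Proof.
move=> [F' EF' <-] [G' EG' <-] i j /=.
have := vb_compat EG' EF' j i; rewrite setIC; apply: smooth_ext.
  by apply: openI; exact: lf_open.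
by move=> x [Fx Gx]; rewrite coord_dual ?dual_tupleE //; exact: lf_basis.
Qed.

Definition dual : vbundle M r := VBundle dual_cover dual_compat.

End Dual.

Section Sections.
Variables (R : realType) (n : nat) (M : manifold R n) (r : nat).
Variable E : vbundle M r.

Definition smooth_section (s : forall x, E x) :=
  forall F, vb_frame E F -> forall i,
    smooth_on (lf_dom F) (fun x => coord (lf_vec F x) i (s x)).

Record section := Section_ {
  sec_fun :> forall x, E x;
  secP : smooth_section sec_fun }.

Lemma sec_ext (s t : section) : (forall x, s x = t x) -> s = t.
Proof.
case: s t => [s ps] [t pt] /= st.
have {}st : s = t by apply: functional_extensionality_dep.
by rewrite st in ps *; congr Section_; exact: Prop_irrelevance.
Qed.

HB.instance Definition _ := gen_eqMixin section.
HB.instance Definition _ := gen_choiceMixin section.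

Fact smooth_section0 : smooth_section (fun x => 0).
Proof.
move=> F EF i; apply: smooth_ext (smooth_cst _ 0); first exact: lf_open.
by move=> x _; rewrite linear0.
Qed.
Definition sec0 := Section_ smooth_section0.

Fact smooth_section_add (s t : section) : smooth_section (fun x => s x + t x).
Proof.
move=> F EF i; have oF := @lf_open _ _ _ _ F.
apply: smooth_ext (smooth_add oF (secP s EF i) (secP t EF i)) => // x _.
by rewrite linearD.
Qed.
Definition sec_add s t := Section_ (smooth_section_add s t).

Fact smooth_section_mul (f : cinf M) (s : section) :
  smooth_section (fun x => f x *: s x).
Proof.
move=> F EF i; have oF := @lf_open _ _ _ _ F.
have sf : smooth_on (lf_dom F) f by apply: smooth_sub (cinfP f).
by apply: smooth_ext (smooth_mul oF sf (secP s EF i)) => // x _; rewrite linearZ.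
Qed.
Definition sec_mul f s := Section_ (smooth_section_mul f s).
Definition sec_scale a s := sec_mul (cinf_cst M a) s.

Fact sec_addA : associative sec_add.
Proof. by move=> u v w; apply: sec_ext => f; exact: addrA. Qed.
Fact sec_addC : commutative sec_add.
Proof. by move=> u v; apply: sec_ext => f; exact: addrC. Qed.
Fact sec_add0 : left_id sec0 sec_add.
Proof. by move=> u; apply: sec_ext => f; exact: add0r. Qed.
Fact sec_addN : left_inverse sec0 (sec_scale (-1)) sec_add.
Proof. by move=> u; apply: sec_ext => f; rewrite /= scaleN1r addNr. Qed.
HB.instance Definition _ :=
  GRing.isZmodule.Build section sec_addA sec_addC sec_add0 sec_addN.

Fact sec_scaleA a b v : sec_scale a (sec_scale b v) = sec_scale (a * b) v.
Proof. by apply: sec_ext => f; exact: scalerA. Qed.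
Fact sec_scale1 : left_id 1 sec_scale.
Proof. by move=> v; apply: sec_ext => f; exact: scale1r. Qed.
Fact sec_scaleDr : right_distributive sec_scale +%R.
Proof. by move=> a v w; apply: sec_ext => f; exact: scalerDr. Qed.
Fact sec_scaleDl v : {morph sec_scale^~ v : a b / a + b}.
Proof. by move=> a b; apply: sec_ext => f; exact: scalerDl. Qed.
HB.instance Definition _ := GRing.Zmodule_isLmodule.Build R section
  sec_scaleA sec_scale1 sec_scaleDr sec_scaleDl.

Lemma frame_sum (F : local_frame E r) x (v : E x) : lf_dom F x ->
  v = \sum_i coord (lf_vec F x) i v *: tnth (lf_vec F x) i.
Proof.
move=> Fx; rewrite [LHS](coord_basis (lf_basis Fx) (memvf v)).
by apply: eq_bigr => i _; rewrite -tnth_nth.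
Qed.

Lemma smooth_frames (f : M -> R) :
  (forall F : local_frame E r, vb_frame E F -> smooth_on (lf_dom F) f) ->
  smooth_on setT f.
Proof.
move=> h; apply: smooth_local => x _; have [F EF Fx] := vb_cover E x.
by exists (lf_dom F) => //; exact: h.
Qed.

(* Bundle maps E -> TM over the identity.  A vector field X on an open set is
   smooth iff X(f) is smooth for every smooth function f; the map is therefore
   smooth iff the images of the local frames of E have this property. *)
Record bundle_map_TM := BundleMapTM {
  bm_fun :> forall x, E x -> tangent x;
  bm_linear : forall x, linear (@bm_fun x);
  bm_smooth : forall F, vb_frame E F -> forall i (f : cinf M),
    smooth_on (lf_dom F) (fun x => @bm_fun x (tnth (lf_vec F x) i) f) }.
Arguments bm_fun b x _ : clear implicits.

Lemma tan_sum (x : M) I (s : seq I) (v : I -> tangent x) f :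
  (\sum_(i <- s) v i) f = \sum_(i <- s) v i f.
Proof. by elim/big_rec2: _ => // i _ w _ <-. Qed.

Lemma bm_sum (rho : bundle_map_TM) x (I : Type) (s : seq I) (k : I -> R)
    (v : I -> E x) :
  rho x (\sum_(i <- s) k i *: v i) = \sum_(i <- s) k i *: rho x (v i).
Proof.
elim/big_rec2: _ => [|i y1 y2 _ <-]; last exact: bm_linear.
by apply: (@addIr _ (rho x 0)); rewrite -{1}[rho x 0]scale1r -bm_linear scale1r
  !add0r.
Qed.

Fact bm_act_smooth (rho : bundle_map_TM) (s : section) (f : cinf M) :
  smooth_on setT (fun x => rho x (s x) f).
Proof.
apply: smooth_frames => F EF; have oF := @lf_open _ _ _ _ F.
have h i := smooth_mul oF (secP s EF i) (bm_smooth rho EF i f).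
apply: smooth_ext (smooth_sum (index_enum _) xpredT oF h) => // x Fx.
by rewrite [in RHS](frame_sum (s x) Fx) bm_sum tan_sum.
Qed.
Definition bm_act rho s f := CInf (bm_act_smooth rho s f).

End Sections.

Record lie_algebroid (R : realType) (n : nat) (M : manifold R n) (r : nat)
    (E : vbundle M r) := LieAlgebroid {
  la_anchor : bundle_map_TM E;
  la_br : section E -> section E -> section E;
  la_brDl : forall a s t u, la_br (a *: s + t) u = a *: la_br s u + la_br t u;
  la_brDr : forall a s t u, la_br u (a *: s + t) = a *: la_br u s + la_br u t;
  la_alt : forall s, la_br s s = 0;
  la_jacobi : forall s t u,
    la_br s (la_br t u) + la_br t (la_br u s) + la_br u (la_br s t) = 0;
  la_leibniz : forall (f : cinf M) s t,
    la_br s (sec_mul f t) =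
      sec_mul f (la_br s t) + sec_mul (bm_act la_anchor s f) t }.

(* Alternating multilinear functions on lists of vectors: one alternating
   k-linear form for each length k *)
Section PointForms.
Variables (R : realType) (V : lmodType R).
Implicit Types (a b : seq V -> R) (l : seq V).

Definition multilinear a := forall l1 l2 c u v,
  a (l1 ++ (c *: u + v) :: l2) = c * a (l1 ++ u :: l2) + a (l1 ++ v :: l2).

Definition alternating a := forall l, ~~ uniq l -> a l = 0.

(* The wedge product is the signed sum over shuffles.  A shuffle of the list
   is given by the mask of the vectors fed to the first form, and its sign by
   the number of inversions [minv]. *)
Fixpoint minv (m : bitseq) : nat :=
  if m is b :: m' then (if b then 0 else count id m') + minv m' else 0.

Definition wedge_pt a b l : R :=
  \sum_(m : (size l).-tuple bool)
    (-1) ^+ minv m * a (mask m l) * b (mask (map negb m) l).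

Lemma wedge_ptE a b l k : size l = k -> wedge_pt a b l =
  \sum_(m : k.-tuple bool)
    (-1) ^+ minv m * a (mask m l) * b (mask (map negb m) l).
Proof. by move<-. Qed.

Lemma tuple_recl k (F : seq bool -> R) :
  \sum_(m : k.+1.-tuple bool) F m =
  \sum_(m : k.-tuple bool) F (true :: m) +
  \sum_(m : k.-tuple bool) F (false :: m).
Proof.
pose h (p : bool * k.-tuple bool) := cons_tuple p.1 p.2.
rewrite (reindex h) /=; last first.
  exists (fun m => (thead m, behead_tuple m)) => [[b m] _|m _] /=.
    by rewrite theadE; congr pair; apply: val_inj.
  by rewrite /h /= [in RHS](tuple_eta m).
rewrite -(pair_bigA _ (fun (c : bool) (m : k.-tuple bool) => F (c :: m))) /=.
by rewrite big_bool.
Qed.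

Definition inner v a l := a (v :: l).
Definition altsg a l := (-1) ^+ size l * a l.

Lemma wedge_cons a b v l :
  wedge_pt a b (v :: l) =
  wedge_pt (inner v a) b l + wedge_pt (altsg a) (inner v b) l.
Proof.
rewrite /wedge_pt /= (tuple_recl _ (fun m => (-1) ^+ minv m * a (mask m (v :: l))
  * b (mask (map negb m) (v :: l)))) /=; congr (_ + _).
apply: eq_bigr => m _; rewrite /altsg size_mask ?size_tuple // exprD.
by rewrite /inner !mulrA; congr (_ * _ * _); rewrite mulrC.
Qed.

Lemma multilinear_inner v a : multilinear a -> multilinear (inner v a).
Proof. by move=> h l1 l2 c u w; exact: (h (v :: l1)). Qed.

Lemma multilinear_altsg a : multilinear a -> multilinear (altsg a).
Proof.
move=> h l1 l2 c u w; rewrite /altsg !size_cat /= h mulrDr; congr (_ + _).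
exact: mulrCA.
Qed.

Lemma alternating_inner v a : alternating a -> alternating (inner v a).
Proof. by move=> h l ul; apply: h; rewrite /= negb_and ul orbT. Qed.

Lemma alternating_altsg a : alternating a -> alternating (altsg a).
Proof. by move=> h l /h; rewrite /altsg => ->; rewrite mulr0. Qed.

Lemma wedge_linl c a1 a2 b l :
  wedge_pt (fun l => c * a1 l + a2 l) b l =
  c * wedge_pt a1 b l + wedge_pt a2 b l.
Proof.
rewrite mulr_sumr -big_split; apply: eq_bigr => m _ /=.
by rewrite mulrDr mulrDl !mulrA [_ * c]mulrC.
Qed.

Lemma wedge_linr c a b1 b2 l :
  wedge_pt a (fun l => c * b1 l + b2 l) l =
  c * wedge_pt a b1 l + wedge_pt a b2 l.
Proof.
rewrite mulr_sumr -big_split; apply: eq_bigr => m _ /=.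
by rewrite mulrDr mulrCA.
Qed.

Lemma wedge_multilinear a b :
  multilinear a -> multilinear b -> multilinear (wedge_pt a b).
Proof.
move=> ha hb l1; elim: l1 a b ha hb => [|w l1 IH] a b ha hb l2 c u v /=.
  rewrite !wedge_cons mulrDr addrACA -wedge_linl -wedge_linr.
  congr (wedge_pt _ _ _ + wedge_pt _ _ _); apply/funext => l.
    exact: (ha [::]).
  exact: (hb [::]).
rewrite !wedge_cons IH ?IH ?mulrDr; last first;
  try exact: multilinear_inner; try exact: multilinear_altsg; try by [].
exact: addrACA.
Qed.

Lemma wedge_0l b l : wedge_pt (fun=> 0) b l = 0.
Proof. by apply: big1 => m _; rewrite mulr0 mul0r. Qed.

Lemma wedge_0r a l : wedge_pt a (fun=> 0) l = 0.
Proof. by apply: big1 => m _; rewrite mulr0. Qed.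

Lemma wedge_adjacent a b l1 l2 u : alternating a -> alternating b ->
  wedge_pt a b (l1 ++ u :: u :: l2) = 0.
Proof.
move=> ha hb; elim: l1 a b ha hb => [|v l1 IH] a b ha hb /=; last first.
  rewrite wedge_cons !IH ?addr0 //;
    by [exact: alternating_inner|exact: alternating_altsg].
have i0 a' : alternating a' -> inner u (inner u a') = fun=> 0.
  by move=> h; apply/funext => l; apply: h; rewrite /= inE eqxx.
rewrite !wedge_cons !i0 // wedge_0l wedge_0r addr0 add0r.
rewrite (_ : inner u (altsg a) = fun l => -1 * altsg (inner u a) l + 0).
  by rewrite (wedge_linl _ _ (fun=> 0)) wedge_0l mulN1r addr0 addrN.
by apply/funext => l; rewrite /inner /altsg /= exprS addr0 -mulrA.
Qed.

Lemma adjacent_alternating a : multilinear a ->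
  (forall l1 l2 u, a (l1 ++ u :: u :: l2) = 0) -> alternating a.
Proof.
move=> ha adj.
have swap l1 l2 u v : a (l1 ++ u :: v :: l2) = - a (l1 ++ v :: u :: l2).
  apply/eqP; rewrite -addr_eq0; apply/eqP.
  have := adj l1 l2 (1 *: u + v).
  rewrite ha mul1r.
  have /= := ha (l1 ++ [:: u]) l2 1 u v; rewrite -!catA /= => ->.
  have /= := ha (l1 ++ [:: v]) l2 1 u v; rewrite -!catA /= => ->.
  by rewrite !adj !mul1r add0r addr0.
have far l2 : forall l1 l3 u, a (l1 ++ u :: l2 ++ u :: l3) = 0.
  elim: l2 => [|v l2 IH] l1 l3 u //=.
  by rewrite swap -cat_rcons IH oppr0.
suff h l : ~~ uniq l -> exists l1 l2 l3 u, l = l1 ++ u :: l2 ++ u :: l3.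
  by move=> l /h[l1 [l2 [l3 [u ->]]]].
elim: l => // v l IH /=; rewrite negb_and negbK => /orP[|/IH].
  case/splitPr => l2 l3; by exists [::], l2, l3, v.
by case=> l1 [l2 [l3 [u ->]]]; exists (v :: l1), l2, l3, u.
Qed.

Lemma wedge_alternating a b : multilinear a -> multilinear b ->
  alternating a -> alternating b -> alternating (wedge_pt a b).
Proof.
move=> ma mb ha hb; apply: adjacent_alternating => [|l1 l2 u].
  exact: wedge_multilinear.
exact: wedge_adjacent.
Qed.

Lemma multilinear0 a l1 l2 : multilinear a -> a (l1 ++ 0 :: l2) = 0.
Proof.
move=> ha; have := ha l1 l2 1 0 0.
by rewrite scaler0 addr0 mul1r => /eqP; rewrite -subr_eq0 opprD addNKr
  oppr_eq0 => /eqP.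
Qed.

Lemma multilinear_sum a l1 l2 (I : Type) (s : seq I) (k : I -> R) (v : I -> V) :
  multilinear a -> a (l1 ++ (\sum_(i <- s) k i *: v i) :: l2) =
  \sum_(i <- s) k i * a (l1 ++ v i :: l2).
Proof.
move=> ha; elim/big_rec2: _ => [|i y z _ <-]; last by rewrite ha.
exact: multilinear0.
Qed.

End PointForms.

(* The algebra C(E[1]) of sections of the exterior algebra of E^*.  An element
   is the family of its components of all degrees: [w x l] is the value of the
   component of degree [size l] on the list [l] of vectors of the fibre at [x].
   Components of degree > r vanish because they are alternating, so this is
   the direct sum of the spaces of sections of the bundles of k-forms. *)
Section Forms.
Variables (R : realType) (n : nat) (M : manifold R n) (r : nat).
Variable E : vbundle M r.

Definition smooth_form (w : forall x, seq (E x) -> R) :=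
  forall F, vb_frame E F -> forall s : seq 'I_r,
    smooth_on (lf_dom F) (fun x => w x [seq tnth (lf_vec F x) i | i <- s]).

Record form := Form {
  form_fun : forall x, seq (E x) -> R;
  form_multilinear : forall x, multilinear (@form_fun x);
  form_alternating : forall x, alternating (@form_fun x);
  form_smooth : smooth_form form_fun }.
Arguments form_fun : clear implicits.
Coercion form_fun : form >-> Funclass.

Lemma form_ext (v w : form) : (forall x l, v x l = w x l) -> v = w.
Proof.
case: v w => [v p q o] [w p' q' o'] /= vw.
have {}vw : v = w.
  by apply: functional_extensionality_dep => x; apply/funext => l.
by rewrite vw in p q o *; congr Form; exact: Prop_irrelevance.
Qed.

HB.instance Definition _ := gen_eqMixin form.
HB.instance Definition _ := gen_choiceMixin form.

Section Linear.
Variables (a : R) (v w : form).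

Definition form_lin_fun x l := a * v x l + w x l.

Fact form_lin_multilinear x : multilinear (@form_lin_fun x).
Proof.
move=> l1 l2 c u t; rewrite /form_lin_fun !form_multilinear !mulrDr.
by rewrite [a * (c * _)]mulrCA addrACA.
Qed.

Fact form_lin_alternating x : alternating (@form_lin_fun x).
Proof.
by move=> l ul; rewrite /form_lin_fun !form_alternating // mulr0 addr0.
Qed.

Fact form_lin_smooth : smooth_form form_lin_fun.
Proof.
move=> F EF s; have oF := @lf_open _ _ _ _ F.
apply: smooth_add (form_smooth w EF s) => //.
exact: smooth_mul (smooth_cst _ a) (form_smooth v EF s).
Qed.

Definition form_lin :=
  Form form_lin_multilinear form_lin_alternating form_lin_smooth.
End Linear.

Fact form0_multilinear x : multilinear (fun l : seq (E x) => 0).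
Proof. by move=> l1 l2 c u v; rewrite mulr0 addr0. Qed.
Fact form0_smooth : smooth_form (fun x l => 0).
Proof. by move=> F EF s; exact: smooth_cst. Qed.
Definition form0 :=
  Form form0_multilinear (fun x l _ => erefl 0) form0_smooth.

Definition form_add := form_lin 1.
Definition form_scale a v := form_lin a v form0.

Fact form_addE v w x l : form_add v w x l = v x l + w x l.
Proof. by rewrite /= /form_lin_fun mul1r. Qed.
Fact form_scaleE a v x l : form_scale a v x l = a * v x l.
Proof. by rewrite /= /form_lin_fun addr0. Qed.
Definition form_opE := (form_addE, form_scaleE).

Fact form_addA : associative form_add.
Proof. by move=> u v w; apply: form_ext => x l; rewrite !form_opE addrA. Qed.
Fact form_addC : commutative form_add.
Proof. by move=> u v; apply: form_ext => x l; rewrite !form_opE addrC. Qed.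
Fact form_add0 : left_id form0 form_add.
Proof. by move=> u; apply: form_ext => x l; rewrite !form_opE add0r. Qed.
Fact form_addN : left_inverse form0 (form_scale (-1)) form_add.
Proof. by move=> u; apply: form_ext => x l; rewrite !form_opE mulN1r addNr. Qed.
HB.instance Definition _ :=
  GRing.isZmodule.Build form form_addA form_addC form_add0 form_addN.

Fact form_scaleA a b v : form_scale a (form_scale b v) = form_scale (a * b) v.
Proof. by apply: form_ext => x l; rewrite !form_opE mulrA. Qed.
Fact form_scale1 : left_id 1 form_scale.
Proof. by move=> v; apply: form_ext => x l; rewrite !form_opE mul1r. Qed.
Fact form_scaleDr : right_distributive form_scale +%R.
Proof. by move=> a v w; apply: form_ext => x l; rewrite !form_opE mulrDr. Qed.
Fact form_scaleDl v : {morph form_scale^~ v : a b / a + b}.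
Proof. by move=> a b; apply: form_ext => x l; rewrite !form_opE mulrDl. Qed.
HB.instance Definition _ := GRing.Zmodule_isLmodule.Build R form
  form_scaleA form_scale1 form_scaleDr form_scaleDl.

Section Wedge.
Variables v w : form.

Fact wedge_smooth : smooth_form (fun x => wedge_pt (v x) (w x)).
Proof.
move=> F EF s; have oF := @lf_open _ _ _ _ F.
pose g (m : (size s).-tuple bool) (x : M) :=
  (-1) ^+ minv m * v x [seq tnth (lf_vec F x) i | i <- mask m s] *
  w x [seq tnth (lf_vec F x) i | i <- mask (map negb m) s].
have sg m : smooth_on (lf_dom F) (g m).
  apply: smooth_mul (form_smooth w EF _) => //.
  exact: smooth_mul (smooth_cst _ _) (form_smooth v EF _).
apply: smooth_ext (smooth_sum (index_enum _) xpredT oF sg) => // x _.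
rewrite (@wedge_ptE _ _ _ _ _ (size s)) ?size_map //.
by apply: eq_bigr => m _; rewrite /g !map_mask.
Qed.

Definition wedge : form := Form
  (fun x => wedge_multilinear (@form_multilinear v x) (@form_multilinear w x))
  (fun x => wedge_alternating (@form_multilinear v x) (@form_multilinear w x)
              (@form_alternating v x) (@form_alternating w x))
  wedge_smooth.
End Wedge.

Fact form_app_smooth (w : form) (s : seq (section E)) :
  smooth_on setT (fun x => w x [seq (e : section E) x | e <- s]).
Proof.
apply: (@smooth_frames _ _ _ _ E) => F EF; have oF := @lf_open _ _ _ _ F.
suff h (t : seq 'I_r) : smooth_on (lf_dom F) (fun x =>
    w x ([seq tnth (lf_vec F x) i | i <- t] ++
         [seq (sec_fun e x : E x) | e <- s])).
  exact: (h [::]).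
elim: s t => [|e s IH] t.
  by apply: smooth_ext (form_smooth w EF t) => // x _; rewrite cats0.
have h i := smooth_mul oF (secP e EF i) (IH (rcons t i)).
apply: smooth_ext (smooth_sum (index_enum _) xpredT oF h) => // x Fx /=.
rewrite [in RHS](frame_sum (e x) Fx) multilinear_sum; last first.
  exact: form_multilinear.
by apply: eq_bigr => i _; rewrite map_rcons cat_rcons.
Qed.
(* w(e_1, ..., e_k), for sections e_1, ..., e_k of E *)
Definition form_app w s : cinf M := CInf (form_app_smooth w s).

Section OfFunction.
Variable f : cinf M.
Definition form_of_cinf_fun x (l : seq (E x)) := if l is [::] then f x else 0.
Fact form_of_cinf_multilinear x : multilinear (@form_of_cinf_fun x).
Proof. by case=> [|u l1] l2 c v w; rewrite /= mulr0 addr0. Qed.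
Fact form_of_cinf_alternating x : alternating (@form_of_cinf_fun x).
Proof. by case. Qed.
Fact form_of_cinf_smooth : smooth_form form_of_cinf_fun.
Proof.
move=> F EF [|i s]; last exact: smooth_cst.
by apply: smooth_sub (cinfP f).
Qed.
Definition form_of_cinf := Form form_of_cinf_multilinear
  form_of_cinf_alternating form_of_cinf_smooth.
End OfFunction.

Section OfDual.
Variable xi : section (dual E).
Definition form_of_dual_fun x (l : seq (E x)) : R :=
  if l is [:: v] then (xi x : 'Hom(E x, R^o)) v else 0.
Fact form_of_dual_multilinear x : multilinear (@form_of_dual_fun x).
Proof.
case=> [|u [|t l1]] [|t' l2] c v w; rewrite /= ?mulr0 ?addr0 //.
exact: linearP.
Qed.
Fact form_of_dual_alternating x : alternating (@form_of_dual_fun x).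
Proof. by case=> [|u [|t l]]. Qed.
Fact form_of_dual_smooth : smooth_form form_of_dual_fun.
Proof.
move=> F EF [|i [|j s]]; try exact: smooth_cst.
have oF := @lf_open _ _ _ _ F.
have EF' : vb_frame (dual E) (dual_frame F) by exists F.
apply: smooth_ext (secP xi EF' i) => // x Fx.
by rewrite coord_dual //; exact: lf_basis.
Qed.
Definition form_of_dual := Form form_of_dual_multilinear
  form_of_dual_alternating form_of_dual_smooth.
End OfDual.

End Forms.
Arguments form_fun {R n M r E} w x l : rename.

Section Graded.
Variables (R : realType) (n : nat) (M : manifold R n) (r : nat).
Variable E : vbundle M r.
Implicit Types (s t u : form E) (i j k : int).

Definition homog i s := forall x l, s x l <> 0 -> (size l)%:Z = i.

Definition gsign i : R := (-1) ^ i.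

Record vector_field k (Q : form E -> form E) : Prop := VectorField {
  vf_linear : linear Q;
  vf_degree : forall i s, homog i s -> homog (i + k) (Q s);
  vf_leibniz : forall i j s t, homog i s -> homog j t ->
    Q (wedge s t) = wedge (Q s) t + gsign (k * i) *: wedge s (Q t) }.

Record poisson_bracket k (br : form E -> form E -> form E) : Prop :=
  PoissonBracket {
  pb_linear_l : forall t, linear (br^~ t);
  pb_linear_r : forall s, linear (br s);
  pb_degree : forall i j s t, homog i s -> homog j t ->
    homog (i + j + k) (br s t);
  pb_antisym : forall i j s t, homog i s -> homog j t ->
    br s t = - (gsign ((i + k) * (j + k)) *: br t s);
  pb_leibniz : forall i j m s t u, homog i s -> homog j t -> homog m u ->
    br s (wedge t u) =
      wedge (br s t) u + gsign ((i + k) * j) *: wedge t (br s u);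
  pb_jacobi : forall i j m s t u, homog i s -> homog j t -> homog m u ->
    br s (br t u) =
      br (br s t) u + gsign ((i + k) * (j + k)) *: br t (br s u) }.

Definition bracket_derivation (Q : form E -> form E)
    (br : form E -> form E -> form E) :=
  forall i j s t, homog i s -> homog j t ->
    Q (br s t) = br (Q s) t + gsign (i - 1) *: br s (Q t).

(* A structure of degree 1 PQ-manifold on E[1] *)
Record PQ_structure := PQStructure {
  pq_Q : form E -> form E;
  pq_br : form E -> form E -> form E;
  pq_poisson_bracket : poisson_bracket (-1) pq_br;
  pq_vector_field : vector_field 1 pq_Q;
  pq_square0 : forall s, pq_Q (pq_Q s) = 0;
  pq_poisson : bracket_derivation pq_Q pq_br }.

Definition del T (i : nat) (l : seq T) := take i l ++ drop i.+1 l.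

Definition is_differential (A : lie_algebroid E) (Q : form E -> form E) :=
  vector_field 1 Q /\
  forall (k : nat) s, homog k%:Z s ->
  forall e : seq (section E), size e = k.+1 ->
  form_app (Q s) e =
    \sum_(i < k.+1)
       (-1) ^+ i *: bm_act (la_anchor A) e`_i (form_app s (del i e)) +
    \sum_(j < k.+1) \sum_(i < j)
       (-1) ^+ (i + j) *:
         form_app s (la_br A e`_i e`_j :: del i (del j e)).

Definition is_gerstenhaber (B : lie_algebroid (dual E))
    (br : form E -> form E -> form E) :=
  [/\ poisson_bracket (-1) br,
      forall (xi : section (dual E)) (f : cinf M),
        br (form_of_dual xi) (form_of_cinf E f) =
        form_of_cinf E (bm_act (la_anchor B) xi f) &
      forall xi xi' : section (dual E),
        br (form_of_dual xi) (form_of_dual xi') = form_of_dual (la_br B xi xi')].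

(* The differential of [lb_E] and the Gerstenhaber bracket of [lb_dual] exist
   and are unique, so [Q] and [br] below denote them. *)
Record lie_bialgebroid := LieBialgebroid {
  lb_E : lie_algebroid E;
  lb_dual : lie_algebroid (dual E);
  lb_compat : forall Q br, is_differential lb_E Q ->
    is_gerstenhaber lb_dual br -> bracket_derivation Q br }.

Definition corresponds (A : lie_bialgebroid) (P : PQ_structure) :=
  is_differential (lb_E A) (pq_Q P) /\ is_gerstenhaber (lb_dual A) (pq_br P).

End Graded.

(* Main.v *)
From HB Require Import structures.
From mathcomp Require Import all_boot all_order all_algebra.
From mathcomp Require Import all_classical all_reals all_analysis.
From mathcomp Require Import ring lra zify.
Require Import Defs.

(** A degree 1 PQ-structure and a Lie bialgebroid are both determined by what
    they do to functions and to sections of the dual bundle, that is, to forms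
    of degree 0 and 1.  Two facts about derivations of the algebra of forms
    carry the proof.

    [der_eq]: a derivation is determined by its values on functions and
    1-forms.  With a local frame [e_i] and its dual [th_i], Euler's identity
    [\sum_i th_i ^^ ins e_i s = k s] for [s] of degree [k] writes [s], after
    multiplication with a bump function, as a sum of products of 1-forms with
    forms of lower degree ([form_deg_ind]).

    [der_exists]: compatible values on functions and 1-forms extend to a
    derivation [D].  The commutator of [D] with a contraction [ins e] is again
    a derivation, one degree lower, and its values on generators are read off
    from those of [D].  Hence the functions [D s (e_1, ..., e_k)] may be defined
    by recursion on the list of sections ([ext_app]); they are multilinear over
    functions and alternating, so they come from a form ([tensor_form]).

    For an odd vector field [Q] of degree 1, let [L_e = [ins e, Q]].  Then
    [[L_e, ins e']] is a derivation of degree -1, so it is the contraction with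
    a section, the derived bracket of [e] and [e'].  If [Q] has square zero, the
    axioms of a Lie algebroid are identities between commutators of operators
    ([algebroid_of]), and unrolling [ins e Q = L_e - Q ins e] gives the formula
    for the differential ([Q_formula]).  Conversely a Lie algebroid prescribes
    [Q] on functions and 1-forms, and the operators [[L_e, L_e'] - L_[e, e']],
    [[L_e, Q]] and [Q ^ 2] vanish one after the other
    ([differential_exists]).

    A Lie algebroid on the dual bundle prescribes the derivations [{f, .}] and
    [{xi, .}] on generators; antisymmetry then prescribes [{s, .}] on
    generators for every form [s].  Antisymmetry and the Jacobi identity hold
    because they hold on generators ([gerstenhaber_exists]).  Conversely the
    degree 0 and degree 1 parts of a bracket of degree -1 form a Lie algebroid
    on the dual bundle ([dual_algebroid_of]).

    That [Q] is a derivation of the bracket is the same condition on both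
    sides, so the two bijections combine. *)

Set Implicit Arguments.
Unset Strict Implicit.
Unset Printing Implicit Defensive.

Import Order.TTheory GRing.Theory Num.Theory.
Import numFieldNormedType.Exports.

Local Open Scope classical_set_scope.
Local Open Scope ring_scope.

(** * Bump functions *)

Section Flat.
Variable R : realType.

(** The powers of [t^-1] make the family stable under derivation. *)
Definition flat (m : nat) (t : R) : R :=
  if 0 < t then t^-1 ^+ m * expR (- t^-1) else 0.

Lemma flat_gt0 m t : 0 < t -> 0 < flat m t.
Proof. by move=> t0; rewrite /flat t0 mulr_gt0 ?expR_gt0 ?exprn_gt0 ?invr_gt0.
  Qed.

Lemma flat_ge0 m t : 0 <= flat m t.
Proof. by case: (ltP 0 t) => [/(flat_gt0 m)/ltW//|t0];
  rewrite /flat ltNge t0. Qed.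

Lemma flat_le0 m t : t <= 0 -> flat m t = 0.
Proof. by move=> t0; rewrite /flat ltNge t0. Qed.

(** Comes from [u ^+ m.+1 / m.+1`! <= expR u] at [u = t^-1]. Applied to
    [m.+1], it bounds the difference quotients of [flat m] at 0. *)
Lemma flat_bound m t : flat m t <= (m.+1)`!%:R * `|t|.
Proof.
case: (ltP 0 t) => [t0|t0]; last by rewrite flat_le0 // mulr_ge0.
rewrite /flat t0 (gtr0_norm t0) expRN.
set u := t^-1; have u0 : 0 < u by rewrite invr_gt0.
have -> : t = u^-1 by rewrite invrK.
rewrite ler_pdivrMr ?expR_gt0 // mulrAC ler_pdivlMr // -exprSr.
have f0 : 0 < (m.+1)`!%:R :> R by rewrite ltr0n fact_gt0.
have := expR_ge1Dxn m (ltW u0).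
rewrite -ler_pdivrMl // mulrC => h; apply: le_trans h.
by rewrite mulrC lerDr.
Qed.

Lemma flat_is_derive m t :
  is_derive t (1 : R) (flat m) (flat m.+2 t - m%:R * flat m.+1 t).
Proof.
case: (ltgtP t 0) => t0.
- rewrite !flat_le0 ?ltW // mulr0 subr0.
  have e : \near t, cst 0 t = flat m t.
    have : \forall x \near t, x < 0 by exact: lt_nbhsl.
    by apply: filterS => x x0; rewrite flat_le0 // ltW.
  exact: near_eq_is_derive e (is_derive_cst _ _ _).
- pose f := fun x : R => x^-1 ^+ m * expR (- x^-1).
  have e : \near t, f t = flat m t.
    have : \forall x \near t, 0 < x by exact: lt_nbhsr.
    by apply: filterS => x x0; rewrite /flat x0.
  have t0' : t != 0 by rewrite gt_eqF.
  have df : is_derive t (1 : R) f (flat m.+2 t - m%:R * flat m.+1 t).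
    have dV : is_derive t (1 : R) (fun x : R => x^-1) (- t^-1 ^+ 2).
      apply: DeriveDef; first exact: derivableV.
      by rewrite deriveV // derive_id /GRing.scale /= mulr1 exprVn.
    pose g := fun x : R => x^-1.
    have dX : is_derive t (1 : R) (g ^+ m) ((m%:R * g t ^+ m.-1) *: - t^-1 ^+
      2).
      exact: is_deriveX.
    have dN : is_derive t (1 : R) (- g) (- - t^-1 ^+ 2) by exact: is_deriveN.
    have dE : is_derive t (1 : R) (expR \o (- g)) (expR (- t^-1) * (- - t^-1 ^+
      2)).
      exact: is_derive1_comp.
    have := is_deriveM dX dE.
    have -> : g ^+ m * (expR \o - g) = f.
      by apply/funext => x; rewrite !fctE /f /=.
    move=> h; apply: (is_derive_eq h).
    rewrite /flat t0 ?fctE /GRing.scale /g /=.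
    case: m {h f e dX} => [|m]; rewrite /= ?exprS ?expr0 //; ring.
  exact: near_eq_is_derive e df.
- rewrite t0 !flat_le0 // mulr0 subr0.
  (* the difference quotient of [flat m] at 0 is [flat m.+1] *)
  have l : (fun h : R => h^-1 *: (flat m (h *: 1 + 0) - flat m 0)) @ 0^' --> (0
    : R).
    have b : forall h : R, h != 0 ->
        `|h^-1 *: (flat m (h *: 1 + 0) - flat m 0)| <= (m.+2)`!%:R * `|h|.
      move=> h h0; rewrite (flat_le0 _ (lexx 0)) subr0 addr0.
      have -> : h *: 1 = h by rewrite /GRing.scale /= mulr1.
      have -> : h^-1 *: flat m h = flat m.+1 h.
        rewrite /flat; case: ifP => _; last by rewrite scaler0.
        by rewrite /GRing.scale /= exprS mulrA.
      by rewrite ger0_norm ?flat_ge0 ?flat_bound.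
    apply/cvgr0Pnorm_le => e e0.
    have f0 : 0 < (m.+2)`!%:R :> R by rewrite ltr0n fact_gt0.
    near=> h.
    have h0 : h != 0 by near: h; exact: nbhs_dnbhs_neq.
    apply: le_trans (b h h0) _.
    rewrite mulrC -ler_pdivlMr //.
    have : `|0 - h| < e / (m.+2)`!%:R.
      near: h; apply: nbhs_dnbhs; apply: nbhsx_ballx; exact: divr_gt0.
    by rewrite sub0r normrN => /ltW.
  by apply: DeriveDef; [apply/cvg_ex; exists 0 | exact: cvg_lim l].
Unshelve. all: by end_near.
Qed.

End Flat.

Section CkMore.
Variables (R : realType) (n : nat).
Implicit Types (V : set 'rV[R]_n) (f p : 'rV[R]_n -> R).

(** A derivative of [flat m \o p] is a derivative of [p] times a combination
    of [flat m.+2 \o p] and [flat m.+1 \o p], so the induction on [k] is over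
    all [m] at once. *)
Lemma Ck_flat k m V p : open V -> Cinf V p -> Ck k V (fun y => flat m (p y)).
Proof.
move=> oV; elim: k m p => [|k IH] m p sp.
  move=> x Vx /=; have [dp _] := sp 1%N.
  apply: (@continuous_comp _ _ _ p (flat m)).
    exact: differentiable_continuous (dp x Vx).
  apply: differentiable_continuous; apply/derivable1_diffP.
  by have [] := flat_is_derive m (p x).
have [dp _] := sp 1%N.
have dflat t : differentiable (flat m : R -> R) t.
  by apply/derivable1_diffP; have [] := flat_is_derive m t.
split=> [x Vx|v].
  exact: (differentiable_comp (dp x Vx) (dflat (p x))).
have sDp : Cinf V ('D_v p) by move=> j; have [_] := sp j.+1; exact.
have h := Ck_mul oV (Ck_add oV (IH m.+2 p sp)
  (Ck_mul oV (Ck_cst k V (- m%:R)) (IH m.+1 p sp))) (sDp k).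
apply: Ck_ext h => // x; rewrite inE => Vx.
have c := differentiable_comp (dp x Vx) (dflat (p x)).
rewrite [RHS]deriveE // diff_comp //; last exact: dp.
have := derive_val (is_derive := flat_is_derive m (p x)).
rewrite deriveE // => e.
rewrite /= -[X in 'd _ _ X]mulr1 [X in _ = X]linearZ /= e.
rewrite deriveE; last exact: dp.
by rewrite mulrC mulNr.
Qed.

Lemma Ck_inv k V f : open V -> (forall x, V x -> f x != 0) -> Cinf V f ->
  Ck k V (fun y => (f y)^-1).
Proof.
move=> oV f0 sf; have [df _] := sf 1%N.
elim: k => [|k IH].
  by move=> x Vx; apply: (@continuousV _ _ f x); [exact: f0|exact: sf 0%N x Vx].
split=> [x Vx|v]; first exact: differentiableV (df x Vx) (f0 x Vx).
have sDf : Ck k V ('D_v f) by have [_] := sf k.+1; exact.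
have h := Ck_mul oV (Ck_mul oV (Ck_mul oV (Ck_cst k V (-1)) IH) IH) sDf.
apply: Ck_ext h => // x; rewrite inE => Vx /=.
rewrite [RHS]deriveV ?f0 //; last exact: diff_derivable (df x Vx).
by rewrite /GRing.scale /= mulN1r !mulNr expr2 invfM.
Qed.

(** A smooth step, equal to 1 below [a] and to 0 above [b]. *)
Definition plateau (a b t : R) : R :=
  flat 0 (b - t) / (flat 0 (b - t) + flat 0 (t - a)).

Lemma plateau_den (a b t : R) : a < b -> flat 0 (b - t) + flat 0 (t - a) != 0.
Proof.
move=> ab; rewrite gt_eqF //; case: (ltP t b) => tb.
  by apply: ltr_pwDl; rewrite ?flat_ge0 // flat_gt0 // subr_gt0.
by apply: ltr_wpDl; rewrite ?flat_ge0 // flat_gt0 // subr_gt0 (lt_le_trans ab).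
Qed.

Lemma plateau1 a b t : a < b -> t <= a -> plateau a b t = 1.
Proof.
move=> ab ta; have := plateau_den t ab; rewrite /plateau.
by rewrite [flat _ (t - a)]flat_le0 ?subr_le0 // addr0 => /divff.
Qed.

Lemma plateau0 a b t : b <= t -> plateau a b t = 0.
Proof. by move=> bt; rewrite /plateau flat_le0 ?subr_le0 // mul0r. Qed.

Lemma Cinf_plateau a b V p : open V -> a < b -> Cinf V p ->
  Cinf V (fun y => plateau a b (p y)).
Proof.
move=> oV ab sp.
have s1 : Cinf V (fun y => b - p y).
  move=> k; apply: Ck_ext (Ck_add oV (Ck_cst k V b)
    (Ck_mul oV (Ck_cst k V (-1)) (sp k))) => // y _.
  by rewrite mulN1r.
have s2 : Cinf V (fun y => p y - a).
  by move=> k; exact: Ck_add oV (sp k) (Ck_cst k V (- a)).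
have f1 k := Ck_flat k 0 oV s1.
have f2 k := Ck_flat k 0 oV s2.
move=> k; apply: Ck_mul => //; apply: Ck_inv => //.
  by move=> x _; exact: plateau_den.
by move=> j; exact: Ck_add.
Qed.

Lemma Cinf_sum I (s : seq I) V (F : I -> 'rV[R]_n -> R) : open V ->
  (forall i, Cinf V (F i)) -> Cinf V (fun y => \sum_(i <- s) F i y).
Proof.
move=> oV sF k; elim: s => [|i s IH].
  by apply: Ck_ext (Ck_cst k V 0) => // y _; rewrite big_nil.
by apply: Ck_ext (Ck_add oV (sF i k) IH) => // y _; rewrite big_cons.
Qed.

End CkMore.

Section Bump.
Variables (R : realType) (n : nat) (M : manifold R n).

(** Row vectors carry the sup norm, so a closed ball is a box. *)
Lemma chart_box (c : chart R n M) (U : set M) x : open U -> c_dom c x -> U x ->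
  exists2 d : R, 0 < d & forall y : 'rV[R]_n,
    (forall i, `|y 0 i - c_map c x 0 i| <= d) -> c_img c U y.
Proof.
move=> oU cx Ux; have oV := @open_c_img R n M c U oU.
have Vx : c_img c U (c_map c x).
  by split; [exact: c_map_cod|rewrite c_mapK].
have /nbhs_ballP[e /= e0 he] := open_nbhs_nbhs (conj oV Vx).
exists (e / 2); first exact: divr_gt0.
move=> y hy; apply: he; split=> // i j; rewrite ord1 /ball /=.
apply: le_lt_trans (_ : e / 2 < e);
  last by rewrite ltr_pdivrMr // ltr_pMr // ltr1n.
by rewrite -normrN opprB; exact: hy.
Qed.

Lemma box_compact (y0 : 'rV[R]_n) d :
  compact [set y : 'rV[R]_n | forall i, `|y 0 i - y0 0 i| <= d].
Proof.
have := @rV_compact R n (fun i => `[y0 0 i - d, y0 0 i + d]%classic)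
  (fun i => @segment_compact R _ _).
congr compact; apply/seteqP; split=> y /= h i; move: (h i);
  rewrite ?in_itv /= ler_distl //; lra.
Qed.

(** A plateau of the squared coordinate distance to [x], extended by 0 outside
    of the chart. The extension is smooth since its support lies in a
    coordinate box, which is compact and therefore closed in the Hausdorff
    space [M]. In another chart the squared distance is a polynomial in the
    coordinates of the transition map. *)
Lemma bump_exists (U : set M) x : open U -> U x -> exists chi : cinf M,
  (exists2 W, open W & W x /\ forall y, W y -> chi y = 1) /\
  (exists2 C, closed C & C `<=` U /\ forall y, ~ C y -> chi y = 0).
Proof.
move=> oU Ux; have [c ac cx] := m_cover x.
have [d d0 hd] := chart_box oU cx Ux.
pose K := [set y : 'rV[R]_n | forall i, `|y 0 i - c_map c x 0 i| <= d].
pose C := c_inv c @` K.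
have cC : closed C.
  apply: compact_closed; first exact: m_hausdorff.
  apply: continuous_compact; last exact: box_compact.
  apply: continuous_in_subspaceT => y; rewrite inE => /hd[cy _].
  by apply: c_inv_cont; rewrite inE.
have CU : C `<=` U by move=> _ [y /hd[_ ?] <-].
(* [q] is less than [d ^+ 2] only inside the box, hence [f] is 0 off [C] *)
pose q (y : 'rV[R]_n) : R := \sum_i (y 0 i - c_map c x 0 i) ^+ 2.
pose f (z : M) := if pselect (c_dom c z) then plateau (d^+2 / 2) (d^+2) (q
  (c_map c z)) else 0.
have ab : d ^+ 2 / 2 < d ^+ 2.
  by rewrite ltr_pdivrMr // ltr_pMr ?exprn_gt0 // ltr1n.
have f0 z : ~ C z -> f z = 0.
  move=> Cz; rewrite /f; case: pselect => // cz; apply: plateau0.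
  rewrite leNgt; apply/negP => qd; apply: Cz; exists (c_map c z);
    last by rewrite c_mapK.
  move=> i; rewrite -ler_sqr ?nnegrE ?normr_ge0 ?(ltW d0) // real_normK
    ?num_real //.
  apply: le_trans (ltW qd); rewrite /q (bigD1 i) //= lerDl sumr_ge0 // => j _.
  exact: sqr_ge0.
(* the summands of [q] in an arbitrary chart [c'] *)
pose F c' i (y : 'rV[R]_n) := (c_map c (c_inv c' y) 0 i - c_map c x 0 i) ^+ 2.
have sq c' : m_atlas M c' -> Cinf (c_img c' (c_dom c)) (fun y => \sum_i F c' i
  y).
  move=> ac'; have oV : open (c_img c' (c_dom c)).
    by apply: open_c_img; exact: c_dom_open.
  apply: Cinf_sum => // i j; have t := Ck_add oV (m_compat ac' ac i j)
    (Ck_cst j (c_img c' (c_dom c)) (- c_map c x 0 i)).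
  by apply: Ck_ext (Ck_mul oV t t) => // y _; rewrite /F expr2.
have sf : smooth_on setT f.
  apply: smooth_local => z _; case: (pselect (c_dom c z)) => cz; last first.
    exists (~` C) => /=; last first.
      apply: smooth_ext (smooth_cst _ 0); first exact: closed_openC.
      by move=> y /f0.
    by case=> y /hd[/(@c_inv_dom _ _ _ c) ? _] e; apply: cz; rewrite -e.
  exists (c_dom c) => // c' ac' k.
  have oV : open (c_img c' (c_dom c)) by apply: open_c_img; exact: c_dom_open.
  apply: Ck_ext (Cinf_plateau oV ab (sq c' ac') k) => // y.
  by rewrite inE /f /= => -[_ cy]; case: pselect.
exists (CInf sf); split; last by exists C.
have cq : {for x, continuous (fun z => \sum_i F c i (c_map c z))}.
  apply: (@continuous_comp _ _ _ (c_map c) (fun y => \sum_i F c i y)).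
    by apply: c_map_cont; rewrite inE.
  by apply: (sq c ac 0%N); split; [exact: c_map_cod|rewrite c_mapK].
have : \forall z \near x, \sum_i F c i (c_map c z) < d ^+ 2 / 2.
  apply: (cvgr_lt _ cq); rewrite /F (eq_bigr (fun=> 0)) ?big1 //.
    by rewrite divr_gt0 // exprn_gt0.
  by move=> i _; rewrite c_mapK // subrr expr0n.
move=> h; have : nbhs x ([set z | \sum_i F c i (c_map c z) < d ^+ 2 / 2] `&`
  c_dom c).
  apply: filterI => //.
  exact: open_nbhs_nbhs (conj (@c_dom_open _ _ _ c) cx).
rewrite nbhsE => -[W [oW Wx] hW]; exists W => //; split=> // y /hW[/= qy cy].
rewrite /f; case: pselect => // cy1; apply: plateau1 => //; apply/ltW.
by move: qy; rewrite /F c_mapK.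
Qed.
End Bump.

(** * Pointwise evaluation of functions, sections and forms *)

Section Evaluation.
Variables (R : realType) (n : nat) (M : manifold R n).
Variables (r : nat) (E : vbundle M r).

Lemma cinfDE (f g : cinf M) x : (f + g) x = f x + g x. Proof. by []. Qed.
Lemma cinfME (f g : cinf M) x : (f * g) x = f x * g x. Proof. by []. Qed.
Lemma cinfNE (f : cinf M) x : (- f) x = - f x. Proof. exact: mulN1r. Qed.
Lemma cinf0E x : (0 : cinf M) x = 0. Proof. by []. Qed.
Lemma cinf1E x : (1 : cinf M) x = 1. Proof. by []. Qed.
Lemma cinfZE a (f : cinf M) x : (a *: f) x = a * f x. Proof. by []. Qed.
Lemma cinf_sumE x (I : Type) (t : seq I) (P : pred I) (f : I -> cinf M) :
  (\sum_(i <- t | P i) f i) x = \sum_(i <- t | P i) f i x.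
Proof. by elim/big_rec2: _ => // i y1 y2 _ <-. Qed.
Definition cinfE := (cinfZE, cinfDE, cinfME, cinfNE, cinf0E, cinf1E).

Lemma secDE (s t : section E) x : (s + t) x = s x + t x. Proof. by []. Qed.
Lemma secNE (s : section E) x : (- s) x = - s x. Proof. exact: scaleN1r. Qed.
Lemma sec0E x : (0 : section E) x = 0. Proof. by []. Qed.
Lemma secZE a (s : section E) x : (a *: s) x = a *: s x. Proof. by []. Qed.
Lemma secME f (s : section E) x : sec_mul f s x = f x *: s x. Proof. by []. Qed.
Lemma sec_sumE x (I : Type) (t : seq I) (P : pred I) (f : I -> section E) :
  (\sum_(i <- t | P i) f i) x = \sum_(i <- t | P i) f i x.
Proof. by elim/big_rec2: _ => // i y1 y2 _ <-. Qed.
Definition secE := (secDE, secNE, sec0E, secZE, secME).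

Lemma formDE (s t : form E) x l : (s + t) x l = s x l + t x l.
Proof. exact: form_addE. Qed.
Lemma formZE a (s : form E) x l : (a *: s) x l = a * s x l.
Proof. exact: form_scaleE. Qed.
Lemma formNE (s : form E) x l : (- s) x l = - s x l.
Proof. by rewrite -mulN1r; exact: form_scaleE. Qed.
Lemma form0E x l : (0 : form E) x l = 0. Proof. by []. Qed.
Lemma form_sumE x l (I : Type) (t : seq I) (P : pred I) (f : I -> form E) :
  (\sum_(i <- t | P i) f i) x l = \sum_(i <- t | P i) f i x l.
Proof. by elim/big_rec2: _ => // i y1 y2 _ <-; rewrite formDE. Qed.
Definition formE := (formDE, formNE, form0E, formZE).

End Evaluation.

(** * Cut-off frames and tensoriality *)

Section CutOff.
Variables (R : realType) (n : nat) (M : manifold R n).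

Definition supported_in (chi : cinf M) (U : set M) :=
  exists2 C, closed C & C `<=` U /\ forall y, ~ C y -> chi y = 0.

Lemma cut_smooth chi U g : open U -> supported_in chi U -> smooth_on U g ->
  smooth_on setT (fun y => chi y * g y).
Proof.
move=> oU [C cC [CU chi0]] sg; apply: smooth_local => z _.
case: (pselect (C z)) => Cz.
  exists U; first exact: CU.
  by apply: smooth_mul => //; apply: smooth_sub (cinfP chi).
exists (~` C) => //; apply: smooth_ext (smooth_cst _ 0).
  exact: closed_openC.
by move=> y /chi0 ->; rewrite mul0r.
Qed.

Variables (r : nat) (E : vbundle M r).
Implicit Types (F : local_frame E r).

Lemma cut_frame F chi i : vb_frame E F -> supported_in chi (lf_dom F) ->
  exists e : section E, forall y, e y = chi y *: tnth (lf_vec F y) i.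
Proof.
move=> EF cF; have oF := @lf_open _ _ _ _ F.
suff s : smooth_section (fun y : M => chi y *: (tnth (lf_vec F y) i : E y)).
  by exists (Section_ s).
move=> G EG j; have oG := @lf_open _ _ _ _ G.
have [C cC [CF chi0]] := cF; apply: smooth_local => z Gz.
case: (pselect (C z)) => Cz.
  exists (lf_dom F `&` lf_dom G); first by split=> //; exact: CF.
  have oFG : open (lf_dom F `&` lf_dom G) by exact: openI.
  apply: smooth_ext (smooth_mul oFG _ (vb_compat EF EG i j)) => //.
    by move=> y _; rewrite linearZ.
  by apply: smooth_sub (cinfP chi).
exists (~` C) => //; apply: smooth_ext (smooth_cst _ 0).
  exact: closed_openC.
by move=> y /chi0 ->; rewrite scale0r linear0.
Qed.

Lemma cut_coord F chi (s : section E) i : vb_frame E F ->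
  supported_in chi (lf_dom F) ->
  exists c : cinf M, forall y, c y = chi y * coord (lf_vec F y) i (s y).
Proof.
move=> EF cF; have sc := cut_smooth (@lf_open _ _ _ _ F) cF (secP s EF i).
by exists (CInf sc).
Qed.

Lemma bump_frame x : exists (F : local_frame E r) (chi : cinf M) (W : set M),
  [/\ vb_frame E F, supported_in chi (lf_dom F), open W, W x &
      forall y, W y -> lf_dom F y /\ chi y = 1].
Proof.
have [F EF Fx] := vb_cover E x; have oF := @lf_open _ _ _ _ F.
have [chi [[W oW [Wx W1]] cF]] := bump_exists oF Fx.
exists F, chi, (W `&` lf_dom F); split=> //; first exact: openI.
by move=> y [/W1].
Qed.

Lemma extend_vec x (v : E x) : exists s : section E, s x = v.
Proof.
have [F [chi [W [EF cF oW Wx W1]]]] := bump_frame x; have [Fx chix] := W1 x Wx.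
have [e he] := choice (fun i => cut_frame i EF cF).
exists (\sum_i coord (lf_vec F x) i v *: e i).
by rewrite sec_sumE [RHS](frame_sum v Fx); apply: eq_bigr => i _;
  rewrite secE he chix scale1r.
Qed.

Lemma extend_vecs x (l : seq (E x)) :
  exists s : seq (section E), [seq (e : section E) x | e <- s] = l.
Proof.
elim: l => [|v l [s <-]]; first by exists [::].
by have [e <-] := extend_vec v; exists (e :: s).
Qed.

Section Tensor.
Variable a : seq (section E) -> cinf M.
Hypothesis aD : forall l1 l2 (f : cinf M) e e',
  a (l1 ++ (sec_mul f e + e') :: l2) = f * a (l1 ++ e :: l2) + a (l1 ++ e' ::
    l2).
Hypothesis aA : forall l1 l2 e, a (l1 ++ e :: e :: l2) = 0.

Let a0 l1 l2 : a (l1 ++ 0 :: l2) = 0.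
Proof.
have := aD l1 l2 1 0 0; have -> : sec_mul 1 0 + 0 = 0 :> section E.
  by apply: sec_ext => y; rewrite /= scale1r addr0.
by rewrite mul1r => /eqP; rewrite -subr_eq0 opprD addNKr oppr_eq0 => /eqP.
Qed.

Let a_sum l1 l2 (I : Type) (t : seq I) (c : I -> cinf M) (e : I -> section E) :
  a (l1 ++ \sum_(i <- t) sec_mul (c i) (e i) :: l2) =
  \sum_(i <- t) c i * a (l1 ++ e i :: l2).
Proof. by elim/big_rec2: _ => // i y1 y2 _ <-. Qed.

(** Near [x] the section [e] is a combination of the frame. With a bump
    function [chi] at [x], the multiple [chi * chi] of [e] is a combination of
    the global sections [chi e_i] with coefficients [chi e^i] vanishing at
    [x], and [1 - chi * chi] vanishes at [x] as well. *)
Lemma tensor_zero l1 l2 (e : section E) x : e x = 0 -> a (l1 ++ e :: l2) x = 0.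
Proof.
move=> e0; have [F [chi [W [EF cF oW Wx W1]]]] := bump_frame x.
have [Fx chix] := W1 x Wx.
have [b hb] := choice (fun i => cut_frame i EF cF).
have [c hc] := choice (fun i => cut_coord e i EF cF).
pose t := \sum_i sec_mul (c i) (b i).
have -> : e = sec_mul (1 - chi * chi) e + t.
  apply: sec_ext => y; rewrite !secE /t sec_sumE.
  have -> : (\sum_i (sec_mul (c i) (b i)) y) = chi y ^+ 2 *: e y.
    have [C _ [CF chi0]] := cF; case: (pselect (C y)) => Cy.
      rewrite [in RHS](frame_sum (e y) (CF _ Cy)) scaler_sumr.
      apply: eq_bigr => i _; rewrite secE hb hc !scalerA; congr (_ *: _); ring.
    rewrite chi0 // expr0n scale0r big1 // => i _.
    by rewrite secE hc chi0 // mul0r scale0r.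
  by rewrite -scalerDl !cinfE -expr2 subrK scale1r.
rewrite aD /t a_sum.
rewrite cinfDE cinf_sumE big1 => [|i _];
  last by rewrite cinfME hc e0 linear0 mulr0 mul0r.
by rewrite !cinfE chix mulr1 subrr mul0r addr0.
Qed.

Lemma tensor_eq (l l' : seq (section E)) x :
  [seq (e : section E) x | e <- l] = [seq (e : section E) x | e <- l'] ->
  a l x = a l' x.
Proof.
suff h l1 : [seq (e : section E) x | e <- l] = [seq (e : section E) x | e <-
  l'] ->
  a (l1 ++ l) x = a (l1 ++ l') x by exact: (h [::]).
elim: l l' l1 => [|e l IH] [|e' l'] l1 //= [ee ll].
rewrite -[in RHS]cat_rcons -(IH l' _ ll) cat_rcons.
have -> : e = sec_mul 1 (e - e') + e'.
  by apply: sec_ext => y; rewrite !secE scale1r subrK.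
have z : (e - e') x = 0 by rewrite !secE ee subrr.
by rewrite aD cinfDE cinfME (tensor_zero _ _ z) mulr0 add0r.
Qed.

Let ext x (v : E x) : section E := sval (cid (extend_vec v)).
Let extE x (v : E x) : ext v x = v. Proof. by rewrite /ext; case: cid. Qed.

Definition tensor_fun x (l : seq (E x)) : R := a (map (@ext x) l) x.

Lemma tensor_funE (l : seq (section E)) x :
  @tensor_fun x [seq (e : section E) x | e <- l] = a l x.
Proof.
apply: tensor_eq; rewrite -!map_comp; apply: eq_map => e /=.
by rewrite extE.
Qed.

Lemma tensor_multilinear x : multilinear (@tensor_fun x).
Proof.
move=> l1 l2 c u v.
have [s1 <-] := extend_vecs l1; have [s2 <-] := extend_vecs l2.
have [s <-] := extend_vec u; have [t <-] := extend_vec v.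
have e1 : c *: s x + t x = (sec_mul (cinf_cst M c) s + t) x by [].
have h (e : section E) : [seq (e0 : section E) x | e0 <- s1] ++ e x :: [seq (e0
  : section E) x | e0 <- s2]
  = [seq (e0 : section E) x | e0 <- s1 ++ e :: s2] by rewrite map_cat.
by rewrite e1 !h !tensor_funE aD.
Qed.

Lemma tensor_alternating x : alternating (@tensor_fun x).
Proof.
apply: adjacent_alternating; first exact: tensor_multilinear.
move=> l1 l2 u.
have [s1 <-] := extend_vecs l1; have [s2 <-] := extend_vecs l2.
have [s <-] := extend_vec u.
have := tensor_funE (s1 ++ s :: s :: s2) x.
by rewrite map_cat aA.
Qed.

Lemma tensor_smooth : smooth_form tensor_fun.
Proof.
move=> F EF s; have oF := @lf_open _ _ _ _ F.
apply: smooth_local => x Fx.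
have [chi [[W oW [Wx W1]] cF]] := bump_exists oF Fx.
have [b hb] := choice (fun i => cut_frame i EF cF).
exists (W `&` lf_dom F) => //.
have oWF : open (W `&` lf_dom F) by exact: openI.
apply: (@smooth_ext _ _ _ _ (a (map b s))) => //.
  move=> y [Wy Fy]; rewrite -tensor_funE; congr tensor_fun.
  by rewrite -map_comp; apply: eq_map => i /=; rewrite hb W1 // scale1r.
by apply: smooth_sub (cinfP (a (map b s))).
Qed.

(** By [tensor_eq] the value of [a] at [x] depends only on the values of its
    arguments at [x], so a form is obtained by extending vectors to sections
    in an arbitrary way. *)
Lemma tensor_form : exists w : form E, forall l, form_app w l = a l.
Proof.
exists (Form tensor_multilinear tensor_alternating tensor_smooth) => l.
by apply: cinf_ext => x; exact: tensor_funE.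
Qed.

End Tensor.

Lemma form_app_inj (s t : form E) : (forall l, form_app s l = form_app t l) ->
  s = t.
Proof.
move=> h; apply: form_ext => x l; have [k <-] := extend_vecs l.
exact: (congr1 (fun f : cinf M => f x) (h k)).
Qed.

End CutOff.

(** * The graded algebra of forms *)

Section FormAlgebra.
Variables (R : realType) (n : nat) (M : manifold R n).
Variables (r : nat) (E : vbundle M r).
Implicit Types (s t u : form E) (e : section E) (f g : cinf M).
Implicit Types (xi : section (dual E)) (b : bool).
Local Notation fc := (form_of_cinf E).
Local Notation fd := (@form_of_dual R n M r E).
Local Notation "s ^^ t" := (wedge s t) (at level 40, left associativity).

Section Contraction.
Variables (e : section E) (s : form E).
Fact ins_multilinear x : multilinear (inner (e x) (s x)).
Proof. exact/multilinear_inner/form_multilinear. Qed.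
Fact ins_alternating x : alternating (inner (e x) (s x)).
Proof. by apply: alternating_inner; exact: form_alternating. Qed.
Fact ins_smooth : smooth_form (fun x => inner (e x) (s x)).
Proof.
move=> F EF t; have oF := @lf_open _ _ _ _ F.
have h i := smooth_mul oF (secP e EF i) (form_smooth s EF (i :: t)).
apply: smooth_ext (smooth_sum (index_enum _) xpredT oF h) => // x Fx /=.
rewrite /inner [in RHS](frame_sum (e x) Fx).
by rewrite (multilinear_sum [::] _ _ _ _ (@form_multilinear _ _ _ _ _ s x)).
Qed.
Definition ins : form E := Form ins_multilinear ins_alternating ins_smooth.
End Contraction.

Section Grading.
Variable s : form E.
Fact grade_smooth : smooth_form (fun x => altsg (s x)).
Proof.
move=> F EF t; have oF := @lf_open _ _ _ _ F.
apply: smooth_ext (smooth_mul oF (smooth_cst _ ((-1) ^+ size t)) (form_smooth s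
  EF t)) => //.
by move=> x _; rewrite /altsg size_map.
Qed.
Definition grade : form E := Form (fun x => multilinear_altsg
  (@form_multilinear _ _ _ _ _ s x))
  (fun x => alternating_altsg (@form_alternating _ _ _ _ _ s x)) grade_smooth.
End Grading.

Definition sgn b : R := if b then -1 else 1.
(** [gr true] is the automorphism acting by [(-1) ^+ k] in degree [k]. It
    expresses graded Leibniz rules for all forms, homogeneous or not. *)
Definition gr b s := if b then grade s else s.

Lemma form_app_cons s e l : form_app s (e :: l) = form_app (ins e s) l.
Proof. exact: cinf_ext. Qed.
Lemma form_appD s t l : form_app (s + t) l = form_app s l + form_app t l.
Proof. by apply: cinf_ext => x; exact: formDE. Qed.
Lemma form_appN s l : form_app (- s) l = - form_app s l.
Proof. by apply: cinf_ext => x; rewrite cinfNE; exact: formNE. Qed.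
Lemma form_appZ a s l : form_app (a *: s) l = a *: form_app s l.
Proof. by apply: cinf_ext => x; rewrite cinfZE; exact: formZE. Qed.
Lemma form_app0 l : form_app (0 : form E) l = 0.
Proof. by apply: cinf_ext. Qed.
Definition form_appE := (form_appD, form_appN, form_appZ, form_app0).

(** Contraction peels off the first argument of a form, so identities between
    forms are proved by induction on lists of arguments. *)
Lemma form_eq_ins s t : form_app s [::] = form_app t [::] ->
  (forall e, ins e s = ins e t) -> s = t.
Proof.
move=> h0 h; apply: form_app_inj => -[|e l] //.
by rewrite !form_app_cons h.
Qed.

Lemma insE e s x l : ins e s x l = s x (e x :: l). Proof. by []. Qed.
Lemma gradeE s x l : grade s x l = (-1) ^+ size l * s x l. Proof. by []. Qed.

Lemma insD e s t : ins e (s + t) = ins e s + ins e t.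
Proof. by apply: form_ext => x l; rewrite !(insE, formE). Qed.
Lemma insZ e a s : ins e (a *: s) = a *: ins e s.
Proof. by apply: form_ext => x l; rewrite !(insE, formE). Qed.
Lemma insN e s : ins e (- s) = - ins e s.
Proof. by rewrite -scaleN1r insZ scaleN1r. Qed.
Lemma ins0 e : ins e 0 = 0.
Proof. by apply: form_ext => x l. Qed.
Lemma insDl e e' s : ins (e + e') s = ins e s + ins e' s.
Proof.
apply: form_ext => x l; rewrite !(insE, formE) secE.
by have := form_multilinear s [::] l 1 (e x) (e' x); rewrite /= scale1r mul1r.
Qed.
Lemma ins_ins e s : ins e (ins e s) = 0.
Proof.
apply: form_ext => x l /=; rewrite /inner.
by apply: form_alternating; rewrite /= inE eqxx.
Qed.
Lemma ins_comm e e' s : ins e (ins e' s) = - ins e' (ins e s).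
Proof.
have := ins_ins (e + e') s; rewrite !insDl !insD !ins_ins add0r addr0.
by move/eqP; rewrite addr_eq0 => /eqP.
Qed.
Lemma ins_gr e b s : ins e (gr b s) = sgn b *: gr b (ins e s).
Proof.
case: b => /=; last by rewrite scale1r.
apply: form_ext => x l; rewrite !(insE, gradeE, formE) /= exprS; ring.
Qed.

Lemma grD b s t : gr b (s + t) = gr b s + gr b t.
Proof.
case: b => //=; apply: form_ext => x l.
by rewrite !(gradeE, formE) mulrDr.
Qed.
Lemma grZ b a s : gr b (a *: s) = a *: gr b s.
Proof.
case: b => //=; apply: form_ext => x l.
by rewrite !(gradeE, formE) mulrCA.
Qed.
Lemma grN b s : gr b (- s) = - gr b s.
Proof. by rewrite -scaleN1r grZ scaleN1r. Qed.
Lemma gr0 b : gr b (0 : form E) = 0.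
Proof. by case: b => //; apply: form_ext => x l; rewrite /= /altsg mulr0. Qed.
Lemma gr_gr b b' s : gr b (gr b' s) = gr (b (+) b') s.
Proof.
case: b; case: b' => //=; apply: form_ext => x l /=.
by rewrite /altsg mulrA -exprMn mulrNN mulr1 expr1n mul1r.
Qed.
Lemma gr_nil b s : form_app (gr b s) [::] = form_app s [::].
Proof. by case: b => //; apply: cinf_ext => x /=; rewrite /altsg /= mul1r. Qed.

Lemma wedge_nil s t : form_app (s ^^ t) [::] = form_app s [::] * form_app t
  [::].
Proof.
apply: cinf_ext => x;
  rewrite /= /wedge_pt (eq_bigl (pred1 [tuple])) ?big_pred1_eq /=.
  by rewrite mul1r.
by move=> m; apply/esym/eqP; exact: tuple0.
Qed.

Lemma wedgeDl s t u : (s + t) ^^ u = s ^^ u + t ^^ u.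
Proof.
by apply: form_ext => x l; rewrite formE -[(s ^^ u) x l]mul1r -wedge_linl.
Qed.
Lemma wedgeDr s t u : u ^^ (s + t) = u ^^ s + u ^^ t.
Proof.
by apply: form_ext => x l; rewrite formE -[(u ^^ s) x l]mul1r -wedge_linr.
Qed.
Lemma wedge0l s : 0 ^^ s = 0.
Proof. by apply: form_ext => x l; exact: wedge_0l. Qed.
Lemma wedge0r s : s ^^ 0 = 0.
Proof. by apply: form_ext => x l; exact: wedge_0r. Qed.
Lemma wedgeZl a s t : (a *: s) ^^ t = a *: (s ^^ t).
Proof.
by apply: form_ext => x l;
  rewrite formE -[RHS]addr0 -[X in _ + X](wedge_0l (t x) l) -wedge_linl.
Qed.
Lemma wedgeZr a s t : s ^^ (a *: t) = a *: (s ^^ t).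
Proof.
by apply: form_ext => x l;
  rewrite formE -[RHS]addr0 -[X in _ + X](wedge_0r (s x) l) -wedge_linr.
Qed.
Lemma wedgeNl s t : (- s) ^^ t = - (s ^^ t).
Proof. by rewrite -scaleN1r wedgeZl scaleN1r. Qed.
Lemma wedgeNr s t : s ^^ (- t) = - (s ^^ t).
Proof. by rewrite -scaleN1r wedgeZr scaleN1r. Qed.
Definition wedgeE := (wedgeDl, wedgeDr, wedgeNl, wedgeNr, wedge0l, wedge0r,
  wedgeZl, wedgeZr).

Lemma ins_wedge e s t : ins e (s ^^ t) = ins e s ^^ t + gr true s ^^ ins e t.
Proof. by apply: form_ext => x l; rewrite !(insE, formE);
  exact: wedge_cons. Qed.

Lemma gr_wedge b s t : gr b (s ^^ t) = gr b s ^^ gr b t.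
Proof.
case: b => //; apply: form_app_inj => l; elim: l s t => [|e l IH] s t.
  by rewrite gr_nil !wedge_nil !gr_nil.
rewrite !form_app_cons ins_gr !ins_wedge !ins_gr grD !wedgeE !form_appE !IH.
apply: cinf_ext => x; rewrite !cinfE; ring.
Qed.

Lemma wedgeA s t u : s ^^ (t ^^ u) = s ^^ t ^^ u.
Proof.
apply: form_app_inj => l; elim: l s t u => [|e l IH] s t u.
  by rewrite !wedge_nil mulrA.
rewrite !form_app_cons !ins_wedge !wedgeE !form_appE !IH gr_wedge.
by rewrite addrA.
Qed.

Lemma sgn_sgn b : sgn b * sgn b = 1.
Proof. by case: b; rewrite /= ?mulr1 // mulrNN mulr1. Qed.

(** Graded commutativity, with the parity of the left factor as the only
    hypothesis. *)
Lemma wedgeC b s t : gr true s = sgn b *: s -> s ^^ t = gr b t ^^ s.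
Proof.
move=> hs; apply: form_app_inj => l; elim: l b s t hs => [|e l IH] b s t hs.
  by rewrite !wedge_nil gr_nil mulrC.
rewrite !form_app_cons !ins_wedge hs !ins_gr !form_appE gr_gr.
have h' : gr true (ins e s) = sgn (~~ b) *: ins e s.
  have := congr1 (ins e) hs; rewrite ins_gr insZ /= => /(congr1 (fun z => - z)).
  by rewrite scaleN1r opprK -scaleNr => ->; case: b {hs}; rewrite /= ?opprK.
by rewrite (IH _ _ _ h') !wedgeE !form_appE (IH b s _ hs) addrC.
Qed.

Lemma ins_fc e f : ins e (fc f) = 0.
Proof. by apply: form_ext. Qed.
Lemma fc_nil f : form_app (fc f) [::] = f.
Proof. exact: cinf_ext. Qed.
Lemma gr_fc b f : gr b (fc f) = fc f.
Proof.
case: b => //; apply: form_eq_ins; first by rewrite gr_nil.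
by move=> e; rewrite ins_gr ins_fc gr0 scaler0.
Qed.
Lemma form_app_fwedge f s l : form_app (fc f ^^ s) l = f * form_app s l.
Proof.
elim: l s => [|e l IH] s; first by rewrite wedge_nil fc_nil.
by rewrite !form_app_cons ins_wedge ins_fc wedge0l add0r gr_fc IH.
Qed.
Lemma fwedgeE f s x l : (fc f ^^ s) x l = f x * s x l.
Proof.
have [k <-] := extend_vecs l.
exact: (congr1 (fun g : cinf M => g x) (form_app_fwedge f s k)).
Qed.
Lemma fwedgeC f s : s ^^ fc f = fc f ^^ s.
Proof. by rewrite [RHS](@wedgeC false) // gr_fc scale1r. Qed.

Lemma insMl f e s : ins (sec_mul f e) s = fc f ^^ ins e s.
Proof.
apply: form_ext => x l; rewrite fwedgeE !insE secE -[f x *: e x]addr0.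
rewrite (form_multilinear s [::] l) /=.
by rewrite (multilinear0 [::] l (@form_multilinear _ _ _ _ _ s x)) addr0.
Qed.

Definition pair xi e : cinf M := form_app (fd xi) [:: e].
Lemma pairE xi e x : pair xi e x = (xi x : 'Hom(E x, R^o)) (e x).
Proof. by []. Qed.
Lemma ins_fd e xi : ins e (fd xi) = fc (pair xi e).
Proof. by apply: form_ext => x [|v [|w l]]. Qed.
Lemma fd_nil xi : form_app (fd xi) [::] = 0.
Proof. exact: cinf_ext. Qed.
Lemma gr_fd b xi : gr b (fd xi) = sgn b *: fd xi.
Proof.
apply: form_eq_ins; first by rewrite form_appZ gr_nil fd_nil scaler0.
by move=> e; rewrite ins_gr insZ !ins_fd gr_fc.
Qed.

Lemma fcD f g : fc (f + g) = fc f + fc g.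
Proof. by apply: form_ext => x [|v l]; rewrite formE //= addr0. Qed.
Lemma fcM f g : fc (f * g) = fc f ^^ fc g.
Proof. by apply: form_ext => x [|v l]; rewrite fwedgeE //= mulr0. Qed.
Lemma fcZ a f : fc (a *: f) = a *: fc f.
Proof. by apply: form_ext => x [|v l]; rewrite formE //= mulr0. Qed.
Lemma fc0 : fc 0 = 0.
Proof. by apply: form_ext => x [|v l]. Qed.
Lemma fcN f : fc (- f) = - fc f.
Proof. by rewrite -scaleN1r fcZ scaleN1r. Qed.
Lemma fc_inj f g : fc f = fc g -> f = g.
Proof. by move=> h; rewrite -[f]fc_nil h fc_nil. Qed.

Lemma fdD xi xi' : fd (xi + xi') = fd xi + fd xi'.
Proof.
apply: form_ext => x l; rewrite formE; case: l => [|v [|w l]];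
  rewrite /= ?addr0 //.
exact: add_lfunE.
Qed.
Lemma fdZ a xi : fd (a *: xi) = a *: fd xi.
Proof.
apply: form_ext => x l; rewrite formE; case: l => [|v [|w l]];
  rewrite /= ?mulr0 //.
exact: scale_lfunE.
Qed.
Lemma fd0 : fd 0 = 0.
Proof. by apply: form_ext => x [|v [|w l]] //; exact: zero_lfunE. Qed.
Lemma fdN xi : fd (- xi) = - fd xi.
Proof. by rewrite -scaleN1r fdZ scaleN1r. Qed.
Lemma fdM f xi : fd (sec_mul f xi) = fc f ^^ fd xi.
Proof.
apply: form_ext => x l; rewrite fwedgeE; case: l => [|v [|w l]];
  rewrite /= ?mulr0 //.
exact: scale_lfunE.
Qed.
Lemma fd_inj xi xi' : fd xi = fd xi' -> xi = xi'.
Proof.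
move=> h; apply: sec_ext => x; apply/lfunP => v.
exact: (congr1 (fun s : form E => s x [:: v]) h).
Qed.

(** The component of degree 1. *)
Section DualPart.
Variable s : form E.
Definition dpart_fun x : dual E x := linfun (fun v : E x => s x [:: v] : R^o).
Lemma dpart_linear x : linear (fun v : E x => s x [:: v] : R^o).
Proof. by move=> a u v; rewrite (form_multilinear s [::] [::]). Qed.
Lemma dpart_funE x (v : E x) : (dpart_fun x : 'Hom(E x, R^o)) v = s x [:: v].
Proof.
pose f := GRing.isLinear.Build _ _ _ _ (fun v : E x => s x [:: v] : R^o)
  (@dpart_linear x).
pose g : {linear E x -> R^o} := HB.pack (fun v : E x => s x [:: v] : R^o) f.
exact: (lfunE g).
Qed.
Lemma dpart_smooth : smooth_section dpart_fun.
Proof.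
move=> F' [F EF <-] i; have oF := @lf_open _ _ _ _ F.
apply: smooth_ext (form_smooth s EF [:: i]) => // x Fx /=.
by rewrite coord_dual ?dpart_funE //; exact: lf_basis.
Qed.
Definition dpart : section (dual E) := Section_ dpart_smooth.
Lemma dpartE x (v : E x) : (dpart x : 'Hom(E x, R^o)) v = s x [:: v].
Proof. exact: dpart_funE. Qed.
End DualPart.

Lemma dpart_fd xi : dpart (fd xi) = xi.
Proof. by apply: sec_ext => x; apply/lfunP => v; rewrite dpartE. Qed.
Lemma dpart_fc f : dpart (fc f) = 0.
Proof. by apply: sec_ext => x; apply/lfunP => v; rewrite dpartE. Qed.
Lemma dpartD s t : dpart (s + t) = dpart s + dpart t.
Proof. by apply: sec_ext => x; apply/lfunP => v; rewrite dpartE formE -!dpartE;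
  apply: esym; exact: add_lfunE. Qed.
Lemma dpartZ a s : dpart (a *: s) = a *: dpart s.
Proof. by apply: sec_ext => x; apply/lfunP => v; rewrite dpartE formE -!dpartE;
  apply: esym; exact: scale_lfunE. Qed.

Lemma homog0_fc s : homog 0 s -> s = fc (form_app s [::]).
Proof.
move=> h; apply: form_ext => x [|v l] //=.
by apply: contrapT => /h.
Qed.
Lemma homog1_fd s : homog 1 s -> s = fd (dpart s).
Proof.
move=> h; apply: form_ext => x [|v [|w l]] /=; last 1 first.
- by apply: contrapT => /h.
- by apply: contrapT => /h.
- by rewrite dpartE.
Qed.
Lemma homog_fc f : homog 0 (fc f).
Proof. by move=> x [|v l]. Qed.
Lemma homog_fd xi : homog 1 (fd xi).
Proof. by move=> x [|v [|w l]]. Qed.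
Lemma homog_lt0 (i : int) s : i < 0 -> homog i s -> s = 0.
Proof.
move=> i0 h; apply: form_ext => x l; apply: contrapT => /h e.
by move: i0; rewrite -e.
Qed.
Lemma homog_nat (i : int) s : homog i s -> s = 0 \/ exists k : nat, i = k.
Proof.
move=> h; case: (ltP i 0) => i0; first by left; exact: homog_lt0 h.
by right; case: i i0 h => // k; exists k.
Qed.
Lemma homog_ins i e s : homog i s -> homog (i - 1) (ins e s).
Proof.
move=> h x l /h /= <-; rewrite -addn1 PoszD; ring.
Qed.
Lemma homog0 i : homog i (0 : form E). Proof. by []. Qed.
Lemma homogD i s t : homog i s -> homog i t -> homog i (s + t).
Proof.
move=> hs ht x l; rewrite formE => st.
case: (pselect (s x l = 0)) => [s0|/hs//]; apply: (ht x).
by move=> t0; apply: st; rewrite s0 t0 addr0.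
Qed.
Lemma homogZ i a s : homog i s -> homog i (a *: s).
Proof.
by move=> hs x l; rewrite formE => st; apply: (hs x) => s0; apply: st;
  rewrite s0 mulr0.
Qed.
Lemma homogN i s : homog i s -> homog i (- s).
Proof. by move=> h; rewrite -scaleN1r; exact: homogZ. Qed.
Lemma homog_wedge i j s t : homog i s -> homog j t -> homog (i + j) (s ^^ t).
Proof.
move=> hs ht x l; have [k <-] := extend_vecs l => h.
rewrite size_map; move: h.
suff: (size k)%:Z != i + j -> form_app (s ^^ t) k = 0.
  move=> h nz; apply/eqP; apply/negPn/negP => /h e; apply: nz.
  exact: (congr1 (fun g : cinf M => g x) e).
elim: k i j s t hs ht {l} => [|e l IH] i j s t hs ht ne.
  rewrite wedge_nil; apply: cinf_ext => y; rewrite cinfE.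
  case: (pselect (s y [::] = 0)) => [s0|/hs si]; first by rewrite /= s0 mul0r.
  case: (pselect (t y [::] = 0)) => [t0|/ht ti]; first by rewrite /= t0 mulr0.
  by move: ne; rewrite -si -ti.
have g : homog i (gr true s).
  by move=> y m nz; apply: (hs y) => s0; apply: nz; rewrite gradeE s0 mulr0.
rewrite form_app_cons ins_wedge form_appD.
rewrite (IH _ _ _ _ (@homog_ins _ e _ hs) ht) ?(IH _ _ _ _ g (@homog_ins _ e _
  ht)) ?addr0 //.
  by apply: contra ne => /eqP /= h; apply/eqP; rewrite -addn1 PoszD h; ring.
by apply: contra ne => /eqP /= h; apply/eqP; rewrite -addn1 PoszD h; ring.
Qed.
Lemma gr_homog (k : nat) s : homog k s -> gr true s = sgn (odd k) *: s.
Proof.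
move=> h; apply: form_ext => x l; rewrite gradeE formE.
case: (pselect (s x l = 0)) => [->|/h [<-]]; first by rewrite !mulr0.
by rewrite -signr_odd; case: (odd _); rewrite /= ?expr1 ?expr0.
Qed.

End FormAlgebra.

(** * Local generation by functions and 1-forms *)

Section Induction.
Variables (R : realType) (n : nat) (M : manifold R n).
Variables (r : nat) (E : vbundle M r).
Implicit Types (s t u : form E) (e : section E) (f g : cinf M).
Implicit Types (xi : section (dual E)) (b : bool).
Local Notation fc := (form_of_cinf E).
Local Notation fd := (@form_of_dual R n M r E).
Local Notation "s ^^ t" := (wedge s t) (at level 40, left associativity).

Lemma form_app_sum (I : Type) (t : seq I) (P : pred I) (F : I -> form E) l :
  form_app (\sum_(i <- t | P i) F i) l = \sum_(i <- t | P i) form_app (F i) l.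
Proof. by elim/big_rec2: _ => [|i y1 y2 _ <-]; rewrite form_appE. Qed.

Lemma ins_sum (I : Type) (t : seq I) (P : pred I) (F : I -> form E) e :
  ins e (\sum_(i <- t | P i) F i) = \sum_(i <- t | P i) ins e (F i).
Proof. by elim/big_rec2: _ => [|i y1 y2 _ <-]; rewrite ?ins0 ?insD. Qed.

Lemma ins_0 s : ins 0 s = 0.
Proof.
apply: form_ext => x l; rewrite insE.
exact: (multilinear0 [::] l (@form_multilinear _ _ _ _ _ s x)).
Qed.

Lemma ins_suml (I : Type) (t : seq I) (P : pred I) (F : I -> section E) s :
  ins (\sum_(i <- t | P i) F i) s = \sum_(i <- t | P i) ins (F i) s.
Proof. by elim/big_rec2: _ => [|i y1 y2 _ <-]; rewrite ?ins_0 ?insDl. Qed.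

(** Expand every argument in a frame: a list of more than [r] frame vectors
    has a repetition. *)
Lemma form_high s x l : (r < size l)%N -> s x l = 0.
Proof.
have [F _ Fx] := vb_cover E x.
suff h : forall t : seq 'I_r, (r < size t + size l)%N ->
    s x ([seq tnth (lf_vec F x) i | i <- t] ++ l) = 0 by exact: (h [::]).
elim: l => [|v l IH] t.
  rewrite addn0 cats0 => rt; apply: form_alternating.
  apply/negP => /map_uniq/card_uniqP ct.
  by have := max_card (mem t); rewrite ct card_ord leqNgt rt.
rewrite (frame_sum v Fx) /= => rt; rewrite multilinear_sum; last first.
  exact: form_multilinear.
apply: big1 => i _; have := IH (rcons t i).
by rewrite size_rcons addSnnS map_rcons cat_rcons => ->; rewrite ?mulr0.
Qed.

Section Component.
Variables (k : nat) (s : form E).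
Definition degree_part_fun x (l : seq (E x)) : R := if size l == k then s x l
  else 0.
Fact degree_part_multilinear x : multilinear (@degree_part_fun x).
Proof.
move=> l1 l2 c u v; rewrite /degree_part_fun !size_cat /=.
by case: eqP => _; rewrite ?form_multilinear // mulr0 addr0.
Qed.
Fact degree_part_alternating x : alternating (@degree_part_fun x).
Proof. by move=> l ul;
  rewrite /degree_part_fun form_alternating // if_same. Qed.
Fact degree_part_smooth : smooth_form degree_part_fun.
Proof.
move=> F EF t; have oF := @lf_open _ _ _ _ F.
case: (eqVneq (size t) k) => [tk|/negPf tk].
  apply: smooth_ext (form_smooth s EF t) => // x _.
  by rewrite /degree_part_fun size_map tk eqxx.
apply: smooth_ext (smooth_cst _ 0) => // x _.
by rewrite /degree_part_fun size_map tk.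
Qed.
Definition degree_part : form E := Form degree_part_multilinear
  degree_part_alternating degree_part_smooth.
Lemma degree_part_homog : homog k degree_part.
Proof. by move=> x l; rewrite /= /degree_part_fun; case: eqP => // ->. Qed.
End Component.

Lemma form_sum_degree_part s : s = \sum_(k < r.+1) degree_part k s.
Proof.
apply: form_ext => x l; rewrite form_sumE /= /degree_part_fun.
case: (ltnP (size l) r.+1) => h; last first.
  by rewrite form_high // big1 // => i _; rewrite if_same.
rewrite (bigD1 (Ordinal h)) //= eqxx big1 ?addr0 // => i /eqP ne.
by case: eqP => // e; case: ne; apply: val_inj.
Qed.

(** By [form_high] a form has finitely many homogeneous components. *)
Lemma form_add_ind (P : form E -> Prop) : P 0 ->
  (forall s t, P s -> P t -> P (s + t)) ->
  (forall (k : nat) s, homog k s -> P s) -> forall s, P s.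
Proof.
move=> P0 PD Ph s; rewrite [s]form_sum_degree_part; elim/big_ind: _ => // i _.
exact: Ph (@degree_part_homog i s).
Qed.

(** The degree is counted by [\sum_i th_i ^^ ins e_i]; frame and dual frame
    are cut off by [chi]. Contracting with [e] reduces the identity for [s] to
    the one for [ins e s], because [\sum_i <th_i, e> c_i = chi ^+ 2 e]. *)
Lemma euler (F : local_frame E r) (chi : cinf M) (c : 'I_r -> section E)
    (th : 'I_r -> section (dual E)) (k : nat) s :
  (forall i y, c i y = chi y *: tnth (lf_vec F y) i) ->
  (forall i y, th i y = chi y *: tnth (dual_tuple (lf_vec F y)) i) ->
  supported_in chi (lf_dom F) -> homog k s ->
  \sum_i fd (th i) ^^ ins (c i) s = k%:R *: (fc (chi * chi) ^^ s).
Proof.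
move=> hc hth [C _ [CF chi0]] hs.
(* off the support of [chi] both sides are zero, on it they agree in the frame *)
have dec e : \sum_i sec_mul (pair (th i) e) (c i) = sec_mul (chi * chi) e.
  apply: sec_ext => y; rewrite sec_sumE secE.
  case: (pselect (C y)) => Cy; last first.
    rewrite big1 => [|i _]; first by rewrite cinfE chi0 // mul0r scale0r.
    by rewrite secE hc chi0 // scale0r scaler0.
  rewrite [in RHS](frame_sum (e y) (CF _ Cy)) scaler_sumr.
  apply: eq_bigr => i _; rewrite secE hc pairE hth scale_lfunE dual_tupleE.
  by rewrite !scalerA cinfE; congr (_ *: _); rewrite /GRing.scale /=; ring.
suff h l : form_app (\sum_i fd (th i) ^^ ins (c i) s) l =
    (size l)%:R *: form_app (fc (chi * chi) ^^ s) l.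
  apply: form_ext => x l; have [m <-] := extend_vecs l.
  rewrite formE -[LHS]/(form_app _ m x) h cinfE form_app_fwedge cinfE fwedgeE
    -[form_app s m x]/(s x _).
  case: (pselect (s x [seq (e : section E) x | e <- m] = 0)) => [->|/hs].
    by rewrite !mulr0.
  by rewrite size_map => -[->].
elim: l s {hs} => [|e l IH] s.
  rewrite /= scale0r form_app_sum big1 // => i _.
  by rewrite wedge_nil fd_nil mul0r.
rewrite !form_app_cons ins_wedge ins_fc wedge0l add0r gr_fc /=.
rewrite ins_sum.
rewrite (eq_bigr (fun i => fc (pair (th i) e) ^^ ins (c i) s + fd (th i) ^^ ins
  (c i) (ins e s))); last first.
  by move=> i _; rewrite ins_wedge ins_fd gr_fd /= [ins e (ins _ _)]ins_comm
    !wedgeE opprK.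
rewrite big_split /= form_appD IH.
have -> : \sum_i fc (pair (th i) e) ^^ ins (c i) s = fc (chi * chi) ^^ ins e s.
  rewrite -insMl -dec ins_suml.
  by apply: eq_bigr => i _; rewrite insMl.
by rewrite -[(size l).+1]addn1 natrD scalerDl scale1r addrC.
Qed.

(** Euler's identity makes [chi ^+ 2] times [s] a sum of products of 1-forms
    with forms of lower degree, so it is killed by [D k]. As [D k] is linear
    over functions, [D k s] vanishes where [chi] is 1. The index [k] lets the
    operator involve signs depending on the degree. *)
Lemma form_deg_ind (D : nat -> form E -> form E) :
  (forall k s t, D k (s + t) = D k s + D k t) ->
  (forall f, D 0%N (fc f) = 0) ->
  (forall (k : nat) f s, homog k s -> D k (fc f ^^ s) = fc f ^^ D k s) ->
  (forall (k : nat) xi s, homog k s -> D k s = 0 -> D k.+1 (fd xi ^^ s) = 0) ->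
  forall (k : nat) s, homog k s -> D k s = 0.
Proof.
move=> DD D0 DM Dxi; elim=> [|k IH] s hs; first by rewrite (homog0_fc hs) D0.
have Dz j : D j 0 = 0 by have := DD j 0 0;
  rewrite addr0 => /esym /(canRL (addrK _)); rewrite subrr.
apply: form_ext => x l.
have [F [chi [W [EF cF oW Wx W1]]]] := bump_frame E x;
  have [Fx chix] := W1 x Wx.
have [c hc] := choice (fun i => cut_frame i EF cF).
have EF' : vb_frame (dual E) (dual_frame F) by exists F.
have [th hth] := choice (fun i => @cut_frame _ _ _ _ (dual E) (dual_frame F)
  chi i EF' cF).
have eu := euler hc hth cF hs.
pose f : cinf M := k.+1%:R *: (chi * chi); have e1 := DM k.+1 f s hs.
have : D k.+1 (fc f ^^ s) = 0.
  rewrite /f fcZ wedgeZl -eu; elim/big_rec: _ => [|i t _ h];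
    first by rewrite Dz.
  have h' : homog k (ins (c i) s).
    by have := @homog_ins _ _ _ _ _ _ (c i) _ hs; rewrite -addn1 PoszD addrK.
  by rewrite DD h addr0 (Dxi _ _ _ h') // IH.
rewrite e1 => /(congr1 (fun s : form E => s x l));
  rewrite fwedgeE /f !cinfE chix.
rewrite !mulr1 => /eqP; rewrite mulf_eq0 pnatr_eq0 /= => /eqP.
exact.
Qed.

End Induction.

(** * Derivations and their extension from generators *)

Section Derivations.
Variables (R : realType) (n : nat) (M : manifold R n).
Variables (r : nat) (E : vbundle M r).
Implicit Types (s t u : form E) (e : section E) (f g : cinf M).
Implicit Types (xi : section (dual E)) (b : bool).
Local Notation fc := (form_of_cinf E).
Local Notation fd := (@form_of_dual R n M r E).
Local Notation "s ^^ t" := (wedge s t) (at level 40, left associativity).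
Local Notation sgn := (sgn R).

Local Arguments gr : simpl never.

Record isder b (D : form E -> form E) : Prop := IsDer {
  der_lin : forall a s t, D (a *: s + t) = a *: D s + D t;
  der_wedge : forall s t, D (s ^^ t) = D s ^^ t + gr b s ^^ D t;
  der_gr : forall s, D (gr true s) = sgn b *: gr true (D s) }.

Section Basic.
Variables (b : bool) (D : form E -> form E).
Hypothesis dD : isder b D.
Lemma der0 : D 0 = 0.
Proof.
have := der_lin dD 1 0 0; rewrite !scale1r addr0 => /esym/(canRL (addrK _)).
by rewrite subrr.
Qed.
Lemma derD s t : D (s + t) = D s + D t.
Proof. by have := der_lin dD 1 s t; rewrite !scale1r. Qed.
Lemma derZ a s : D (a *: s) = a *: D s.
Proof. by have := der_lin dD a s 0; rewrite der0 !addr0. Qed.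
Lemma derN s : D (- s) = - D s.
Proof. by rewrite -scaleN1r derZ scaleN1r. Qed.
Lemma der_fwedge f s : D (fc f ^^ s) = D (fc f) ^^ s + fc f ^^ D s.
Proof. by rewrite (der_wedge dD) gr_fc. Qed.
Lemma der_grb b' s : D (gr b' s) = sgn (b && b') *: gr b' (D s).
Proof.
case: b'; first by rewrite andbT /= -(der_gr dD).
by rewrite andbF /= scale1r.
Qed.
End Basic.

Lemma isder_lin b D D' a : isder b D -> isder b D' ->
  isder b (fun s => a *: D s + D' s).
Proof.
move=> dD dD'; split=> [c s t|s t|s].
- rewrite (der_lin dD) (der_lin dD') !scalerDr !scalerA mulrC.
  by rewrite -!addrA; congr (_ + _); rewrite addrCA.
- rewrite (der_wedge dD) (der_wedge dD') !wedgeE scalerDr -!addrA;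
  congr (_ + _).
  by rewrite addrCA.
- by rewrite (der_gr dD) (der_gr dD') grD grZ scalerDr !scalerA mulrC.
Qed.

(** The difference of two derivations that agree on functions is linear over
    functions, which brings it under [form_deg_ind]. *)
Lemma der_eq b D D' : isder b D -> isder b D' ->
  (forall f, D (fc f) = D' (fc f)) -> (forall xi, D (fd xi) = D' (fd xi)) ->
  forall s, D s = D' s.
Proof.
move=> dD dD' e0 e1; apply: form_add_ind => [|s t hs ht|k s hs].
- by rewrite (der0 dD) (der0 dD').
- by rewrite (derD dD) (derD dD') hs ht.
apply/eqP; rewrite -subr_eq0; apply/eqP.
apply: (form_deg_ind (D := fun _ s => D s - D' s)) hs.
- by move=> _ t u; rewrite (derD dD) (derD dD') opprD addrACA.
- by move=> f; rewrite e0 subrr.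
- move=> _ f t _; rewrite (der_fwedge dD) (der_fwedge dD') e0 !wedgeE.
  by rewrite opprD addrACA subrr add0r.
- move=> _ xi t _ ht; rewrite (der_wedge dD) (der_wedge dD') e1.
  by rewrite opprD addrACA subrr add0r -wedgeNr -wedgeDr ht wedge0r.
Qed.

(** What the values of a derivation of parity [b] on functions and on 1-forms
    satisfy. *)
Record der_data b (D0 : cinf M -> form E) (D1 : section (dual E) -> form E) :
  Prop :=
  DerData {
  dd0_lin : forall a f g, D0 (a *: f + g) = a *: D0 f + D0 g;
  dd0_mul : forall f g, D0 (f * g) = D0 f ^^ fc g + fc f ^^ D0 g;
  dd0_gr : forall f, gr true (D0 f) = sgn b *: D0 f;
  dd1_lin : forall a xi xi', D1 (a *: xi + xi') = a *: D1 xi + D1 xi';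
  dd1_mul : forall f xi, D1 (sec_mul f xi) = D0 f ^^ fd xi + fc f ^^ D1 xi;
  dd1_gr : forall xi, gr true (D1 xi) = sgn (~~ b) *: D1 xi }.

Definition ins_data0 e (D0 : cinf M -> form E) f := ins e (D0 f).
(** If [D] extends [D0] and [D1], then [ins_data0 e D0] and [ins_data1 b e D0
    D1] are the values on generators of the graded commutator of [ins e] with
    [D]. *)
Definition ins_data1 b e (D0 : cinf M -> form E) (D1 : section (dual E) -> form
  E) xi :=
  ins e (D1 xi) - sgn b *: D0 (pair xi e).

(** The values of the extension [D] on lists of sections, by [ins e D = sgn b
    D ins e + [ins e, D]]. On the empty list only the components of [t] of
    degree 0 and 1 count, because a product [D1 xi ^^ eta] of a form with a
    1-form vanishes there. *)
Fixpoint ext_app b D0 D1 t (l : seq (section E)) : cinf M :=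
  if l is e :: l' then
    sgn b *: ext_app b D0 D1 (ins e t) l' + ext_app (~~ b) (ins_data0 e D0)
      (ins_data1 b e D0 D1) t l'
  else form_app (D0 (form_app t [::])) [::] + form_app (D1 (dpart t)) [::].

Lemma pair_lin a xi xi' e : pair (a *: xi + xi') e = a *: pair xi e + pair xi'
  e.
Proof. by apply: (@fc_inj _ _ _ _ E);
  rewrite fcD fcZ -!ins_fd fdD fdZ insD insZ. Qed.
Lemma pair_mul f xi e : pair (sec_mul f xi) e = f * pair xi e.
Proof. by apply: (@fc_inj _ _ _ _ E);
  rewrite fcM -!ins_fd fdM ins_wedge ins_fc wedge0l add0r gr_fc. Qed.

Lemma sgnN b : sgn (~~ b) = - sgn b.
Proof. by case: b; rewrite /= ?opprK. Qed.

Lemma der_data_ins b D0 D1 e : der_data b D0 D1 ->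
  der_data (~~ b) (ins_data0 e D0) (ins_data1 b e D0 D1).
Proof.
move=> H; split; rewrite /ins_data0 /ins_data1.
- by move=> a f g; rewrite (dd0_lin H) insD insZ.
- by move=> f g; rewrite (dd0_mul H) insD !ins_wedge !ins_fc wedge0l wedge0r
  addr0 add0r gr_fc.
- move=> f; have := congr1 (ins e) (dd0_gr H f).
  rewrite ins_gr insZ /= => /(congr1 (fun z => - z)).
  by rewrite scaleN1r opprK => ->; rewrite sgnN scaleNr.
- move=> a xi xi'; rewrite (dd1_lin H) pair_lin (dd0_lin H) insD insZ.
  apply: form_ext => x l; rewrite !formE; ring.
- move=> f xi; rewrite (dd1_mul H) pair_mul (dd0_mul H) insD !ins_wedge ins_fc
  ins_fd.
  rewrite (dd0_gr H) gr_fc !wedgeE.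
  apply: form_ext => x l; rewrite !formE; ring.
- move=> xi; rewrite negbK grD grN grZ (dd0_gr H).
  have := congr1 (ins e) (dd1_gr H xi).
  rewrite ins_gr insZ /= => /(congr1 (fun z => - z));
    rewrite scaleN1r opprK => ->.
  by rewrite sgnN; apply: form_ext => x l; rewrite !formE; ring.
Qed.

Lemma ext_app_lin b D0 D1 a s t l : der_data b D0 D1 ->
  ext_app b D0 D1 (a *: s + t) l = a *: ext_app b D0 D1 s l + ext_app b D0 D1 t
    l.
Proof.
elim: l b D0 D1 s t => [|e l IH] b D0 D1 s t H /=.
  rewrite !form_appE (dd0_lin H) dpartD dpartZ (dd1_lin H) !form_appE.
  by rewrite scalerDr addrACA.
rewrite insD insZ (IH _ _ _ _ _ H) (IH _ _ _ _ _ (der_data_ins e H)).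
apply: cinf_ext => x; rewrite !cinfE; ring.
Qed.

Lemma eq_ext_app b D0 D1 D0' D1' t l : D0 =1 D0' -> D1 =1 D1' ->
  ext_app b D0 D1 t l = ext_app b D0' D1' t l.
Proof. by move=> /funext -> /funext ->. Qed.

Lemma ext_app_data_lin b D0 D1 D0' D1' f t l :
  ext_app b (fun g => fc f ^^ D0 g + D0' g) (fun xi => fc f ^^ D1 xi + D1' xi)
    t l =
  f * ext_app b D0 D1 t l + ext_app b D0' D1' t l.
Proof.
elim: l b D0 D1 D0' D1' t => [|e l IH] b D0 D1 D0' D1' t /=.
  by rewrite !form_appE !form_app_fwedge mulrDr addrACA.
rewrite IH.
rewrite [ext_app (~~ b) _ _ _ _](@eq_ext_app _ _ _ (fun g => fc f ^^ ins_data0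
  e D0 g + ins_data0 e D0' g)
  (fun xi => fc f ^^ ins_data1 b e D0 D1 xi + ins_data1 b e D0' D1' xi)).
- by rewrite IH; apply: cinf_ext => x; rewrite !cinfE; ring.
- by move=> g; rewrite /ins_data0 insD ins_wedge ins_fc wedge0l add0r gr_fc.
- move=> xi; rewrite /ins_data1 insD ins_wedge ins_fc wedge0l add0r gr_fc
  !wedgeE.
  by apply: form_ext => x k; rewrite !formE; ring.
Qed.

Lemma ext_app_data0 b D0 D1 t l : (forall f, D0 f = 0) -> (forall xi, D1 xi =
  0) ->
  ext_app b D0 D1 t l = 0.
Proof.
elim: l b D0 D1 t => [|e l IH] b D0 D1 t h0 h1 /=.
  by rewrite h0 h1 form_app0 addr0.
rewrite !IH ?scaler0 ?addr0 // => [f|xi]; first by rewrite /ins_data0 h0 ins0.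
by rewrite /ins_data1 h0 h1 ins0 scaler0 subr0.
Qed.

(** These data arise as the failure of [ins_data1] to be linear over functions
    in [e]. *)
Lemma ext_app_ins b e w t l : gr true w = sgn b *: w ->
  ext_app (~~ b) (fun _ => 0) (fun xi => fc (pair xi e) ^^ w) t l =
  form_app (w ^^ ins e t) l.
Proof.
elim: l b w t => [|e' l IH] b w t hw /=.
  rewrite form_app0 add0r form_app_fwedge wedge_nil mulrC; congr (_ * _).
  by apply: cinf_ext => x; rewrite /= dpartE.
rewrite IH // form_app_cons ins_wedge hw.
have h' : gr true (ins e' w) = sgn (~~ b) *: ins e' w.
  have := congr1 (ins e') hw;
    rewrite ins_gr insZ /= => /(congr1 (fun z => - z)).
  by rewrite scaleN1r opprK -scaleNr => ->; rewrite sgnN.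
rewrite [ext_app _ (ins_data0 _ _) _ _ _](@eq_ext_app _ _ _ (fun=> 0) (fun xi
  => fc (pair xi e) ^^ ins e' w)).
- rewrite IH // [ins e (ins _ _)]ins_comm !wedgeE !form_appE sgnN.
  by apply: cinf_ext => x; rewrite !cinfE; ring.
- by move=> g; rewrite /ins_data0 ins0.
- by move=> xi; rewrite /ins_data1 scaler0 subr0 ins_wedge ins_fc wedge0l add0r
  gr_fc.
Qed.

Lemma fpart_fwedge f t : form_app (fc f ^^ t) [::] = f * form_app t [::].
Proof. exact: form_app_fwedge. Qed.

Lemma dpart_wedge s t : dpart (s ^^ t) =
  sec_mul (form_app s [::]) (dpart t) + sec_mul (form_app t [::]) (dpart s).
Proof.
apply: fd_inj; rewrite fdD !fdM; apply: form_eq_ins.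
  by rewrite !form_appE !wedge_nil !fd_nil !mulr0 addr0.
move=> e; rewrite insD !ins_wedge !ins_fc !wedge0l !add0r !gr_fc !ins_fd -!fcM
  -fcD.
congr fc; apply: cinf_ext => x; rewrite !pairE !dpartE !cinfE !pairE !dpartE.
have := congr1 (fun g : cinf M => g x) (form_app_cons (s ^^ t) e [::]).
rewrite ins_wedge form_appD !wedge_nil gr_nil !cinfE /= /inner => ->.
by rewrite addrC mulrC; congr (_ + _); rewrite mulrC.
Qed.

(** The Leibniz rule for a product with a function, obtained on lists of
    sections since multilinearity is derived from it. *)
Lemma ext_app_fwedge b D0 D1 f t l : der_data b D0 D1 ->
  ext_app b D0 D1 (fc f ^^ t) l = form_app (D0 f ^^ t) l + f * ext_app b D0 D1
    t l.
Proof.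
elim: l b D0 D1 t => [|e l IH] b D0 D1 t H /=.
  rewrite fpart_fwedge dpart_wedge fc_nil dpart_fc.
  have -> : sec_mul (form_app t [::]) 0 = 0 :> section (dual E).
    by apply: sec_ext => x; rewrite secE scaler0.
  rewrite addr0 (dd0_mul H) (dd1_mul H) !form_appE !wedge_nil !fc_nil fd_nil.
  by rewrite mulr0 add0r mulrDr addrA.
rewrite ins_wedge ins_fc wedge0l add0r gr_fc (IH _ _ _ _ H) (IH _ _ _ _
  (der_data_ins e H)).
rewrite form_app_cons ins_wedge (dd0_gr H) !wedgeE !form_appE.
by apply: cinf_ext => x; rewrite !cinfE; ring.
Qed.

(** In [sgn b D (ins (f e) t) + [ins (f e), D] t] both terms fail to be linear
    over functions in [e], by opposite multiples of [D0 f ^^ ins e t]. *)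
Lemma ext_app_multilinear b D0 D1 t l1 l2 f e e' : der_data b D0 D1 ->
  ext_app b D0 D1 t (l1 ++ (sec_mul f e + e') :: l2) =
  f * ext_app b D0 D1 t (l1 ++ e :: l2) + ext_app b D0 D1 t (l1 ++ e' :: l2).
Proof.
elim: l1 b D0 D1 t => [|e1 l1 IH] b D0 D1 t H /=; last first.
  rewrite (IH _ _ _ _ H) (IH _ _ _ _ (der_data_ins e1 H)).
  by apply: cinf_ext => x; rewrite !cinfE; ring.
rewrite insDl insMl.
have -> : fc f ^^ ins e t + ins e' t = 1 *: (fc f ^^ ins e t) + ins e' t by
  rewrite scale1r.
rewrite (ext_app_lin _ _ _ _ H) scale1r (ext_app_fwedge _ _ _ H).
pose D1' := fun xi => fc (- (cinf_cst M (sgn b))) ^^ (fc (pair xi e) ^^ D0 f) +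
  ins_data1 b e' D0 D1 xi.
rewrite [ext_app _ (ins_data0 _ _) _ _ _](@eq_ext_app _ _ _ (fun g => fc f ^^
  ins_data0 e D0 g + (fc (- (cinf_cst M (sgn b))) ^^ 0 + ins_data0 e' D0 g))
  (fun xi => fc f ^^ ins_data1 b e D0 D1 xi + D1' xi)).
- rewrite ext_app_data_lin ext_app_data_lin (ext_app_ins _ _ _ (dd0_gr H f)).
  by apply: cinf_ext => x; rewrite !cinfE /=; ring.
- by move=> g; rewrite /ins_data0 insDl insMl wedge0r add0r.
- move=> xi; rewrite /D1' /ins_data1 insDl insMl.
  have -> : pair xi (sec_mul f e + e') = f * pair xi e + pair xi e'.
    by apply: (@fc_inj _ _ _ _ E); rewrite -ins_fd insDl insMl !ins_fd fcD fcM.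
  have -> : f * pair xi e + pair xi e' = 1 *: (f * pair xi e) + pair xi e' by
    rewrite scale1r.
  rewrite (dd0_lin H) scale1r (dd0_mul H) !wedgeE fwedgeC.
  apply: form_ext => x k; rewrite !formE !fwedgeE !cinfE /=; ring.
Qed.

(** The graded commutator of [ins e] with [[ins e, D]] is zero since [ins e]
    squares to zero. *)
Lemma ext_app_alternating b D0 D1 t l1 l2 e : der_data b D0 D1 ->
  ext_app b D0 D1 t (l1 ++ e :: e :: l2) = 0.
Proof.
elim: l1 b D0 D1 t => [|e1 l1 IH] b D0 D1 t H /=; last first.
  by rewrite (IH _ _ _ _ H) (IH _ _ _ _ (der_data_ins e1 H)) scaler0 addr0.
have z : ext_app b D0 D1 0 l2 = 0.
  have := ext_app_lin (-1) 0 0 l2 H; rewrite scaler0 addr0.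
  by rewrite scaleN1r addNr.
rewrite ins_ins z [ext_app (~~ ~~ b) _ _ _ _]ext_app_data0.
- by rewrite sgnN scaler0 add0r addr0 scaleNr subrr.
- by move=> f; rewrite /ins_data0 ins_ins.
- move=> xi; rewrite /ins_data1 insD insN ins_ins insZ /ins_data0 sgnN scaleNr.
  by rewrite opprK sub0r addNr.
Qed.

Definition der_ext b D0 D1 t : form E := xget 0 [set w | forall l, form_app w l
  = ext_app b D0 D1 t l].

Lemma der_extE b D0 D1 t l : der_data b D0 D1 ->
  form_app (der_ext b D0 D1 t) l = ext_app b D0 D1 t l.
Proof.
move=> H; rewrite /der_ext; case: xgetP => [w _|]; first exact.
have [w hw] := tensor_form (fun l1 l2 f e e' => @ext_app_multilinear b D0 D1 t
  l1 l2 f e e' H)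
  (fun l1 l2 e => @ext_app_alternating b D0 D1 t l1 l2 e H).
by move/(_ w) => /(_ hw).
Qed.

Lemma ins_der_ext b D0 D1 t e : der_data b D0 D1 ->
  ins e (der_ext b D0 D1 t) = sgn b *: der_ext b D0 D1 (ins e t) +
    der_ext (~~ b) (ins_data0 e D0) (ins_data1 b e D0 D1) t.
Proof.
move=> H; apply: form_app_inj => l; rewrite !form_appE -form_app_cons.
by rewrite !der_extE //; exact: der_data_ins.
Qed.

Lemma der_ext_lin b D0 D1 a s t : der_data b D0 D1 ->
  der_ext b D0 D1 (a *: s + t) = a *: der_ext b D0 D1 s + der_ext b D0 D1 t.
Proof.
by move=> H; apply: form_app_inj => l;
  rewrite !form_appE !der_extE // ext_app_lin.
Qed.

Lemma der_ext_gr b D0 D1 s : der_data b D0 D1 ->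
  der_ext b D0 D1 (gr true s) = sgn b *: gr true (der_ext b D0 D1 s).
Proof.
move=> H; apply: form_app_inj => l;
  elim: l b D0 D1 s H => [|e l IH] b D0 D1 s H.
  rewrite form_appZ gr_nil !der_extE //= gr_nil.
  have -> : dpart (gr true s) = (-1) *: dpart s.
    rewrite -dpartZ; apply: sec_ext => x; apply/lfunP => v; rewrite !dpartE.
    by rewrite gradeE formE /= expr1.
  have -> : D1 ((-1) *: dpart s) = - D1 (dpart s).
    have D10 : D1 0 = 0.
      have := dd1_lin H (-1) 0 0; rewrite scaler0 addr0.
      by rewrite scaleN1r addNr.
    by have := dd1_lin H (-1) (dpart s) 0; rewrite !addr0 D10 addr0 scaleN1r.
  have e0 := gr_nil true (D0 (form_app s [::])).
  have e1 := gr_nil true (D1 (dpart s)).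
  move: e0 e1; rewrite (dd0_gr H) (dd1_gr H) !form_appE sgnN => e0 e1.
  by rewrite scalerDr -{1}e0 -{1}e1 scaleNr opprK; congr (_ + _); rewrite e0.
have H' := der_data_ins e H.
rewrite !form_app_cons insZ ins_gr !ins_der_ext // ins_gr.
rewrite grD grZ /= !form_appE.
have -> : der_ext b D0 D1 (-1 *: gr true (ins e s)) = (-1) *: der_ext b D0 D1
  (gr true (ins e s)).
  have := der_ext_lin (-1) (gr true (ins e s)) 0 H; rewrite addr0 => ->.
  have := der_ext_lin (-1) 0 0 H; rewrite scaler0 addr0 => ->.
  by rewrite scaleN1r addNr addr0.
rewrite !form_appE (IH _ _ _ _ H) (IH _ _ _ _ H') !form_appE sgnN.
by apply: cinf_ext => x; rewrite !cinfE; ring.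
Qed.

Lemma der_ext_wedge b D0 D1 s t : der_data b D0 D1 ->
  der_ext b D0 D1 (s ^^ t) = der_ext b D0 D1 s ^^ t + gr b s ^^ der_ext b D0 D1
    t.
Proof.
move=> H; apply: form_app_inj => l;
  elim: l b D0 D1 s t H => [|e l IH] b D0 D1 s t H.
  rewrite form_appD !wedge_nil gr_nil !der_extE //= wedge_nil dpart_wedge.
  have := dd1_lin H 1 (sec_mul (form_app s [::]) (dpart t)) (sec_mul (form_app
    t [::]) (dpart s)).
  rewrite !scale1r => ->;
    rewrite (dd0_mul H) !(dd1_mul H) !form_appE !wedge_nil !fc_nil !fd_nil.
  by apply: cinf_ext => x; rewrite !cinfE; ring.
have H' := der_data_ins e H.
rewrite !form_app_cons ins_der_ext // ins_wedge insD !ins_wedge !ins_der_ext //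
  ins_gr.
have -> : der_ext b D0 D1 (ins e s ^^ t + gr true s ^^ ins e t) =
    der_ext b D0 D1 (ins e s ^^ t) + der_ext b D0 D1 (gr true s ^^ ins e t).
  by have := der_ext_lin 1 (ins e s ^^ t) (gr true s ^^ ins e t) H;
    rewrite !scale1r.
rewrite !form_appE !(IH _ _ _ _ _ H) (IH _ _ _ _ _ H') (der_ext_gr _ H) !wedgeE
  !form_appE !gr_gr.
rewrite (addbC b) /=.
have := sgn_sgn R b.
case: b {IH H H'} => /= h; apply: cinf_ext => x; rewrite !cinfE; ring.
Qed.

Lemma isder_der_ext b D0 D1 : der_data b D0 D1 -> isder b (der_ext b D0 D1).
Proof.
move=> H; split=> [a s t|s t|s]; first exact: der_ext_lin.
  exact: der_ext_wedge.
exact: der_ext_gr.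
Qed.

Lemma dd00 b D0 D1 : der_data b D0 D1 -> D0 0 = 0.
Proof.
by move=> H; have := dd0_lin H (-1) 0 0; rewrite scaler0 addr0 scaleN1r addNr.
Qed.
Lemma dd10 b D0 D1 : der_data b D0 D1 -> D1 0 = 0.
Proof.
by move=> H; have := dd1_lin H (-1) 0 0; rewrite scaler0 addr0 scaleN1r addNr.
Qed.

Lemma der_ext0 b D0 D1 : der_data b D0 D1 -> der_ext b D0 D1 0 = 0.
Proof. by move=> H; exact: der0 (isder_der_ext H). Qed.

Lemma der_ext_fc b D0 D1 f : der_data b D0 D1 -> der_ext b D0 D1 (fc f) = D0 f.
Proof.
move=> H; apply: form_app_inj => l; elim: l b D0 D1 H => [|e l IH] b D0 D1 H.
  by rewrite der_extE //= fc_nil dpart_fc (dd10 H) form_app0 addr0.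
have H' := der_data_ins e H.
by rewrite !form_app_cons ins_der_ext // ins_fc der_ext0 // scaler0 add0r IH.
Qed.

Lemma der_ext_fd b D0 D1 xi : der_data b D0 D1 -> der_ext b D0 D1 (fd xi) = D1
  xi.
Proof.
move=> H; apply: form_app_inj => l; elim: l b D0 D1 H => [|e l IH] b D0 D1 H.
  by rewrite der_extE //= fd_nil dpart_fd (dd00 H) form_app0 add0r.
have H' := der_data_ins e H.
rewrite !form_app_cons ins_der_ext // ins_fd der_ext_fc // form_appD IH //
  /ins_data1 !form_appE.
by rewrite addrCA subrr addr0.
Qed.

Lemma der_ext_homog b D0 D1 (i k : int) t : der_data b D0 D1 ->
  (forall f, homog k (D0 f)) -> (forall xi, homog (k + 1) (D1 xi)) ->
  homog i t -> homog (i + k) (der_ext b D0 D1 t).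
Proof.
move=> H h0 h1 ht x l; have [m <-] := extend_vecs l; rewrite size_map => nz.
apply/eqP/negPn/negP => /eqP ne; apply: nz.
suff z : ext_app b D0 D1 t m = 0.
  exact: (congr1 (fun g : cinf M => g x) (etrans (der_extE t m H) z)).
elim: m b D0 D1 i k t H h0 h1 ht ne {l} => [|e m IH] b D0 D1 i k t H h0 h1 ht
  ne /=.
  have z (s : form E) j : homog j s -> j <> 0 -> form_app s [::] = 0.
    move=> hs j0; apply: cinf_ext => y; apply: contrapT => /hs /= e.
    by apply: j0; rewrite -e.
  case: (pselect (k = 0)) => k0.
    rewrite (z (D1 _) _ (h1 _)) ?k0 // addr0 (z t i ht) ?(dd00 H) ?form_app0 //.
    by move=> i0; apply: ne; rewrite i0 k0.
  rewrite (z (D0 _) _ (h0 _)) // add0r.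
  case: (pselect (k + 1 = 0)) => k1; last by rewrite (z (D1 _) _ (h1 _)).
  have -> : dpart t = 0; last by rewrite (dd10 H) form_app0.
  apply: fd_inj; rewrite fd0; apply: form_eq_ins;
    first by rewrite fd_nil form_app0.
  move=> e; rewrite ins_fd ins0 -fc0; congr fc; apply: cinf_ext => y.
  rewrite pairE dpartE; apply: contrapT => /ht /= e1; apply: ne.
  by rewrite -e1 addrC k1.
have H' := der_data_ins e H.
rewrite (IH _ _ _ (i - 1) k _ H) //; last 2 first.
- exact: homog_ins.
- move=> e1; apply: ne; rewrite /= -addn1 PoszD e1; ring.
rewrite (IH _ _ _ i (k - 1) _ H') ?scaler0 ?addr0 //.
- by move=> f; exact: homog_ins.
- move=> xi; apply: homogD.
    have -> : k - 1 + 1 = k + 1 - 1 by ring.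
    exact: homog_ins.
  apply: homogN; apply: homogZ; rewrite subrK; exact: h0.
- move=> e1; apply: ne; rewrite /= -addn1 PoszD e1; ring.
Qed.

(** The converse of [der_eq]: [ext_app] is multilinear over functions and
    alternating, hence given by forms, and the Leibniz rule follows by
    contracting both sides. *)
Theorem der_exists b D0 D1 : der_data b D0 D1 ->
  exists D, [/\ isder b D, forall f, D (fc f) = D0 f, forall xi, D (fd xi) = D1
    xi &
    forall k : int, (forall f, homog k (D0 f)) -> (forall xi, homog (k + 1) (D1
      xi)) ->
      forall i s, homog i s -> homog (i + k) (D s)].
Proof.
move=> H; exists (der_ext b D0 D1); split=> [|f|xi|k h0 h1 i s].
- exact: isder_der_ext.
- exact: der_ext_fc.
- exact: der_ext_fd.
- exact: der_ext_homog.
Qed.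

End Derivations.

(** * Parity, degree and graded commutators *)

Section More.
Variables (R : realType) (n : nat) (M : manifold R n).
Variables (r : nat) (E : vbundle M r).
Implicit Types (s t u : form E) (e : section E) (f g : cinf M).
Implicit Types (xi : section (dual E)) (b : bool).
Local Notation fc := (form_of_cinf E).
Local Notation fd := (@form_of_dual R n M r E).
Local Notation "s ^^ t" := (wedge s t) (at level 40, left associativity).
Local Notation sgn := (sgn R).
Local Arguments gr : simpl never.

Definition zodd (i : int) := odd `|i|%N.
Lemma zoddD (i j : int) : zodd (i + j) = zodd i (+) zodd j.
Proof.
rewrite /zodd; lia.
Qed.
Lemma zoddM (i j : int) : zodd (i * j) = zodd i && zodd j.
Proof. by rewrite /zodd abszM oddM. Qed.
Lemma gsignE (i : int) : gsign R i = sgn (zodd i).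
Proof.
rewrite /gsign /zodd; case: i => k; last rewrite NegzE -exprnN.
  by rewrite /= -exprnP -signr_odd; case: (odd k).
by rewrite /= -exprVn invrN1 -signr_odd /=; case: (odd k).
Qed.
Lemma sgnM b b' : sgn b * sgn b' = sgn (b (+) b').
Proof. by case: b; case: b'; rewrite /= ?mulr1 ?mul1r ?mulrNN ?mulr1. Qed.

Lemma gr_homogz (i : int) s b : homog i s -> gr b s = sgn (b && zodd i) *: s.
Proof.
case: b => [|_]; last by rewrite /= scale1r.
move=> h; case: (homog_nat h) => [->|[k ik]]; first by rewrite gr0 scaler0.
by move: h; rewrite ik => /gr_homog.
Qed.

Lemma homog_app (k : nat) s : (forall l, size l != k -> form_app s l = 0) ->
  homog k s.
Proof.
move=> h x l; have [m <-] := extend_vecs l; rewrite size_map => nz; congr Posz.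
apply/eqP/negPn/negP => /h e; apply: nz.
exact: (congr1 (fun g : cinf M => g x) e).
Qed.

Lemma app_homog (k : int) s l : homog k s -> (size l)%:Z <> k -> form_app s l =
  0.
Proof.
move=> h ne; apply: cinf_ext => x; apply: contrapT => /h.
by rewrite size_map.
Qed.

Lemma homog_eq (k : int) s t : homog k s -> homog k t ->
  (forall l, (size l)%:Z = k -> form_app s l = form_app t l) -> s = t.
Proof.
move=> hs ht h; apply: form_app_inj => l.
case: (pselect ((size l)%:Z = k)) => [/h//|ne].
by rewrite (app_homog hs ne) (app_homog ht ne).
Qed.

Lemma isder_ins e : isder true (ins e : form E -> form E).
Proof.
split=> [a s t|s t|s]; first by rewrite insD insZ.
  by rewrite ins_wedge.
by rewrite ins_gr.
Qed.

Lemma isder0 b : isder b (fun _ : form E => 0).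
Proof.
split=> [a s t|s t|s]; first by rewrite scaler0 addr0.
  by rewrite wedge0l wedge0r addr0.
by rewrite gr0 scaler0.
Qed.

Lemma isder_comm b b' D D' : isder b D -> isder b' D' ->
  isder (b (+) b') (fun s => D (D' s) - sgn (b && b') *: D' (D s)).
Proof.
move=> dD dD'; split=> [a s t|s t|s].
- rewrite !(derD dD, derD dD', derZ dD, derZ dD').
  apply: form_ext => x l; rewrite !formE; ring.
- rewrite (der_wedge dD) (der_wedge dD') (derD dD) (derD dD') !(der_wedge dD)
  !(der_wedge dD').
  rewrite (der_grb dD) (der_grb dD') !wedgeE !gr_gr [b' && b]andbC [b' (+)
    b]addbC.
  apply: form_ext => x l; rewrite !formE.
  have := sgn_sgn R (b && b').
  move: (sgn (b && b')) => a h.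
  transitivity (
    (D (D' s) ^^ t) x l + (gr b (D' s) ^^ D t) x l +
    (a * (gr b' (D s) ^^ D' t) x l + (gr (b (+) b') s ^^ D (D' t)) x l) -
    (a * (D' (D s) ^^ t) x l + a * (gr b' (D s) ^^ D' t) x l +
    ((a * a) * (gr b (D' s) ^^ D t) x l + a * (gr (b (+) b') s ^^ D' (D t)) x
      l))).
    ring.
  rewrite h; ring.
- rewrite (der_gr dD) (der_gr dD') !(derZ dD, derZ dD') (der_gr dD) (der_gr
  dD').
  rewrite grD grN grZ -[sgn (b (+) b')]sgnM.
  apply: form_ext => x l; rewrite !formE; ring.
Qed.

(** Leibniz rules for homogeneous forms suffice, since every form is a finite
    sum of these. *)
Lemma isder_homog b D :
  (forall a s t, D (a *: s + t) = a *: D s + D t) ->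
  (forall (i : nat) s, homog i s -> gr true (D s) = sgn (odd i (+) b) *: D s) ->
  (forall (i j : nat) s t, homog i s -> homog j t ->
    D (s ^^ t) = D s ^^ t + sgn (b && odd i) *: (s ^^ D t)) ->
  isder b D.
Proof.
move=> lD gD wD.
have D0 : D 0 = 0 by have := lD (-1) 0 0; rewrite scaler0 addr0 scaleN1r addNr.
have DD s t : D (s + t) = D s + D t by have := lD 1 s t; rewrite !scale1r.
have DZ a s : D (a *: s) = a *: D s by have := lD a s 0;
  rewrite !addr0 D0 addr0.
split=> // [s t|]; last first.
  apply: form_add_ind => [|s t hs ht|i s hs].
  - by rewrite gr0 D0 gr0 scaler0.
  - by rewrite grD !DD hs ht grD scalerDr.
  - by rewrite (gr_homog hs) DZ (gD _ _ hs) scalerA sgnM addbCA addbb addbF.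
move: s t; apply: form_add_ind => [t|s s' hs hs' t|i s hs].
- by rewrite wedge0l D0 gr0 !wedge0l addr0.
- by rewrite wedgeDl DD hs hs' grD DD !wedgeDl addrACA.
apply: form_add_ind => [|t t' ht ht'|j t ht].
- by rewrite wedge0r D0 !wedge0r addr0.
- by rewrite wedgeDr DD ht ht' DD !wedgeDr addrACA.
by rewrite (wD _ _ _ _ hs ht) (gr_homogz _ hs) wedgeZl.
Qed.

Lemma isder_vf b k D : isder b D -> zodd k = b ->
  (forall i s, homog i s -> homog (i + k) (D s)) -> vector_field k D.
Proof.
move=> dD kb hD; split=> // [a s t|i j s t hs ht]; first exact: (der_lin dD).
by rewrite (der_wedge dD) (gr_homogz _ hs) wedgeZl gsignE zoddM kb.
Qed.

Lemma vf_isder k (D : form E -> form E) : vector_field k D -> isder (zodd k) D.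
Proof.
case=> lD hD wD; apply: isder_homog => [a s t|i s hs|i j s t hs ht].
- exact: lD.
- by rewrite (gr_homogz _ (hD _ _ hs)) zoddD.
- by rewrite (wD _ _ _ _ hs ht) gsignE zoddM.
Qed.

Lemma insZl a e s : ins (a *: e) s = a *: ins e s.
Proof.
by rewrite -[a *: e]/(sec_mul (cinf_cst M a) e) insMl; apply: form_ext => x l;
  rewrite fwedgeE formE.
Qed.
Lemma insNl e s : ins (- e) s = - ins e s.
Proof. by rewrite -scaleN1r insZl scaleN1r. Qed.

Lemma sec_eq_pair e e' : (forall xi, pair xi e = pair xi e') -> e = e'.
Proof.
move=> h; apply: sec_ext => x; have [F EF Fx] := vb_cover E x.
rewrite (frame_sum (e x) Fx) (frame_sum (e' x) Fx); apply: eq_bigr => i _.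
have [xi hxi] := @extend_vec _ _ _ _ (dual E) x (tnth (dual_tuple (lf_vec F x))
  i).
have := congr1 (fun g : cinf M => g x) (h xi).
by rewrite !pairE hxi !dual_tupleE => ->.
Qed.

Lemma sec_eq_ins e e' : (forall s, ins e s = ins e' s) -> e = e'.
Proof.
move=> h; apply: sec_eq_pair => xi; apply: (@fc_inj _ _ _ _ E).
by rewrite -!ins_fd h.
Qed.

Lemma form1_exists (phi : section E -> cinf M) :
  (forall f e e', phi (sec_mul f e + e') = f * phi e + phi e') ->
  exists xi, forall e, pair xi e = phi e.
Proof.
move=> lphi; pose a (l : seq (section E)) : cinf M := if l is [:: e] then phi e
  else 0.
have [||w hw] := @tensor_form _ _ _ _ E a.
- by move=> [|e1 [|e2 l1]] [|e3 l2] f e e' /=; rewrite ?mulr0 ?addr0.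
- by move=> [|e1 [|e2 l1]] l2 e.
exists (dpart w) => e; rewrite -[RHS](hw [:: e]); apply: cinf_ext => x.
by rewrite pairE dpartE.
Qed.

Lemma form2_exists (phi : section E -> section E -> cinf M) :
  (forall e e', phi e e' = - phi e' e) ->
  (forall e0 f e e', phi e0 (sec_mul f e + e') = f * phi e0 e + phi e0 e') ->
  exists2 w : form E, homog 2 w & forall e e', form_app w [:: e; e'] = phi e e'.
Proof.
move=> phiN lphi.
have phi0 e : phi e e = 0.
  apply: cinf_ext => x; have := congr1 (fun g : cinf M => g x) (phiN e e).
  by rewrite cinfNE cinf0E; lra.
pose a (l : seq (section E)) : cinf M :=
  if l is [:: e; e'] then phi e e' else 0.
have [||w hw] := @tensor_form _ _ _ _ E a.
- move=> [|e1 [|e2 [|e3 l1]]] [|e4 [|e5 l2]] f e e' /=;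
  rewrite ?mulr0 ?addr0 //.
  by rewrite phiN lphi opprD -mulrN -!phiN.
- by move=> [|e1 [|e2 [|e3 l1]]] [|e4 l2] e //=.
exists w => [|e e']; last by rewrite hw.
by apply: homog_app => -[|e1 [|e2 [|e3 l]]] // _; rewrite hw.
Qed.

End More.

(** * Cartan calculus of an odd vector field *)

Section Cartan.
Variables (R : realType) (n : nat) (M : manifold R n).
Variables (r : nat) (E : vbundle M r).
Implicit Types (s t u : form E) (e : section E) (f g : cinf M).
Implicit Types (xi : section (dual E)) (b : bool).
Local Notation fc := (form_of_cinf E).
Local Notation fd := (@form_of_dual R n M r E).
Local Notation "s ^^ t" := (wedge s t) (at level 40, left associativity).
Local Notation sgn := (sgn R).
Local Arguments gr : simpl never.

(** A bundle of finite rank is its own bidual. *)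
Lemma bidual_section (phi : section (dual E) -> cinf M) :
  (forall f xi xi', phi (sec_mul f xi + xi') = f * phi xi + phi xi') ->
  exists e, forall xi, pair xi e = phi xi.
Proof.
move=> /form1_exists[w hw].
pose F0 x := sval (cid2 (vb_cover E x)).
have F0P x : lf_dom (F0 x) x by rewrite /F0; case: cid2.
pose wv x (p : dual E x) : R := (w x : 'Hom(dual E x, R^o)) p.
pose h x : E x := \sum_i wv x (tnth (dual_tuple (lf_vec (F0 x) x)) i) *: tnth
  (lf_vec (F0 x) x) i.
have hE x (p : dual E x) : (p : 'Hom(E x, R^o)) (h x) = wv x p.
  rewrite [in RHS](@frame_sum _ _ _ _ (dual E) (dual_frame (F0 x)) x p (F0P x)).
  rewrite /h /wv !linear_sum; apply: eq_bigr => i _.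
  by rewrite !linearZ /= coord_dual ?lf_basis //; exact: mulrC.
have sh : smooth_section h.
  move=> F EF i; have oF := @lf_open _ _ _ _ F.
  have EF' : vb_frame (dual E) (dual_frame F) by exists F.
  have EF'' : vb_frame (dual (dual E)) (dual_frame (E := dual E) (dual_frame
    F)).
    by exists (dual_frame F).
  apply: smooth_ext (secP w EF'' i) => // x Fx /=.
  rewrite coord_dual; last by apply: dual_basis; exact: lf_basis.
  by rewrite -/(wv x _) -hE dual_tupleE.
exists (Section_ sh) => xi; rewrite -hw; apply: cinf_ext => x.
by rewrite !pairE -[RHS]/(wv x (xi x)) -hE.
Qed.

Lemma fc_app s : homog 0 s -> fc (form_app s [::]) = s.
Proof. by move=> h; rewrite -homog0_fc. Qed.

Section Lie.
Variable Q : form E -> form E.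
Hypothesis dQ : isder true Q.
Hypothesis hQ : forall i s, homog i s -> homog (i + 1) (Q s).

(** Cartan's formula for the Lie derivative. *)
Definition lie e s := ins e (Q s) + Q (ins e s).

Lemma isder_lie e : isder false (lie e).
Proof.
have := isder_comm (isder_ins e) dQ; rewrite /= => h.
split=> [a s t|s t|s].
- by have := der_lin h a s t; rewrite !scaleN1r !opprK.
- by have := der_wedge h s t; rewrite !scaleN1r !opprK.
- by have := der_gr h s; rewrite !scaleN1r !opprK.
Qed.

Lemma homog_lie e i s : homog i s -> homog i (lie e s).
Proof.
move=> hs; apply: homogD.
  by have := homog_ins (e := e) (hQ hs); rewrite addrK.
by have := hQ (homog_ins (e := e) hs); rewrite subrK.
Qed.

Lemma lie_fc e f : lie e (fc f) = ins e (Q (fc f)).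
Proof. by rewrite /lie ins_fc (der0 dQ) addr0. Qed.

Lemma Q_fc_fd f : exists xi, Q (fc f) = fd xi.
Proof.
exists (dpart (Q (fc f))); apply: homog1_fd.
exact: (hQ (@homog_fc _ _ _ _ E f)).
Qed.

Definition anchor_act e f := form_app (Q (fc f)) [:: e].

Lemma ins_Q_fc e f : ins e (Q (fc f)) = fc (anchor_act e f).
Proof.
rewrite /anchor_act form_app_cons fc_app //.
by have := homog_ins (e := e) (hQ (@homog_fc _ _ _ _ E f)).
Qed.

(** The commutator of a Lie derivative with a contraction. *)
Definition derived_br e e' s := lie e (ins e' s) - ins e' (lie e s).

Lemma isder_derived_br e e' : isder true (derived_br e e').
Proof.
have h := isder_comm (isder_lie e) (isder_ins e').
split=> [a s t|s t|s].
- by have := der_lin h a s t; rewrite !scale1r.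
- by have := der_wedge h s t; rewrite !scale1r.
- by have := der_gr h s; rewrite !scale1r.
Qed.

Lemma derived_br_fc e e' f : derived_br e e' (fc f) = 0.
Proof.
by rewrite /derived_br ins_fc (der0 (isder_lie e)) lie_fc ins_Q_fc ins_fc subrr.
Qed.

Lemma derived_br_homog e e' i s : homog i s -> homog (i - 1) (derived_br e e'
  s).
Proof.
move=> hs; apply: homogD; first by apply/homog_lie/homog_ins.
by apply/homogN/homog_ins/homog_lie.
Qed.

(** A derivation of degree -1 kills functions, hence is linear over functions;
    on 1-forms it is an element of the bidual. *)
Lemma derived_br_exists e e' : exists h, forall s, ins h s = derived_br e e' s.
Proof.
have dD := isder_derived_br e e'.
have [|h hh] := @bidual_section (fun xi => form_app (derived_br e e' (fd xi))
  [::]).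
  move=> f xi xi'; rewrite fdD fdM (derD dD) (der_fwedge dD) derived_br_fc
    wedge0l add0r.
  by rewrite form_appD form_app_fwedge.
exists h; apply: der_eq (isder_ins h) dD _ _ => [f|xi].
  by rewrite ins_fc derived_br_fc.
rewrite ins_fd hh fc_app //.
by have := @derived_br_homog e e' _ _ (@homog_fd _ _ _ _ E xi).
Qed.

Lemma del0 T (x : T) l : del 0 (x :: l) = l.
Proof. by rewrite /del /= drop0. Qed.
Lemma delS T i (x : T) l : del i.+1 (x :: l) = x :: del i l.
Proof. by []. Qed.

Section Formula.
Variables (rho : bundle_map_TM E) (br : section E -> section E -> section E).
Hypothesis rhoQ : forall e f, anchor_act e f = bm_act rho e f.
Hypothesis brQ : forall e e' s, ins (br e e') s = derived_br e e' s.

(** Moves the Lie derivative past the contractions with the arguments, each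
    time at the cost of a contraction with a derived bracket. *)
Lemma lie_formula (k : nat) s e l : homog k s -> size l = k ->
  form_app (lie e s) l = bm_act rho e (form_app s l) -
    \sum_(i < k) (-1) ^+ i *: form_app s (br e l`_i :: del i l).
Proof.
elim: k s l => [|k IH] s [|e' l] // hs.
  move=> _; rewrite big_ord0 subr0 [in LHS](homog0_fc hs) lie_fc ins_Q_fc
    fc_nil.
  exact: rhoQ.
move=> [sl]; have hs' : homog k (ins e' s).
  by have := homog_ins (e := e') hs; rewrite -addn1 PoszD addrK.
have -> : form_app (lie e s) (e' :: l) = form_app (lie e (ins e' s)) l -
  form_app (ins (br e e') s) l.
  rewrite form_app_cons brQ /derived_br !form_appE.
  by apply: cinf_ext => x; rewrite !cinfE; ring.
rewrite (IH _ _ hs' sl) -form_app_cons big_ord_recl /= expr0 scale1r /del /=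
  drop0.
rewrite -form_app_cons opprD addrA addrAC -!sumrN.
congr (_ + _ + _). apply: eq_bigr => i _; rewrite /bump /= add1n /=.
by rewrite exprS !form_app_cons ins_comm form_appN -scalerA scaleN1r scalerN
  opprK.
Qed.

(** Unrolls [ins e (Q s) = lie e s - Q (ins e s)] along the list of arguments;
    the derived brackets of [lie_formula] make up the double sum. *)
Lemma Q_formula (k : nat) s : homog k%:Z s ->
  forall e : seq (section E), size e = k.+1 ->
  form_app (Q s) e =
    \sum_(i < k.+1)
       (-1) ^+ i *: bm_act rho e`_i (form_app s (del i e)) +
    \sum_(j < k.+1) \sum_(i < j)
       (-1) ^+ (i + j) *:
         form_app s (br e`_i e`_j :: del i (del j e)).
Proof.
elim: k s => [|k IH] s hs [|e l] // [sl].
all: have -> : form_app (Q s) (e :: l) = form_app (lie e s) l - form_app (Q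
  (ins e s)) l by
  rewrite form_app_cons /lie form_appD addrK.
  rewrite !big_ord_recl !big_ord0 /= !addr0 expr0 scale1r /del /= drop0.
  move/eqP: sl; rewrite size_eq0 => /eqP ->.
  rewrite (lie_formula e hs) // big_ord0 subr0 [s](homog0_fc hs) ins_fc (der0
    dQ).
  by rewrite form_app0 subr0.
have hs' : homog k (ins e s).
  by have := homog_ins (e := e) hs;
    rewrite -[X in homog (Posz X - _)]addn1 PoszD addrK.
rewrite (lie_formula e hs sl) (IH _ hs' _ sl).
rewrite [in RHS]big_ord_recl /= expr0 scale1r del0.
rewrite [X in _ = _ + X]big_ord_recl big_ord0 add0r opprD -!addrA;
  congr (_ + _).
rewrite addrCA; congr (_ + _).
  rewrite -sumrN; apply: eq_bigr => i _; rewrite /bump /= add1n exprS.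
  by rewrite -scalerA scaleN1r delS form_app_cons.
rewrite -!sumrN -big_split /=; apply: eq_bigr => j _.
rewrite /bump /= add1n big_ord_recl /= add0n exprS -scalerA scaleN1r.
congr (_ + _); first by rewrite delS del0.
rewrite -sumrN; apply: eq_bigr => i _; rewrite /bump /= add1n /=.
rewrite !delS addSn addnS !exprS mulN1r mulN1r opprK.
by rewrite !form_app_cons ins_comm form_appN scalerN opprK.
Qed.

End Formula.

End Lie.
End Cartan.

(** * Lie algebroids and homological vector fields *)

Section Algebroid.
Variables (R : realType) (n : nat) (M : manifold R n).
Variables (r : nat) (E : vbundle M r).
Implicit Types (s t u : form E) (e : section E) (f g : cinf M).
Implicit Types (xi : section (dual E)) (b : bool).
Local Notation fc := (form_of_cinf E).
Local Notation fd := (@form_of_dual R n M r E).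
Local Notation "s ^^ t" := (wedge s t) (at level 40, left associativity).
Local Notation sgn := (sgn R).
Local Arguments gr : simpl never.

Section FromQ.
Variable Q : form E -> form E.
Hypothesis dQ : isder true Q.
Hypothesis hQ : forall i s, homog i s -> homog (i + 1) (Q s).
Hypothesis QQ : forall s, Q (Q s) = 0.

Section Anchor.
Variables (x : M) (v : E x).
Definition q_anchor_fun f := Q (fc f) x [:: v].
Fact q_anchor_linear a f g : q_anchor_fun (a *: f + g) = a * q_anchor_fun f +
  q_anchor_fun g.
Proof. by rewrite /q_anchor_fun fcD fcZ (der_lin dQ) !formE. Qed.
Fact q_anchor_leibniz f g : q_anchor_fun (f * g) = f x * q_anchor_fun g +
  q_anchor_fun f * g x.
Proof.
rewrite /q_anchor_fun fcM (der_fwedge dQ) fwedgeC formE !fwedgeE addrC.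
by rewrite [X in _ + X]mulrC.
Qed.
Definition q_anchor_tan : tangent x := Tangent q_anchor_linear q_anchor_leibniz.
End Anchor.

Fact q_anchor_bm_linear x : linear (@q_anchor_tan x).
Proof.
move=> a u v; apply: tan_ext => f.
exact: (form_multilinear (Q (fc f)) [::] [::] a u v).
Qed.
Fact q_anchor_bm_smooth F : vb_frame E F -> forall i f,
  smooth_on (lf_dom F) (fun x => q_anchor_tan (tnth (lf_vec F x) i : E x) f).
Proof. by move=> EF i f; exact: (form_smooth (Q (fc f)) EF [:: i]). Qed.
Definition q_anchor : bundle_map_TM E := BundleMapTM q_anchor_bm_linear
  q_anchor_bm_smooth.

Lemma q_anchorE e f : anchor_act Q e f = bm_act q_anchor e f.
Proof. exact: cinf_ext. Qed.

Definition q_bracket e e' : section E := sval (cid (derived_br_exists dQ hQ e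
  e')).
Lemma ins_q_bracket e e' s : ins (q_bracket e e') s = derived_br Q e e' s.
Proof. by rewrite /q_bracket; case: cid => h /= ->. Qed.

Definition derived_brE e e' s : derived_br Q e e' s =
  ins e (Q (ins e' s)) + Q (ins e (ins e' s)) - ins e' (ins e (Q s)) - ins e'
    (Q (ins e s)).
Proof. by rewrite /derived_br /lie insD opprD addrA. Qed.

Fact q_bracket_Dl a e e' (u : section E) : q_bracket (a *: e + e') u = a *:
  q_bracket e u + q_bracket e' u.
Proof.
apply: sec_eq_ins => s; rewrite insDl insZl !ins_q_bracket !derived_brE.
rewrite !(insDl, insZl, insD, insZ, derD dQ, derZ dQ).
by apply: form_ext => x l; rewrite !formE; ring.
Qed.
Fact q_bracket_Dr a e e' (u : section E) : q_bracket u (a *: e + e') = a *: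
  q_bracket u e + q_bracket u e'.
Proof.
apply: sec_eq_ins => s; rewrite insDl insZl !ins_q_bracket !derived_brE.
rewrite !(insDl, insZl, insD, insZ, derD dQ, derZ dQ).
by apply: form_ext => x l; rewrite !formE; ring.
Qed.
Fact q_bracket_alt e : q_bracket e e = 0.
Proof.
apply: sec_eq_ins => s;
  rewrite ins_q_bracket derived_brE !ins_ins (der0 dQ) ins_0.
by rewrite addr0 subr0 subrr.
Qed.
Fact q_bracket_leibniz f e e' : q_bracket e (sec_mul f e') = sec_mul f
  (q_bracket e e') + sec_mul (bm_act q_anchor e f) e'.
Proof.
apply: sec_eq_ins => s;
  rewrite insDl !insMl !ins_q_bracket !derived_brE !insMl -q_anchorE.
rewrite !(insD, ins_wedge, der_fwedge dQ, gr_fc, ins_fc, wedge0l, add0r).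
rewrite (ins_Q_fc hQ) !wedgeE.
have -> : gr true (Q (fc f)) = - Q (fc f).
  have [xi ->] := Q_fc_fd hQ f; by rewrite gr_fd /= scaleN1r.
by apply: form_ext => x l; rewrite !(formE, fwedgeE, wedgeE); ring.
Qed.

Lemma lie_Q e s : lie Q e (Q s) = Q (lie Q e s).
Proof. by rewrite /lie QQ ins0 add0r (derD dQ) QQ addr0. Qed.

(** As [Q] squares to zero, Lie derivatives commute with [Q]. Taking the
    commutator of [derived_br] with [Q] therefore turns contractions into Lie
    derivatives. *)
Lemma lie_q_bracket e e' s : lie Q (q_bracket e e') s = lie Q e (lie Q e' s) -
  lie Q e' (lie Q e s).
Proof.
have -> : lie Q e (lie Q e' s) = lie Q e (ins e' (Q s)) + lie Q e (Q (ins e'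
  s)).
  by rewrite -(derD (isder_lie dQ e)).
have -> : lie Q e' (lie Q e s) = ins e' (Q (lie Q e s)) + Q (ins e' (lie Q e
  s)) by [].
rewrite {1}/lie !ins_q_bracket /derived_br !lie_Q (derD dQ) (derN dQ).
by apply: form_ext => x l; rewrite !formE; ring.
Qed.

Lemma q_bracket_anti e e' : q_bracket e e' = - q_bracket e' e.
Proof.
have := q_bracket_alt (e + e').
have := q_bracket_Dl 1 e e' (e + e'); rewrite !scale1r => ->.
have := q_bracket_Dr 1 e e' e; rewrite !scale1r => ->.
have := q_bracket_Dr 1 e e' e'; rewrite !scale1r => ->.
by rewrite !q_bracket_alt addr0 add0r => /eqP; rewrite addr_eq0 => /eqP.
Qed.

(** The Jacobi identity for the commutators of the operators [lie Q s], [lie Q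
    t] and [ins u]. *)
Fact q_bracket_jacobi (s t u : section E) : q_bracket s (q_bracket t u) +
  q_bracket t (q_bracket u s) + q_bracket u (q_bracket s t) = 0.
Proof.
apply: sec_eq_ins => w; rewrite !insDl ins_0.
rewrite [q_bracket u (q_bracket s t)]q_bracket_anti [q_bracket u
  s]q_bracket_anti.
have -> : q_bracket t (- q_bracket s u) = - q_bracket t (q_bracket s u).
  have := q_bracket_Dr (-1) (q_bracket s u) 0 t; rewrite !addr0 !scaleN1r => ->.
  have := q_bracket_Dr (-1) 0 0 t; rewrite !addr0 scaler0 scaleN1r => h.
  have -> : q_bracket t 0 = 0.
    apply: sec_eq_ins => z;
      by rewrite ins_q_bracket derived_brE !(ins_0, ins0, der0 dQ, addr0,
        subr0).
  by rewrite addr0.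
rewrite !insNl !ins_q_bracket /derived_br !ins_q_bracket /derived_br
  !lie_q_bracket.
rewrite !(insD, insN, derD (isder_lie dQ s), derN (isder_lie dQ s), derD
  (isder_lie dQ t), derN (isder_lie dQ t)).
by apply: form_ext => x l; rewrite !formE; ring.
Qed.

Definition algebroid_of : lie_algebroid E :=
  LieAlgebroid q_bracket_Dl q_bracket_Dr q_bracket_alt q_bracket_jacobi
    q_bracket_leibniz.

Lemma algebroid_ofP : is_differential algebroid_of Q.
Proof.
split=> [|k s hs e he]; first exact: isder_vf dQ _ hQ.
exact: (Q_formula dQ hQ q_anchorE ins_q_bracket hs he).
Qed.

End FromQ.

Section ToQ.
Variable A : lie_algebroid E.
Local Notation rho := (bm_act (la_anchor A)).
Local Notation br := (la_br A).

Lemma bm_actD (B : bundle_map_TM E) e e' f : bm_act B (e + e') f = bm_act B e f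
  + bm_act B e' f.
Proof.
apply: cinf_ext => x /=; have := bm_linear B 1 (e x) (e' x).
by rewrite !scale1r => ->.
Qed.
Lemma bm_actM (B : bundle_map_TM E) g e f : bm_act B (sec_mul g e) f = g *
  bm_act B e f.
Proof.
apply: cinf_ext => x /=; have := bm_linear B (g x) (e x) 0.
have b0 : B x 0 = 0.
  by have := bm_linear B (-1) 0 (0 : E x); rewrite scaler0 addr0 scaleN1r addNr.
by rewrite addr0 b0 addr0 => ->.
Qed.
Lemma bm_act_lin (B : bundle_map_TM E) e a f g :
  bm_act B e (a *: f + g) = a *: bm_act B e f + bm_act B e g.
Proof. by apply: cinf_ext => x; exact: tan_linear. Qed.
Lemma bm_act_mul (B : bundle_map_TM E) e f g :
  bm_act B e (f * g) = f * bm_act B e g + bm_act B e f * g.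
Proof. by apply: cinf_ext => x; exact: tan_leibniz. Qed.
Lemma bm_act_D (B : bundle_map_TM E) e f g :
  bm_act B e (f + g) = bm_act B e f + bm_act B e g.
Proof. by have := bm_act_lin B e 1 f g; rewrite !scale1r. Qed.
Lemma bm_act0 (B : bundle_map_TM E) e : bm_act B e 0 = 0.
Proof. by have := bm_act_lin B e (-1) 0 0;
  rewrite scaler0 addr0 scaleN1r addNr. Qed.
Lemma la_anti e e' : br e e' = - br e' e.
Proof.
have := la_alt A (e + e').
have := la_brDl A 1 e e' (e + e'); rewrite !scale1r => ->.
have := la_brDr A 1 e e' e; rewrite !scale1r => ->.
have := la_brDr A 1 e e' e'; rewrite !scale1r => ->.
by rewrite !la_alt addr0 add0r => /eqP; rewrite addr_eq0 => /eqP.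
Qed.
Lemma la_D e e' (u : section E) : br u (e + e') = br u e + br u e'.
Proof. by have := la_brDr A 1 e e' u; rewrite !scale1r. Qed.
Lemma la_0 (u : section E) : br u 0 = 0.
Proof. by have := la_brDr A (-1) 0 0 u;
  rewrite scaler0 addr0 scaleN1r addNr. Qed.
Lemma la_N e (u : section E) : br u (- e) = - br u e.
Proof. by have := la_brDr A (-1) e 0 u; rewrite la_0 !addr0 !scaleN1r. Qed.
Lemma la_jac e e' (u : section E) : br e (br e' u) - br e' (br e u) - br (br e
  e') u = 0.
Proof.
rewrite -[RHS](la_jacobi A e e' u) [br (br e e') u]la_anti opprK.
by rewrite [br u e]la_anti la_N.
Qed.

(** Replacing [u] by [f u] in the Jacobi identity for [e], [e'] and [u] leaves
    the difference of both sides times [u]. *)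
Lemma anchor_bracket e e' f : rho (br e e') f = rho e (rho e' f) - rho e' (rho
  e f).
Proof.
have key (u : section E) : sec_mul (rho e (rho e' f) - rho e' (rho e f) - rho
  (br e e') f) u = 0.
  have := la_jac e e' (sec_mul f u); rewrite !(la_leibniz, la_D).
  have := la_jac e e' u => j1 j2.
  apply: sec_eq_ins => s; apply: form_ext => x l.
  have := congr1 (fun z => ins z s x l) j1;
    have := congr1 (fun z => ins z s x l) j2.
  rewrite !(insDl, insNl, insMl, ins_0, formE, fwedgeE, cinfE) => h2 h1.
  match type of h1 with ?a = _ => match type of h2 with ?c = _ =>
    transitivity (c - f x * a); last by rewrite h1 h2 mulr0 subrr end end.
  ring.
(* [key] gives the claim where [u] can be chosen nonzero; in a zero fibre both
   sides vanish *)
apply: cinf_ext => x; case: (pselect (exists v : E x, v <> 0)) => [[v v0]|none].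
  have [u hu] := extend_vec v.
  have := congr1 (fun s : section E => s x) (key u); rewrite !(secE, cinfE) hu.
  move/eqP; rewrite scaler_eq0 => /orP[|/eqP//].
  by rewrite subr_eq0 => /eqP <-.
have z (w : section E) : w x = 0 by apply: contrapT => h; apply: none;
  exists (w x).
have b0 (w : section E) g : rho w g x = 0.
  rewrite /= z; have b0 : la_anchor A x 0 = 0.
    by have := bm_linear (la_anchor A) (-1) 0 (0 : E x);
      rewrite scaler0 addr0 scaleN1r addNr.
  by rewrite b0.
by rewrite cinfE cinfNE !b0 subrr.
Qed.

Let d0 f : exists xi, forall e, pair xi e = rho e f.
Proof. by apply: form1_exists => g e e'; rewrite bm_actD bm_actM. Qed.
Definition d_fun f : form E := fd (sval (cid (d0 f))).
Lemma ins_d_fun e f : ins e (d_fun f) = fc (rho e f).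
Proof. by rewrite /d_fun ins_fd; case: cid => xi /= ->. Qed.
Lemma homog_d_fun f : homog 1 (d_fun f). Proof. exact: homog_fd. Qed.

Let phi xi e e' := rho e (pair xi e') - rho e' (pair xi e) - pair xi (br e e').
Let pairD xi e e' : pair xi (e + e') = pair xi e + pair xi e'.
Proof. by apply: (@fc_inj _ _ _ _ E); rewrite fcD -!ins_fd insDl. Qed.
Let pairM xi f e : pair xi (sec_mul f e) = f * pair xi e.
Proof. by apply: (@fc_inj _ _ _ _ E); rewrite fcM -!ins_fd insMl. Qed.
Let pairN xi e : pair xi (- e) = - pair xi e.
Proof. by apply: (@fc_inj _ _ _ _ E); rewrite fcN -!ins_fd insNl. Qed.
Let d1 xi : exists w : form E,
  homog 2 w /\ forall e e', form_app w [:: e; e'] = phi xi e e'.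
Proof.
have [|e0 f e e'|w hw hw'] := @form2_exists _ _ _ _ E (phi xi).
- move=> e e'; rewrite /phi [br e e']la_anti pairN.
  by apply: cinf_ext => x; rewrite !cinfE; ring.
- rewrite /phi la_D la_leibniz !pairD !pairM bm_act_D bm_act_mul bm_actD
  bm_actM.
  by apply: cinf_ext => x; rewrite !cinfE; ring.
by exists w.
Qed.
(** The differential of a 1-form, given on pairs of sections by the function
    [phi] above. *)
Definition d_dual xi : form E := sval (cid (d1 xi)).
Lemma homog_d_dual xi : homog 2 (d_dual xi).
Proof. by rewrite /d_dual; case: cid => w [/= ]. Qed.
Lemma ins_d_dual e e' xi : ins e' (ins e (d_dual xi)) = fc (phi xi e e').
Proof.
have h : form_app (d_dual xi) [:: e; e'] = phi xi e e' by rewrite /d_dual;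
  case: cid => w [/= _].
rewrite -h !form_app_cons fc_app //.
by have := homog_ins (e := e') (homog_ins (e := e) (@homog_d_dual xi)).
Qed.

Lemma eq_ins1 s t : homog 1 s -> homog 1 t -> (forall e, ins e s = ins e t) ->
  s = t.
Proof.
move=> hs ht h; apply: (homog_eq hs ht) => -[|e l] // _.
by rewrite !form_app_cons h.
Qed.
Lemma eq_ins2 s t : homog 2 s -> homog 2 t ->
  (forall e e', ins e' (ins e s) = ins e' (ins e t)) -> s = t.
Proof.
move=> hs ht h; apply: (homog_eq hs ht) => -[|e [|e' l]] // _.
by rewrite !form_app_cons h.
Qed.

Lemma d_data : der_data true d_fun d_dual.
Proof.
split.
- move=> a f g; apply: eq_ins1 => [||e]; first exact: homog_d_fun.
    by apply: homogD; [apply: homogZ|]; exact: homog_d_fun.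
  by rewrite insD insZ !ins_d_fun bm_act_lin fcD fcZ.
- move=> f g; apply: eq_ins1 => [||e]; first exact: homog_d_fun.
    apply: homogD; first exact: (homog_wedge (@homog_d_fun f) (@homog_fc _ _ _
      _ E g)).
    exact: (homog_wedge (@homog_fc _ _ _ _ E f) (@homog_d_fun g)).
  rewrite insD !ins_wedge !ins_d_fun !ins_fc wedge0r wedge0l addr0 add0r gr_fc.
  by rewrite bm_act_mul fcD !fcM addrC.
- by move=> f; rewrite (gr_homogz _ (@homog_d_fun f)).
- move=> a xi xi'; apply: eq_ins2 => [||e e']; first exact: homog_d_dual.
    by apply: homogD; [apply: homogZ|]; exact: homog_d_dual.
  rewrite !(insD, insZ) !ins_d_dual -fcZ -fcD; congr fc.
  rewrite /phi !pair_lin !bm_act_lin.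
  by apply: cinf_ext => x; rewrite !cinfE; ring.
- move=> f xi; apply: eq_ins2 => [||e e']; first exact: homog_d_dual.
    apply: homogD; first exact: (homog_wedge (@homog_d_fun f) (@homog_fd _ _ _
      _ E xi)).
    exact: (homog_wedge (@homog_fc _ _ _ _ E f) (@homog_d_dual xi)).
  have g0 : gr true (d_fun f) = - d_fun f by rewrite (gr_homogz _ (@homog_d_fun
    f)) /= scaleN1r.
  rewrite !(wedge0l, insD, ins_wedge, ins0, gr0, g0, insN, ins_d_fun, ins_fd,
    ins_fc, gr_fc, wedge0l, wedge0r, add0r, addr0).
  rewrite !ins_d_dual wedgeNl -!fcM -fcN -!fcD; congr fc.
  rewrite /phi !pair_mul !bm_act_mul.
  by apply: cinf_ext => x; rewrite !cinfE; ring.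
- by move=> xi; rewrite (gr_homogz _ (@homog_d_dual xi)).
Qed.

(** [Q] extends its values [d_fun] and [d_dual]; its derived bracket is the
    bracket of [A], by comparison on generators. The operators [K e e' = [L_e,
    L_e'] - L_[e, e']], [P e = [L_e, Q]] and [Q ^ 2] are derivations.
    Contractions commute with [K e e'] by the Jacobi identity of [A], with [P
    e] (up to sign) as [K] is zero, and with [Q ^ 2] as [P] is zero. So each
    vanishes on 1-forms once it does on functions. *)
Theorem differential_exists : exists Q, [/\ is_differential A Q, isder true Q,
  forall i s, homog i s -> homog (i + 1) (Q s) & forall s, Q (Q s) = 0].
Proof.
have [Q [dQ Qfc Qfd /(_ 1 (@homog_d_fun) (@homog_d_dual)) hQ]] := der_exists
  d_data.
exists Q.
have rhoQ e f : anchor_act Q e f = rho e f.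
  by apply: (@fc_inj _ _ _ _ E); rewrite -(ins_Q_fc hQ) Qfc ins_d_fun.
have lfc e f : lie Q e (fc f) = fc (rho e f).
  by rewrite (lie_fc dQ) (ins_Q_fc hQ) rhoQ.
have dl := isder_lie dQ.
have brQ e e' s : ins (br e e') s = derived_br Q e e' s.
  apply: der_eq (isder_ins (br e e')) (isder_derived_br dQ e e') _ _ s =>
    [f|xi].
    by rewrite ins_fc (derived_br_fc dQ hQ).
  rewrite ins_fd /derived_br ins_fd lfc {1}/lie ins_fd Qfd insD ins_d_dual
    (ins_Q_fc hQ) rhoQ.
  rewrite /phi -fcD -fcN -fcD; congr fc.
  by apply: cinf_ext => x; rewrite !cinfE; ring.
(* an opaque name keeps [L e s] from being unfolded into a sum *)
have [L LQ] : exists L, L = lie Q by exists (lie Q).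
have LE e s : L e s = ins e (Q s) + Q (ins e s) by rewrite LQ.
have dL e : isder false (L e) by rewrite LQ.
have hL e i s : homog i s -> homog i (L e s) by rewrite LQ; exact: homog_lie.
have Lfc e f : L e (fc f) = fc (rho e f) by rewrite LQ.
have commL e e' s : L e (ins e' s) = ins e' (L e s) + ins (br e e') s.
  by rewrite LQ brQ /derived_br addrCA subrr addr0.
pose K e e' s := L e (L e' s) - L e' (L e s) - L (br e e') s.
have dK e e' : isder false (K e e').
  have h1 := isder_comm (dL e) (dL e').
  have h2 := isder_lin (-1) (dL (br e e')) h1.
  split=> [a s t|s t|s].
  - by have := der_lin h2 a s t; rewrite !scale1r !scaleN1r /K => h;
    rewrite addrC h [- _ + _]addrC [X in _ = _ + X]addrC.
  - by have := der_wedge h2 s t; rewrite !scale1r !scaleN1r /K => h;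
    rewrite addrC h [- _ + _]addrC [X in _ = _ + (_ ^^ X)]addrC.
  - by have := der_gr h2 s; rewrite !scale1r !scaleN1r /K => h;
    rewrite addrC h [- _ + _]addrC.
(* the anchor preserves brackets *)
have K0f e e' f : K e e' (fc f) = 0.
  rewrite /K !Lfc anchor_bracket !(fcD, fcN).
  by apply: form_ext => x l; rewrite !formE; ring.
have KI e e' (u : section E) s : ins u (K e e' s) = K e e' (ins u s).
  have jacobiator : ins (br e (br e' u)) s - ins (br e' (br e u)) s - ins (br
    (br e e') u) s = 0.
    by rewrite -!insNl -!insDl la_jac ins_0.
    have LL e1 e2 : L e1 (L e2 (ins u s)) = ins u (L e1 (L e2 s)) + ins (br e1
      u) (L e2 s) +
      (ins (br e2 u) (L e1 s) + ins (br e1 (br e2 u)) s).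
    by rewrite (commL e2 u s) (derD (dL e1)) (commL e1 u (L e2 s)) (commL e1
      (br e2 u) s).
  rewrite /K !LL (commL (br e e') u s) !(insD, insN).
  apply: form_ext => x l; have := congr1 (fun s : form E => s x l) jacobiator.
  rewrite !formE => h.
  match type of h with ?a = _ => rewrite -[LHS]addr0 -h end; ring.
have K0 e e' s : K e e' s = 0.
  apply: der_eq (dK e e') (isder0 _ _) (K0f e e') _ s => xi.
  apply: eq_ins1 => // [|u]; last by rewrite KI ins_fd K0f ins0.
  have h : homog 1 (fd xi) := @homog_fd _ _ _ _ E xi.
  by apply: homogD; [apply: homogD|apply: homogN]; try apply: homogN;
    do !apply: (@hL _ _ _).
pose P e s := L e (Q s) - Q (L e s).
have dP e : isder true (P e).
  have h := isder_comm (dL e) dQ.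
  split=> [a s t|s t|s].
  - by have := der_lin h a s t; rewrite !scale1r.
  - by have := der_wedge h s t; rewrite !scale1r.
  - by have := der_gr h s; rewrite !scale1r.
have PI e (u : section E) s : ins u (P e s) = - P e (ins u s).
  have insQ w : ins u (Q w) = L u w - Q (ins u w) by rewrite LE addrK.
  have c1 : ins u (L e (Q s)) = L e (ins u (Q s)) - ins (br e u) (Q s) by
    rewrite commL addrK.
  have c2 : ins u (L e s) = L e (ins u s) - ins (br e u) s by rewrite commL
    addrK.
  have k : L e (L u s) - L u (L e s) -
    (ins (br e u) (Q s) + Q (ins (br e u) s)) = 0 by rewrite -LE; exact: K0.
  rewrite /P insD insN c1 !insQ c2 !(derD (dL e), derN (dL e), derD dQ, derN
    dQ).
  apply: form_ext => x l; have := congr1 (fun s : form E => s x l) k.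
  rewrite !formE => h.
  match type of h with ?a = _ => rewrite -[RHS]addr0 -h end; ring.
have P0f e f : P e (fc f) = 0.
  have hf := @homog_fc _ _ _ _ E f.
  apply: eq_ins1 => // [|u]; last by rewrite PI ins_fc (der0 (dP e)) oppr0 ins0.
  exact: (homogD (hL e _ _ (hQ _ _ hf)) (homogN (hQ _ _ (hL e _ _ hf)))).
have P0 e s : P e s = 0.
  apply: der_eq (dP e) (isder0 _ _) (P0f e) _ s => xi.
  have hf := @homog_fd _ _ _ _ E xi.
  apply: eq_ins2 => // [|u v]; last by rewrite PI ins_fd P0f oppr0 !ins0.
  exact: (homogD (hL e _ _ (hQ _ _ hf)) (homogN (hQ _ _ (hL e _ _ hf)))).
have lQ e s : L e (Q s) = Q (L e s) by apply/eqP;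
  rewrite -subr_eq0 -[X in X == 0]/(P e s) P0.
have QQI e s : ins e (Q (Q s)) = Q (Q (ins e s)).
  have -> : ins e (Q (Q s)) = L e (Q s) - Q (ins e (Q s)) by rewrite LE addrK.
  by rewrite lQ LE (derD dQ) addrC addKr.
have dQQ : isder false (fun s => Q (Q s)).
  split=> [a s t|s t|s].
  - by rewrite !(der_lin dQ).
  - rewrite (der_wedge dQ) (derD dQ) !(der_wedge dQ) gr_gr (der_gr dQ) /=
    wedgeZl.
    by apply: form_ext => x l; rewrite !formE; ring.
  - by rewrite (der_gr dQ) (derZ dQ) (der_gr dQ) scalerA mulrNN mulr1.
have QQf f : Q (Q (fc f)) = 0.
  apply: eq_ins2 => // [|e e'];
    first exact: (hQ _ _ (hQ _ _ (@homog_fc _ _ _ _ E f))).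
  by rewrite QQI ins_fc !(der0 dQ) !ins0.
have QQ s : Q (Q s) = 0.
  apply: der_eq dQQ (isder0 _ _) (fun f => QQf f) _ s => xi.
  apply: form_eq_ins; last by move=> e; rewrite QQI ins_fd QQf ins0.
  by rewrite (app_homog (hQ _ _ (hQ _ _ (@homog_fd _ _ _ _ E xi)))) //
    form_app0.
split=> //; split=> [|k s hs e he]; first exact: isder_vf dQ _ hQ.
exact: (Q_formula dQ hQ rhoQ brQ hs he).
Qed.

End ToQ.
End Algebroid.

(** * The bracket of a Lie algebroid on the dual bundle *)

Section Gerstenhaber.
Variables (R : realType) (n : nat) (M : manifold R n).
Variables (r : nat) (E : vbundle M r).
Implicit Types (s t u : form E) (e : section E) (f g : cinf M).
Implicit Types (xi eta : section (dual E)) (b c : bool).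
Local Notation fc := (form_of_cinf E).
Local Notation fd := (@form_of_dual R n M r E).
Local Notation "s ^^ t" := (wedge s t) (at level 40, left associativity).
Local Notation sgn := (sgn R).
Local Arguments gr : simpl never.

Definition parity b s := gr true s = sgn b *: s.

Lemma parity_fc f : parity false (fc f).
Proof. by rewrite /parity gr_fc scale1r. Qed.
Lemma parity_fd xi : parity true (fd xi).
Proof. exact: gr_fd. Qed.
Lemma parity_gr b s c : parity b s -> gr c s = sgn (c && b) *: s.
Proof. by case: c => //= _; rewrite scale1r. Qed.
Lemma parity_der b D s c : isder b D -> parity c s -> parity (b (+) c) (D s).
Proof.
move=> dD hs; rewrite /parity.
have -> : gr true (D s) = sgn b *: D (gr true s).
  by rewrite (der_gr dD) scalerA sgn_sgn scale1r.
by rewrite hs (derZ dD) scalerA sgnM.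
Qed.
Lemma parityD b s t a : parity b s -> parity b t -> parity b (a *: s + t).
Proof. by rewrite /parity grD grZ => -> ->;
  rewrite scalerDr !scalerA mulrC. Qed.
Lemma parity_homog (k : nat) s : homog k s -> parity (odd k) s.
Proof. exact: gr_homog. Qed.
Lemma parity_homogz (k : int) s : homog k s -> parity (zodd k) s.
Proof. by move=> h; rewrite /parity (gr_homogz _ h). Qed.
Lemma parity0 b : parity b (0 : form E).
Proof. by rewrite /parity gr0 scaler0. Qed.

Lemma wedge_comm b c s t : parity b s -> parity c t -> s ^^ t = sgn (b && c) *:
  (t ^^ s).
Proof. by move=> hs ht; rewrite (wedgeC t hs) (parity_gr _ ht) wedgeZl. Qed.

Lemma isder_wedge b c D t : parity c t -> isder b D ->
  isder (c (+) b) (fun s => t ^^ D s).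
Proof.
move=> ht dD; split=> [a s u|s u|s].
- by rewrite (der_lin dD) wedgeDr wedgeZr.
- rewrite (der_wedge dD) wedgeDr !wedgeA; congr (_ + _ ^^ _).
  have := ht; rewrite /parity => ht'.
  by rewrite (wedgeC (gr b s) ht') gr_gr.
- rewrite (der_gr dD) wedgeZr gr_wedge ht wedgeZl scalerA; congr (_ *: _).
  by rewrite -sgnM mulrC mulrA sgn_sgn mul1r.
Qed.

Section Bracket.
Variable B : lie_algebroid (dual E).
Local Notation rho := (bm_act (la_anchor B)).
Local Notation br := (la_br B).

Lemma rhoZ a xi f : rho (a *: xi) f = a *: rho xi f.
Proof. exact: (bm_actM (la_anchor B) (cinf_cst M a) xi f). Qed.

Lemma br_fun_data f : der_data true (fun _ => 0 : form E) (fun eta => - fc (rho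
  eta f)).
Proof.
split.
- by move=> a g h; rewrite scaler0 addr0.
- by move=> g h; rewrite wedge0l wedge0r addr0.
- by move=> g; rewrite gr0 scaler0.
- by move=> a xi xi'; rewrite bm_actD rhoZ fcD fcZ opprD scalerN.
- by move=> g xi; rewrite bm_actM fcM wedge0l add0r wedgeNr.
- by move=> xi; rewrite grN gr_fc scale1r.
Qed.

Lemma br_fun_exists f : exists D : form E -> form E, [/\ isder true D, forall
  g, D (fc g) = 0,
  forall eta, D (fd eta) = - fc (rho eta f) &
  forall (i : int) s, homog i s -> homog (i - 1) (D s)].
Proof.
have [D [dD Dfc Dfd hD]] := der_exists (br_fun_data f); exists D;
  split=> // i s.
apply: hD => [f'|eta]; first exact: homog0.
by apply: homogN; exact: homog_fc.
Qed.
(** The derivation [{f, .}]. *)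
Definition br_fun f := sval (cid (br_fun_exists f)).
Lemma br_funP f : [/\ isder true (br_fun f), forall g, br_fun f (fc g) = 0,
  forall eta, br_fun f (fd eta) = - fc (rho eta f) &
  forall (i : int) s, homog i s -> homog (i - 1) (br_fun f s)].
Proof. by rewrite /br_fun; case: cid. Qed.
Lemma isder_br_fun f : isder true (br_fun f). Proof. by case: (br_funP f). Qed.
Lemma br_fun_fc f g : br_fun f (fc g) = 0. Proof. by case: (br_funP f). Qed.
Lemma br_fun_fd f eta : br_fun f (fd eta) = - fc (rho eta f). Proof. by case:
  (br_funP f). Qed.
Lemma br_fun_homog f (i : int) s : homog i s -> homog (i - 1) (br_fun f s).
Proof. by case: (br_funP f) => _ _ _; apply. Qed.

Lemma br_dual_data xi : der_data false (fun g => fc (rho xi g)) (fun eta => fd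
  (br xi eta)).
Proof.
split.
- by move=> a g h; rewrite bm_act_lin fcD fcZ.
- by move=> g h; rewrite bm_act_mul fcD !fcM addrC.
- by move=> g; rewrite gr_fc scale1r.
- by move=> a eta eta'; rewrite la_brDr fdD fdZ.
- by move=> g eta; rewrite la_leibniz fdD !fdM addrC.
- by move=> eta; rewrite gr_fd.
Qed.

Lemma br_dual_exists xi : exists D : form E -> form E, [/\ isder false D,
  forall g, D (fc g) = fc (rho xi g),
  forall eta, D (fd eta) = fd (br xi eta) &
  forall (i : int) s, homog i s -> homog i (D s)].
Proof.
have [D [dD Dfc Dfd hD]] := der_exists (br_dual_data xi); exists D;
  split=> // i s hs.
rewrite -[i]addr0; apply: hD => // [f|eta]; first exact: homog_fc.
exact: homog_fd.
Qed.
(** The derivation [{xi, .}]. *)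
Definition br_dual xi := sval (cid (br_dual_exists xi)).
Lemma br_dualP xi : [/\ isder false (br_dual xi), forall g, br_dual xi (fc g) =
  fc (rho xi g),
  forall eta, br_dual xi (fd eta) = fd (br xi eta) &
  forall (i : int) s, homog i s -> homog i (br_dual xi s)].
Proof. by rewrite /br_dual; case: cid. Qed.
Lemma isder_br_dual xi : isder false (br_dual xi). Proof. by case: (br_dualP
  xi). Qed.
Lemma br_dual_fc xi g : br_dual xi (fc g) = fc (rho xi g). Proof. by case:
  (br_dualP xi). Qed.
Lemma br_dual_fd xi eta : br_dual xi (fd eta) = fd (br xi eta). Proof. by case:
  (br_dualP xi). Qed.
Lemma br_dual_homog xi (i : int) s : homog i s -> homog i (br_dual xi s).
Proof. by case: (br_dualP xi) => _ _ _; apply. Qed.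

Lemma br_fun_lin a f g s : br_fun (a *: f + g) s = a *: br_fun f s + br_fun g s.
Proof.
apply: der_eq (isder_br_fun _) (isder_lin a (isder_br_fun f) (isder_br_fun g))
  _ _ s => [h|eta].
  by rewrite !br_fun_fc scaler0 addr0.
by rewrite !br_fun_fd bm_act_lin fcD fcZ opprD scalerN.
Qed.
Lemma br_fun_mul f g s : br_fun (f * g) s = fc g ^^ br_fun f s + fc f ^^ br_fun
  g s.
Proof.
have d1 := isder_wedge (parity_fc g) (isder_br_fun f);
  have d2 := isder_wedge (parity_fc f) (isder_br_fun g).
have h := isder_lin 1 d1 d2.
rewrite -[X in _ = X + _]scale1r.
apply: der_eq (isder_br_fun _) h _ _ s => [k|eta]; rewrite scale1r.
  by rewrite !br_fun_fc !wedge0r addr0.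
rewrite !br_fun_fd bm_act_mul fcD !fcM !wedgeNr opprD addrC; congr (_ + _).
by rewrite -!fcM mulrC.
Qed.
Lemma br_dual_lin a xi eta s : br_dual (a *: xi + eta) s = a *: br_dual xi s +
  br_dual eta s.
Proof.
apply: der_eq (isder_br_dual _) (isder_lin a (isder_br_dual xi) (isder_br_dual
  eta)) _ _ s => [h|z].
  by rewrite !br_dual_fc bm_actD rhoZ fcD fcZ.
by rewrite !br_dual_fd la_brDl fdD fdZ.
Qed.
Lemma br_dual_mul f xi s : br_dual (sec_mul f xi) s = fc f ^^ br_dual xi s + fd
  xi ^^ br_fun f s.
Proof.
have d1 := isder_wedge (parity_fc f) (isder_br_dual xi);
  have d2 := isder_wedge (parity_fd xi) (isder_br_fun f).
have h := isder_lin 1 d1 d2.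
rewrite -[X in _ = X + _]scale1r.
apply: der_eq (isder_br_dual _) h _ _ s => [k|eta]; rewrite scale1r.
  by rewrite !br_dual_fc br_fun_fc wedge0r addr0 bm_actM fcM.
rewrite !br_dual_fd br_fun_fd wedgeNr fwedgeC -!fdM -fdN -fdD; congr fd.
rewrite la_anti la_leibniz [br eta xi]la_anti.
by apply: sec_ext => x; rewrite !secE scalerN opprD opprK.
Qed.

(** The condition on products [f xi] is the Leibniz rule of the bracket in its
    first slot, for the first argument [f xi]; see [br_dual_mul]. *)
Lemma parity_bracket_data b s : parity b s ->
  der_data (~~ b) (fun g => sgn b *: br_fun g s) (fun eta => - br_dual eta s).
Proof.
move=> hs; split.
- by move=> a f g; rewrite br_fun_lin scalerDr !scalerA mulrC.
- by move=> f g; rewrite br_fun_mul scalerDr !wedgeE fwedgeC.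
- move=> f; rewrite grZ (parity_der (isder_br_fun f) hs) scalerA mulrC -scalerA.
  by congr (_ *: _).
- by move=> a xi eta; rewrite br_dual_lin opprD scalerN.
- move=> f xi; rewrite br_dual_mul opprD wedgeNr addrC; congr (_ + _).
  rewrite wedgeZl (wedge_comm (parity_fd xi) (parity_der (isder_br_fun f) hs)).
  by rewrite -scaleNr; case: b {hs}; rewrite /= ?opprK.
- move=> xi; rewrite grN (parity_der (isder_br_dual xi) hs) negbK scalerN.
  by [].
Qed.

(** The derivation [{s, .}] for [s] of parity [b]: its values on generators
    are forced by antisymmetry. *)
Definition parity_bracket b s := der_ext (~~ b) (fun g => sgn b *: br_fun g s)
  (fun eta => - br_dual eta s).

Lemma isder_parity_bracket b s : parity b s -> isder (~~ b) (parity_bracket b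
  s).
Proof. by move=> hs; exact: isder_der_ext (parity_bracket_data hs). Qed.
Lemma parity_bracket_fc b s f : parity b s -> parity_bracket b s (fc f) = sgn b
  *: br_fun f s.
Proof. by move=> hs; exact: (der_ext_fc f (parity_bracket_data hs)). Qed.
Lemma parity_bracket_fd b s xi : parity b s -> parity_bracket b s (fd xi) = -
  br_dual xi s.
Proof. by move=> hs; exact: (der_ext_fd xi (parity_bracket_data hs)). Qed.
Lemma parity_bracket_lin b a s t u : parity b s -> parity b t ->
  parity_bracket b (a *: s + t) u = a *: parity_bracket b s u + parity_bracket
    b t u.
Proof.
move=> hs ht; have hst := parityD a hs ht.
apply: der_eq (isder_parity_bracket hst) (isder_lin a (isder_parity_bracket hs)
  (isder_parity_bracket ht)) _ _ u => [f|xi].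
  rewrite !parity_bracket_fc // (der_lin (isder_br_fun f)) scalerDr !scalerA
    mulrC //.
by rewrite !parity_bracket_fd // (der_lin (isder_br_dual xi)) opprD scalerN.
Qed.

Definition parity_part b s := 2^-1 *: (s + sgn b *: gr true s).
Lemma parity_partP b s : parity b (parity_part b s).
Proof.
rewrite /parity /parity_part grZ grD grZ gr_gr scalerA mulrC -scalerA;
  congr (_ *: _).
by rewrite scalerDr scalerA sgn_sgn scale1r addrC.
Qed.
Lemma parity_part_lin b a s t : parity_part b (a *: s + t) = a *: parity_part b
  s + parity_part b t.
Proof.
rewrite /parity_part grD grZ; apply: form_ext => x l; rewrite !formE; ring.
Qed.
Lemma parity_part_id b c s : parity c s -> parity_part b s = if b == c then s
  else 0.
Proof.
move=> hs; rewrite /parity_part hs scalerA sgnM.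
have e : b (+) c = (b != c) by case: b; case: c {hs}.
rewrite e; case: eqP => _ /=; apply: form_ext => x l; rewrite !formE; last ring.
by field.
Qed.

(** The sign in [parity_bracket] depends on the parity of the first argument,
    which is split accordingly. *)
Definition bracket s t := parity_bracket false (parity_part false s) t +
  parity_bracket true (parity_part true s) t.

Lemma parity_bracket0 b t : parity_bracket b 0 t = 0.
Proof.
have := parity_bracket_lin (-1) t (parity0 b) (parity0 b).
by rewrite scaler0 addr0 scaleN1r addNr.
Qed.

Lemma bracket_parity b s t : parity b s -> bracket s t = parity_bracket b s t.
Proof.
move=> hs; rewrite /bracket !(parity_part_id _ hs).
by case: b {hs}; rewrite /= parity_bracket0 ?addr0 ?add0r.
Qed.

Lemma bracket_linl a s t u : bracket (a *: s + t) u = a *: bracket s u +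
  bracket t u.
Proof.
rewrite /bracket !parity_part_lin !parity_bracket_lin; try exact: parity_partP.
by rewrite scalerDr addrACA.
Qed.
Lemma bracket_linr a s t u : bracket u (a *: s + t) = a *: bracket u s +
  bracket u t.
Proof.
rewrite /bracket !(der_lin (isder_parity_bracket (parity_partP _ _))).
by rewrite scalerDr addrACA.
Qed.

Lemma isder_bracket b s : parity b s -> isder (~~ b) (bracket s).
Proof.
move=> hs; have e : bracket s = parity_bracket b s by apply/funext => t;
  exact: bracket_parity.
by rewrite e; exact: isder_parity_bracket.
Qed.
Lemma bracket_fc b s f : parity b s -> bracket s (fc f) = sgn b *: br_fun f s.
Proof. by move=> hs; rewrite (bracket_parity _ hs) parity_bracket_fc. Qed.
Lemma bracket_fd b s xi : parity b s -> bracket s (fd xi) = - br_dual xi s.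
Proof. by move=> hs; rewrite (bracket_parity _ hs) parity_bracket_fd. Qed.
Lemma bracket_fcl f t : bracket (fc f) t = br_fun f t.
Proof.
have p := parity_fc f.
apply: der_eq (isder_bracket p) (isder_br_fun f) _ _ t => [g|xi].
  by rewrite (bracket_fc g p) !br_fun_fc scaler0.
by rewrite (bracket_fd xi p) br_dual_fc br_fun_fd.
Qed.
Lemma bracket_fdl xi t : bracket (fd xi) t = br_dual xi t.
Proof.
have p := parity_fd xi.
apply: der_eq (isder_bracket p) (isder_br_dual xi) _ _ t => [g|eta].
  by rewrite (bracket_fc g p) br_fun_fd br_dual_fc scaleN1r opprK.
by rewrite (bracket_fd eta p) !br_dual_fd la_anti fdN opprK.
Qed.

Lemma bracket_homog (i j : int) s t : homog i s -> homog j t ->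
  homog (i + j - 1) (bracket s t).
Proof.
move=> hs ht; have p := parity_homogz hs; rewrite (bracket_parity _ p).
have -> : i + j - 1 = j + (i - 1) by ring.
apply: (der_ext_homog (parity_bracket_data p)) => // [f|xi].
  by apply: homogZ; exact: br_fun_homog.
by rewrite subrK; apply: homogN; exact: br_dual_homog.
Qed.

(** For this rule and [bracket_dwedge], both sides are derivations in [s], so
    they are compared on generators. *)
Lemma bracket_fwedge b f t s : parity b t ->
  bracket (fc f ^^ t) s = fc f ^^ bracket t s + t ^^ br_fun f s.
Proof.
move=> ht; have p : parity b (fc f ^^ t).
  by rewrite /parity gr_wedge gr_fc ht wedgeZr.
have d1 := isder_wedge (parity_fc f) (isder_bracket ht);
  have d2 := isder_wedge ht (isder_br_fun f).
rewrite addbT in d2; have h := isder_lin 1 d1 d2.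
rewrite -[X in _ = X + _]scale1r.
apply: der_eq (isder_bracket p) h _ _ s => [g|eta]; rewrite scale1r.
  rewrite (bracket_fc g p) (bracket_fc g ht) (der_fwedge (isder_br_fun g))
    !br_fun_fc.
  by rewrite wedge0l add0r wedge0r addr0 wedgeZr.
rewrite (bracket_fd eta p) (bracket_fd eta ht) (der_fwedge (isder_br_dual eta))
  br_dual_fc br_fun_fd.
by rewrite !wedgeNr opprD addrC fwedgeC.
Qed.

Lemma bracket_dwedge b xi t s : parity b t ->
  bracket (fd xi ^^ t) s = fd xi ^^ bracket t s + sgn b *: (t ^^ br_dual xi s).
Proof.
move=> ht; have p : parity (~~ b) (fd xi ^^ t).
  by rewrite /parity gr_wedge gr_fd ht wedgeZr wedgeZl scalerA sgnN /= mulrN1.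
have d1 := isder_wedge (parity_fd xi) (isder_bracket ht);
  have d2 := isder_wedge ht (isder_br_dual xi).
rewrite addbF in d2; rewrite /= negbK in d1; have h := isder_lin (sgn b) d2 d1.
have dp := isder_bracket p; rewrite negbK in dp.
rewrite addrC.
apply: der_eq dp h _ _ s => [g|eta].
  rewrite (bracket_fc g p) (bracket_fc g ht) (der_wedge (isder_br_fun g))
    br_fun_fd br_dual_fc gr_fd /=.
  rewrite !wedgeE fwedgeC sgnN; apply: form_ext => x l; rewrite !formE; ring.
rewrite (bracket_fd eta p) (bracket_fd eta ht) (der_wedge (isder_br_dual eta))
  !br_dual_fd /gr.
rewrite (wedge_comm ht (parity_fd _)) scalerA andbT sgn_sgn scale1r.
by rewrite [br eta xi]la_anti fdN !wedgeE opprD opprK.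
Qed.

(** For a function or a 1-form in the second slot this is the definition of
    the bracket. The general case follows by [form_deg_ind] from the Leibniz
    rules in the two slots. *)
Lemma bracket_anti (i j : nat) s t : homog i s -> homog j t ->
  bracket s t = - (sgn (~~ odd i && ~~ odd j) *: bracket t s).
Proof.
move=> hs ht; have ps := parity_homog hs.
have D1 u v w : bracket (u + v) w = bracket u w + bracket v w.
  by have := bracket_linl 1 u v w; rewrite !scale1r.
have D2 u v w : bracket w (u + v) = bracket w u + bracket w v.
  by have := bracket_linr 1 u v w; rewrite !scale1r.
apply/eqP; rewrite -addr_eq0; apply/eqP.
apply: (form_deg_ind (D := fun j t => bracket s t + sgn (~~ odd i && ~~ odd j)
  *: bracket t s)) ht.
- by move=> k u v; rewrite D1 D2 scalerDr addrACA.
- move=> f; rewrite (bracket_fc f ps) bracket_fcl andbT sgnN scaleNr.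
  by rewrite subrr.
- move=> k f u hu; have pu := parity_homog hu.
  rewrite (der_fwedge (isder_bracket ps)) (bracket_fwedge f s pu) (bracket_fc f
    ps).
  rewrite (wedge_comm pu (parity_der (isder_br_fun f) ps)) !wedgeE.
  by case: (odd i); case: (odd k); apply: form_ext => x l;
    rewrite !(formE, fwedgeE) /=; ring.
- move=> k xi u hu h; have pu := parity_homog hu.
  rewrite (der_wedge (isder_bracket ps)) (bracket_dwedge xi s pu) (bracket_fd
    xi ps) gr_fd.
  rewrite (wedge_comm pu (parity_der (isder_br_dual xi) ps)).
  move/eqP: h; rewrite addr_eq0 => /eqP ->; rewrite !wedgeE /=.
  by case: (odd i); case: (odd k); apply: form_ext => x l; rewrite !formE /=;
    ring.
Qed.

Lemma bracket0l t : bracket 0 t = 0.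
Proof. by have := bracket_linl (-1) 0 0 t;
  rewrite scaler0 addr0 scaleN1r addNr. Qed.
Lemma bracket0r t : bracket t 0 = 0.
Proof. by have := bracket_linr (-1) 0 0 t;
  rewrite scaler0 addr0 scaleN1r addNr. Qed.
Lemma bracketZl a s t : bracket (a *: s) t = a *: bracket s t.
Proof. by have := bracket_linl a s 0 t; rewrite bracket0l !addr0. Qed.
Lemma bracketZr a s t : bracket s (a *: t) = a *: bracket s t.
Proof. by have := bracket_linr a t 0 s; rewrite bracket0r !addr0. Qed.
Lemma bracketNl s t : bracket (- s) t = - bracket s t.
Proof. by rewrite -scaleN1r bracketZl scaleN1r. Qed.
Lemma bracketNr s t : bracket s (- t) = - bracket s t.
Proof. by rewrite -scaleN1r bracketZr scaleN1r. Qed.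

Lemma bracket_antiz (i j : int) s t : homog i s -> homog j t ->
  bracket s t = - (sgn (~~ zodd i && ~~ zodd j) *: bracket t s).
Proof.
move=> hs ht; case: (homog_nat hs) => [->|[i' ei]].
  by rewrite bracket0l bracket0r scaler0 oppr0.
case: (homog_nat ht) => [->|[j' ej]].
  by rewrite bracket0l bracket0r scaler0 oppr0.
by move: hs ht; rewrite ei ej; exact: bracket_anti.
Qed.

Definition jacobiator (i j : int) s t u :=
  bracket s (bracket t u) - bracket (bracket s t) u -
  sgn (~~ zodd i && ~~ zodd j) *: bracket t (bracket s u).

Lemma jacobiator_swap12 (i j : int) s t u : homog i s -> homog j t ->
  jacobiator i j s t u =
    - (sgn (~~ zodd i && ~~ zodd j) *: jacobiator j i t s u).
Proof.
move=> hs ht; rewrite /jacobiator (bracket_antiz hs ht) bracketNl bracketZl.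
by case: (zodd i); case: (zodd j); apply: form_ext => x l; rewrite !formE /=;
  ring.
Qed.

(** Permuting the arguments changes the jacobiator by a sign. Therefore the
    derivation property in the last argument ([isder_jacobiator]) can be used
    for each of them. *)
Lemma jacobiator_swap23 (i j m : int) s t u : homog i s -> homog j t ->
  homog m u ->
  jacobiator i j s t u =
    - (sgn (~~ zodd j && ~~ zodd m) *: jacobiator i m s u t).
Proof.
move=> hs ht hu; rewrite /jacobiator (bracket_antiz ht hu) bracketNr bracketZr.
rewrite (bracket_antiz (bracket_homog hs ht) hu) (bracket_antiz ht
  (bracket_homog hs hu)).
rewrite !zoddD; case: (zodd i); case: (zodd j); case: (zodd m);
  by apply: form_ext => x l; rewrite !formE /=; ring.
Qed.

Lemma isder_jacobiator (i j : int) s t : homog i s -> homog j t ->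
  isder (~~ zodd i (+) ~~ zodd j) (jacobiator i j s t).
Proof.
move=> hs ht; have ps := parity_homogz hs; have pt := parity_homogz ht.
have h1 := isder_comm (isder_bracket ps) (isder_bracket pt).
have h2 := isder_bracket (parity_homogz (bracket_homog hs ht)).
(* the degrees of [{{s, t}, .}] and of the commutator of [{s, .}] and [{t, .}]
   agree *)
have e : ~~ zodd (i + j - 1) = ~~ zodd i (+) ~~ zodd j.
  by rewrite !zoddD; case: (zodd i); case: (zodd j).
rewrite e in h2; have := isder_lin (-1) h2 h1; congr isder.
apply/funext => u; rewrite /jacobiator; apply: form_ext => x l; rewrite !formE;
  ring.
Qed.

Lemma jacobiator_homog (i j m : int) s t u : homog i s -> homog j t ->
  homog m u ->
  homog (i + j + m - 2) (jacobiator i j s t u).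
Proof.
move=> hs ht hu; have h1 := bracket_homog hs (bracket_homog ht hu).
have h2 := bracket_homog (bracket_homog hs ht) hu.
have h3 := bracket_homog ht (bracket_homog hs hu).
have e1 : i + (j + m - 1) - 1 = i + j + m - 2 by ring.
have e2 : i + j - 1 + m - 1 = i + j + m - 2 by ring.
have e3 : j + (i + m - 1) - 1 = i + j + m - 2 by ring.
rewrite e1 in h1; rewrite e2 in h2; rewrite e3 in h3.
exact: (homogD (homogD h1 (homogN h2)) (homogN (homogZ h3))).
Qed.

(** For degree reasons only two cases are not trivial: three 1-forms, where
    this is the Jacobi identity of [B], and two 1-forms and a function, where
    it says that the anchor preserves brackets. *)
Lemma jacobiator_generators (i j m : nat) s t u : (i <= 1)%N -> (j <= 1)%N ->
  (m <= 1)%N ->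
  homog i s -> homog j t -> homog m u -> jacobiator i j s t u = 0.
Proof.
have hdd xi eta f : jacobiator 1 1 (fd xi) (fd eta) (fc f) = 0.
  rewrite /jacobiator !bracket_fdl !br_dual_fd !br_dual_fc bracket_fdl
    !br_dual_fc scale1r.
  by rewrite anchor_bracket fcD fcN; apply: form_ext => x l; rewrite !formE;
    ring.
have hdf xi f eta : jacobiator 1 0 (fd xi) (fc f) (fd eta) = 0.
  rewrite (jacobiator_swap23 (@homog_fd _ _ _ _ E xi) (@homog_fc _ _ _ _ E f)
    (@homog_fd _ _ _ _ E eta)).
  by rewrite hdd scaler0 oppr0.
case: i => [|[|i]] //; case: j => [|[|j]] //;
  case: m => [|[|m]] // _ _ _ hs ht hu;
  try by apply: (homog_lt0 _ (jacobiator_homog hs ht hu)).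
- rewrite (jacobiator_swap12 _ hs ht) [s](homog0_fc hs) [t](homog1_fd ht)
  [u](homog1_fd hu).
  by rewrite hdf scaler0 oppr0.
- rewrite [s](homog1_fd hs) [t](homog0_fc ht) [u](homog1_fd hu).
  exact: hdf.
- rewrite [s](homog1_fd hs) [t](homog1_fd ht) [u](homog0_fc hu).
  exact: hdd.
- rewrite [s](homog1_fd hs) [t](homog1_fd ht) [u](homog1_fd hu).
  rewrite /jacobiator !bracket_fdl !br_dual_fd bracket_fdl !br_dual_fd scale1r
    -!fdN -!fdD.
  by rewrite addrAC la_jac fd0.
Qed.

Lemma jacobiator_third (i j : nat) s t :
  homog i s -> homog j t ->
  (forall (m : nat) u, (m <= 1)%N -> homog m u -> jacobiator i j s t u = 0) ->
  forall u, jacobiator i j s t u = 0.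
Proof.
move=> hs ht h u; apply: der_eq (isder_jacobiator hs ht) (isder0 _ _) _ _ u =>
  [f|xi].
  by apply: (h 0%N) => //; exact: homog_fc.
by apply: (h 1%N) => //; exact: homog_fd.
Qed.

(** The degree bound of [jacobiator_generators] is removed from one argument
    after the other. *)
Lemma bracket_jacobi (i j m : nat) s t u : homog i s -> homog j t -> homog m u ->
  jacobiator i j s t u = 0.
Proof.
have J1 (a b : nat) v w z : (a <= 1)%N -> (b <= 1)%N -> homog a v ->
    homog b w -> jacobiator a b v w z = 0.
  move=> a1 b1 hv hw; apply: (jacobiator_third hv hw) => k y k1 hy.
  exact: jacobiator_generators hv hw hy.
have J2 (a b : nat) v w z : (a <= 1)%N -> homog a v -> homog b w ->
    jacobiator a b v w z = 0.
  move=> a1 hv hw; apply: (jacobiator_third hv hw) => k y k1 hy.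
  by rewrite (jacobiator_swap23 hv hw hy) J1 // scaler0 oppr0.
move=> hs ht hu; apply: (jacobiator_third hs ht) => k y k1 hy.
by rewrite (jacobiator_swap23 hs ht hy) (jacobiator_swap12 _ hs hy) J2 //
  !(scaler0, oppr0).
Qed.

Lemma bracket_poisson : poisson_bracket (-1) bracket.
Proof.
split.
- by move=> t a s u; exact: bracket_linl.
- by move=> s a t u; exact: bracket_linr.
- by move=> i j s t; exact: bracket_homog.
- move=> i j s t hs ht; rewrite (bracket_antiz hs ht) gsignE zoddM !zoddD.
  by rewrite !addbT.
- move=> i j m s t u hs ht hu; have ps := parity_homogz hs.
  rewrite (der_wedge (isder_bracket ps)) (gr_homogz _ ht) wedgeZl gsignE zoddM
    zoddD.
  by rewrite addbT.
- move=> i j m s t u hs ht hu; apply/eqP.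
  rewrite gsignE zoddM !zoddD !addbT -subr_eq0 opprD addrA -/(jacobiator i j s
    t u).
  case: (homog_nat hs) => [->|[i' ei]];
    first by rewrite /jacobiator !(bracket0l, bracket0r) scaler0 !subrr.
  case: (homog_nat ht) => [->|[j' ej]];
    first by rewrite /jacobiator !(bracket0l, bracket0r) scaler0 !subrr.
  case: (homog_nat hu) => [->|[m' em]];
    first by rewrite /jacobiator !(bracket0l, bracket0r) scaler0 !subrr.
  by move: hs ht hu; rewrite ei ej em => hs ht hu;
    rewrite (bracket_jacobi hs ht hu).
Qed.

Theorem gerstenhaber_exists : exists K : form E -> form E -> form E,
  is_gerstenhaber B K.
Proof.
exists bracket; split=> [|xi f|xi xi'].
- exact: bracket_poisson.
- by rewrite bracket_fdl br_dual_fc.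
- by rewrite bracket_fdl br_dual_fd.
Qed.

End Bracket.
End Gerstenhaber.

(** * Uniqueness, and the structures induced by a bracket *)

Section Uniqueness.
Variables (R : realType) (n : nat) (M : manifold R n) (r : nat).

Lemma bundle_map_ext (E : vbundle M r) (b b' : bundle_map_TM E) :
  (forall e f, bm_act b e f = bm_act b' e f) -> b = b'.
Proof.
move=> h; have bb x (v : E x) : b x v = b' x v.
  apply: tan_ext => f; have [e <-] := extend_vec v.
  exact: (congr1 (fun g : cinf M => g x) (h e f)).
case: b b' {h} bb => [b p q] [b' p' q'] /= bb.
have {}bb : b = b'.
  by apply: functional_extensionality_dep => x; apply/funext => v.
by rewrite bb in p q *; congr BundleMapTM; exact: Prop_irrelevance.
Qed.

Lemma algebroid_ext (E : vbundle M r) (A A' : lie_algebroid E) :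
  (forall e f, bm_act (la_anchor A) e f = bm_act (la_anchor A') e f) ->
  (forall e e', la_br A e e' = la_br A' e e') -> A = A'.
Proof.
move=> /bundle_map_ext h1 h2.
have {}h2 : la_br A = la_br A' by apply/funext => e; apply/funext.
case: A A' h1 h2 => [a b p1 p2 p3 p4 p5] [a' b' q1 q2 q3 q4 q5] /= h1 h2.
rewrite h1 h2 in p1 p2 p3 p4 p5 *.
by congr LieAlgebroid; exact: Prop_irrelevance.
Qed.

Variable E : vbundle M r.
Implicit Types (s t u : form E) (e : section E) (f g : cinf M).
Implicit Types (xi eta : section (dual E)) (b c : bool).
Local Notation fc := (form_of_cinf E).
Local Notation fd := (@form_of_dual R n M r E).
Local Notation "s ^^ t" := (wedge s t) (at level 40, left associativity).
Local Notation sgn := (sgn R).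
Local Arguments gr : simpl never.

Lemma differential_unique (A : lie_algebroid E) Q Q' :
  is_differential A Q -> is_differential A Q' -> Q = Q'.
Proof.
move=> [vQ hQ] [vQ' hQ']; have dQ := vf_isder vQ; have dQ' := vf_isder vQ'.
apply/funext; apply: form_add_ind => [|s t hs ht|k s hs].
- by rewrite (der0 dQ) (der0 dQ').
- by rewrite (derD dQ) (derD dQ') hs ht.
apply: (homog_eq (vf_degree vQ hs) (vf_degree vQ' hs)) => l sl.
have {}sl : size l = k.+1 by move: sl; rewrite -PoszD addn1 => -[].
by rewrite (hQ _ _ hs _ sl) (hQ' _ _ hs _ sl).
Qed.

Lemma differential_fc (A : lie_algebroid E) Q e f : is_differential A Q ->
  form_app (Q (fc f)) [:: e] = bm_act (la_anchor A) e f.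
Proof.
case=> _ h; rewrite (h 0%N _ (@homog_fc _ _ _ _ E f) [:: e]) //.
rewrite !big_ord_recl !big_ord0 /= !addr0 expr0 scale1r del0.
by rewrite fc_nil.
Qed.

Lemma differential_fd (A : lie_algebroid E) Q e e' xi : is_differential A Q ->
  form_app (Q (fd xi)) [:: e; e'] = bm_act (la_anchor A) e (pair xi e') -
    bm_act (la_anchor A) e' (pair xi e) - pair xi (la_br A e e').
Proof.
case=> _ h; rewrite (h 1%N _ (@homog_fd _ _ _ _ E xi) [:: e; e']) //.
rewrite !big_ord_recl !big_ord0 /= /bump leqnn addn0 /=.
rewrite /del /= !addr0 add0r expr0 scale1r !expr1 !scaleN1r.
by [].
Qed.

Lemma differential_inj (A A' : lie_algebroid E) Q :
  is_differential A Q -> is_differential A' Q -> A = A'.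
Proof.
move=> h h'; have ha e f : bm_act (la_anchor A) e f = bm_act (la_anchor A') e f.
  by rewrite -(differential_fc _ _ h) -(differential_fc _ _ h').
apply: algebroid_ext => // e e'; apply: sec_eq_pair => xi.
have := differential_fd e e' xi h; rewrite (differential_fd e e' xi h') !ha.
by move=> /addrI/oppr_inj.
Qed.

Section Poisson.
Variable K : form E -> form E -> form E.
Hypothesis pK : poisson_bracket (-1) K.

Lemma poisson_der (i : int) s : homog i s -> isder (~~ zodd i) (K s).
Proof.
move=> hs; apply: isder_homog => [a t u|j t ht|j k t u ht hu].
- exact: (pb_linear_r pK).
- rewrite (gr_homogz _ (pb_degree pK hs ht)) !zoddD /=.
  by congr (sgn _ *: _); rewrite /zodd /=; case: (odd _); case: (odd _).
- by rewrite (pb_leibniz pK hs ht hu) gsignE zoddM zoddD addbT.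
Qed.

Lemma poissonDl s s' t : K (s + s') t = K s t + K s' t.
Proof. by have := pb_linear_l pK t 1 s s'; rewrite !scale1r. Qed.

Lemma poisson_fc_fc f g : K (fc f) (fc g) = 0.
Proof.
by apply: (@homog_lt0 _ _ _ _ _ (0 + 0 - 1)) => //; apply: (pb_degree pK);
  exact: homog_fc.
Qed.

Lemma poisson_fd_fc xi f : homog 0 (K (fd xi) (fc f)).
Proof. exact: (pb_degree pK (@homog_fd _ _ _ _ E xi) (@homog_fc _ _ _ _ E f)).
  Qed.

Lemma poisson_fd_fd xi eta : homog 1 (K (fd xi) (fd eta)).
Proof. exact: (pb_degree pK (@homog_fd _ _ _ _ E xi) (@homog_fd _ _ _ _ E
  eta)). Qed.

Lemma poisson_anti (i j : int) s t : homog i s -> homog j t ->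
  K s t = - (sgn (~~ zodd i && ~~ zodd j) *: K t s).
Proof. by move=> hs ht;
  rewrite (pb_antisym pK hs ht) gsignE zoddM !zoddD !addbT. Qed.
End Poisson.

(** Agreement on generators spreads to the second argument by [der_eq], and
    from there to the first by antisymmetry. *)
Lemma gerstenhaber_unique (B : lie_algebroid (dual E)) K K' :
  is_gerstenhaber B K -> is_gerstenhaber B K' -> K = K'.
Proof.
move=> [pK h0 h1] [pK' h0' h1'].
have hd xi t : K (fd xi) t = K' (fd xi) t.
  have hx := @homog_fd _ _ _ _ E xi.
  apply: der_eq (poisson_der pK hx) (poisson_der pK' hx) _ _ t => [f|eta].
    by rewrite h0 h0'.
  by rewrite h1 h1'.
have hf f t : K (fc f) t = K' (fc f) t.
  have hx := @homog_fc _ _ _ _ E f.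
  apply: der_eq (poisson_der pK hx) (poisson_der pK' hx) _ _ t => [g|eta].
    by rewrite !poisson_fc_fc.
  have he := @homog_fd _ _ _ _ E eta.
  by rewrite (poisson_anti pK hx he) (poisson_anti pK' hx he) hd.
apply/funext => s; apply/funext => t; move: s.
apply: form_add_ind => [|s s' hs hs'|k s hs].
- by have := hf 0 t; rewrite fc0.
- by rewrite (poissonDl pK) (poissonDl pK') hs hs'.
apply: der_eq (poisson_der pK hs) (poisson_der pK' hs) _ _ t => [g|eta].
  have he := @homog_fc _ _ _ _ E g.
  by rewrite (poisson_anti pK hs he) (poisson_anti pK' hs he) hf.
have he := @homog_fd _ _ _ _ E eta.
by rewrite (poisson_anti pK hs he) (poisson_anti pK' hs he) hd.
Qed.

Lemma gerstenhaber_inj (B B' : lie_algebroid (dual E)) K :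
  is_gerstenhaber B K -> is_gerstenhaber B' K -> B = B'.
Proof.
move=> [_ h0 h1] [_ h0' h1']; apply: algebroid_ext => [xi f|xi eta].
  by apply: (@fc_inj _ _ _ _ E); rewrite -h0 h0'.
by apply: fd_inj; rewrite -h1 h1'.
Qed.

Section FromBracket.
Variable K : form E -> form E -> form E.
Hypothesis pK : poisson_bracket (-1) K.

Definition pb_act xi f := form_app (K (fd xi) (fc f)) [::].
Lemma pb_actE xi f : K (fd xi) (fc f) = fc (pb_act xi f).
Proof. by rewrite /pb_act fc_app //; exact: poisson_fd_fc. Qed.

(** Linearity over functions holds because functions commute: their bracket
    has degree -1. *)
Lemma pb_act_linl f g xi eta :
  pb_act (sec_mul g xi + eta) f = g * pb_act xi f + pb_act eta f.
Proof.
apply: (@fc_inj _ _ _ _ E);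
  rewrite -pb_actE fdD fdM (poissonDl pK) fcD fcM -!pb_actE; congr (_ + _).
have hf := @homog_fc _ _ _ _ E f; have hx := @homog_fd _ _ _ _ E xi.
have hgx := homog_wedge (@homog_fc _ _ _ _ E g) hx.
rewrite (poisson_anti pK hgx hf) (poisson_anti pK hx hf).
rewrite (der_fwedge (poisson_der pK hf)) (poisson_fc_fc pK) wedge0l add0r.
by rewrite wedgeNr wedgeZr add0r.
Qed.

Lemma pb_act_section f : exists w : section (dual (dual E)), forall xi, pair w
  xi = pb_act xi f.
Proof. by apply: form1_exists => g xi eta; exact: pb_act_linl. Qed.
(** The anchor as a section of the bidual, for a fixed function: it makes
    [{xi, f}] at [x] depend on [xi x] only. *)
Definition pb_act_dual f := sval (cid (pb_act_section f)).
Lemma pb_act_dualE f xi x : (pb_act_dual f x : 'Hom(dual E x, R^o)) (xi x) =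
  pb_act xi f x.
Proof.
have := congr1 (fun g : cinf M => g x) (svalP (cid (pb_act_section f)) xi).
exact.
Qed.

Section PAnchor.
Variables (x : M) (p : dual E x).
Definition pb_anchor_fun f : R := (pb_act_dual f x : 'Hom(dual E x, R^o)) p.
Fact pb_anchor_linear a f g :
  pb_anchor_fun (a *: f + g) = a * pb_anchor_fun f + pb_anchor_fun g.
Proof.
rewrite /pb_anchor_fun; have [xi <-] := extend_vec p;
  rewrite !pb_act_dualE /pb_act.
by rewrite fcD fcZ (pb_linear_r pK) form_appD form_appZ.
Qed.
Fact pb_anchor_leibniz f g :
  pb_anchor_fun (f * g) = f x * pb_anchor_fun g + pb_anchor_fun f * g x.
Proof.
rewrite /pb_anchor_fun; have [xi <-] := extend_vec p; rewrite !pb_act_dualE.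
have -> : pb_act xi (f * g) = f * pb_act xi g + pb_act xi f * g.
  apply: (@fc_inj _ _ _ _ E);
    rewrite -pb_actE fcM (der_fwedge (poisson_der pK (@homog_fd _ _ _ _ E xi))).
  by rewrite !pb_actE fcD !fcM addrC.
by rewrite !cinfE.
Qed.
Definition pb_anchor_tan : tangent x := Tangent pb_anchor_linear
  pb_anchor_leibniz.
End PAnchor.

Fact pb_anchor_bm_linear x : linear (@pb_anchor_tan x).
Proof. by move=> a u v; apply: tan_ext => f; exact: linearP. Qed.
Fact pb_anchor_bm_smooth F : vb_frame (dual E) F -> forall i f,
  smooth_on (lf_dom F) (fun x => pb_anchor_tan (tnth (lf_vec F x) i : dual E x)
    f).
Proof.
move=> EF i f; have oF := @lf_open _ _ _ _ F.
have EF' : vb_frame (dual (dual E)) (dual_frame (E := dual E) F) by exists F.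
apply: smooth_ext (secP (pb_act_dual f) EF' i) => // x Fx /=.
by rewrite coord_dual //; exact: lf_basis.
Qed.
Definition pb_anchor : bundle_map_TM (dual E) := BundleMapTM
  pb_anchor_bm_linear pb_anchor_bm_smooth.

Lemma pb_anchorE xi f : bm_act pb_anchor xi f = pb_act xi f.
Proof. by apply: cinf_ext => x; exact: pb_act_dualE. Qed.

Definition pb_section xi eta : section (dual E) := dpart (K (fd xi) (fd eta)).
Lemma fd_pb_section xi eta : fd (pb_section xi eta) = K (fd xi) (fd eta).
Proof. by rewrite /pb_section -homog1_fd //; exact: poisson_fd_fd. Qed.

Let K1 xi eta : K (fd xi) (fd eta) = - K (fd eta) (fd xi).
Proof.
by rewrite (poisson_anti pK (@homog_fd _ _ _ _ E xi) (@homog_fd _ _ _ _ E eta))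
  scale1r.
Qed.

Fact pb_section_Dl a xi xi' eta : pb_section (a *: xi + xi') eta = a *:
  pb_section xi eta + pb_section xi' eta.
Proof. by apply: fd_inj;
  rewrite fdD fdZ !fd_pb_section fdD fdZ (pb_linear_l pK). Qed.
Fact pb_section_Dr a xi xi' eta : pb_section eta (a *: xi + xi') = a *:
  pb_section eta xi + pb_section eta xi'.
Proof. by apply: fd_inj;
  rewrite fdD fdZ !fd_pb_section fdD fdZ (pb_linear_r pK). Qed.
Fact pb_section_alt xi : pb_section xi xi = 0.
Proof.
apply: fd_inj; rewrite fd0 fd_pb_section; apply: form_ext => x l.
have := congr1 (fun s : form E => s x l) (K1 xi xi); rewrite !formE; lra.
Qed.
Fact pb_section_jacobi xi eta zeta : pb_section xi (pb_section eta zeta) +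
  pb_section eta (pb_section zeta xi) + pb_section zeta (pb_section xi eta) = 0.
Proof.
apply: fd_inj; rewrite fd0 !fdD !fd_pb_section.
have h := @homog_fd _ _ _ _ E.
have := pb_jacobi pK (h xi) (h eta) (h zeta); rewrite gsignE scale1r => ->.
rewrite [K (fd zeta) (fd xi)]K1 -(fd_pb_section xi eta) [K (fd zeta) _]K1.
have -> : K (fd eta) (- K (fd xi) (fd zeta)) = - K (fd eta) (K (fd xi) (fd
  zeta)).
  by rewrite (derN (poisson_der pK (h eta))).
by apply: form_ext => x l; rewrite !formE; ring.
Qed.
Fact pb_section_leibniz f xi eta : pb_section xi (sec_mul f eta) =
  sec_mul f (pb_section xi eta) + sec_mul (bm_act pb_anchor xi f) eta.
Proof.
apply: fd_inj; rewrite fdD !fdM !fd_pb_section fdM pb_anchorE.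
by rewrite (der_fwedge (poisson_der pK (@homog_fd _ _ _ _ E xi))) pb_actE addrC.
Qed.

Definition dual_algebroid_of : lie_algebroid (dual E) :=
  LieAlgebroid pb_section_Dl pb_section_Dr pb_section_alt pb_section_jacobi
    pb_section_leibniz.

Lemma dual_algebroid_ofP : is_gerstenhaber dual_algebroid_of K.
Proof.
by split=> // [xi f|xi eta]; rewrite ?pb_anchorE ?pb_actE //= fd_pb_section.
Qed.
End FromBracket.

Lemma bialgebroid_ext (A A' : lie_bialgebroid E) :
  lb_E A = lb_E A' -> lb_dual A = lb_dual A' -> A = A'.
Proof.
case: A A' => [a b p] [a' b' p'] /= e e'; rewrite e e' in p *.
by congr LieBialgebroid; exact: Prop_irrelevance.
Qed.

Lemma PQ_ext (P P' : PQ_structure E) : pq_Q P = pq_Q P' -> pq_br P = pq_br P'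
  -> P = P'.
Proof.
case: P P' => [a b p1 p2 p3 p4] [a' b' q1 q2 q3 q4] /= e e';
  rewrite e e' in p1 p2 p3 p4 *.
by congr PQStructure; exact: Prop_irrelevance.
Qed.

Lemma PQ_of_bialgebroid (A : lie_bialgebroid E) : exists P, corresponds A P.
Proof.
have [Q [dQ _ _ QQ]] := differential_exists (lb_E A).
have [K gK] := gerstenhaber_exists (lb_dual A).
have [pK _ _] := gK; have [vQ _] := dQ.
by exists (PQStructure pK vQ QQ (lb_compat dQ gK)).
Qed.

Lemma bialgebroid_of_PQ (P : PQ_structure E) : exists A, corresponds A P.
Proof.
have vQ := pq_vector_field P; have dQ := vf_isder vQ.
have hA := algebroid_ofP dQ (vf_degree vQ) (pq_square0 P).
have hB := dual_algebroid_ofP (pq_poisson_bracket P).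
have compat Q K : is_differential (algebroid_of dQ (vf_degree vQ) (pq_square0
  P)) Q ->
    is_gerstenhaber (dual_algebroid_of (pq_poisson_bracket P)) K ->
      bracket_derivation Q K.
  move=> hQ hK; rewrite (differential_unique hQ hA) (gerstenhaber_unique hK hB).
  exact: pq_poisson.
by exists (LieBialgebroid compat).
Qed.

Lemma corresponds_PQ (A : lie_bialgebroid E) P P' :
  corresponds A P -> corresponds A P' -> P = P'.
Proof.
move=> [h1 h2] [h1' h2']; apply: PQ_ext;
  first exact: differential_unique h1 h1'.
exact: gerstenhaber_unique h2 h2'.
Qed.

Lemma corresponds_bialgebroid (A A' : lie_bialgebroid E) P :
  corresponds A P -> corresponds A' P -> A = A'.
Proof.
move=> [h1 h2] [h1' h2']; apply: bialgebroid_ext;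
  first exact: differential_inj h1 h1'.
exact: gerstenhaber_inj h2 h2'.
Qed.

End Uniqueness.

Theorem corollary1p19 (R : realType) (n : nat) (M : manifold R n) (r : nat)
    (E : vbundle M r) :
  exists F : lie_bialgebroid E -> PQ_structure E,
    bijective F /\
    (forall (A : lie_bialgebroid E) (P : PQ_structure E),
       corresponds A P <-> F A = P).
Proof.
have [F hF] := choice (@PQ_of_bialgebroid R n M r E).
have [G hG] := choice (@bialgebroid_of_PQ R n M r E).
exists F; split.
  exists G => [A|P]; first exact: corresponds_bialgebroid (hG (F A)) (hF A).
  exact: corresponds_PQ (hF (G P)) (hG P).
move=> A P; split=> [AP|<-]; last exact: hF.
exact: corresponds_PQ (hF A) AP.
Qed.
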